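(* Let $\mathsf M$ be the oriented matroid of the non-Pappus arrangement of pseudolines, and let $\mathcal Q$ be its tope-pairs poset. Then $\pi_1(|\mathcal Q|)$ is not isomorphic to the fundamental group of the complement $\mathbb C^r\setminus\bigcup_{H\in\mathscr A}H$ of any arrangement $\mathscr A$ of linear hyperplanes in any $\mathbb C^r$.
   Context: The non-Pappus matroid is the rank-three matroid on $\{1,\dots,9\}$ whose lines with at least three points are exactly $123,157,168,247,269,348,359,456$ (in particular $789$ is not a line); it is not realizable over any field. It is realized by an arrangement of pseudolines in the projective plane (Grünbaum's non-Pappus arrangement), whose associated rank-three oriented matroid is $\mathsf M$; its topes are the sign vectors in $\{+,-\}^{\{1,\dots,9\}}$ of the regions of the corresponding centrally symmetric pseudocircle arrangement on $S^2$. For topes, $S(X,Y)=\{f: X_f=-Y_f\neq0\}$; the tope-pairs poset $\mathcal Q$ is the set of pairs of topes with $(T,R)\le(T',R')$ iff $S(T',T)\subseteq S(T',R)\subseteq S(T',R')$, and $|\mathcal Q|$ is the geometric realization of its order complex. *)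

(* Defs.v *)
From HB Require Import structures.
From mathcomp Require Import all_boot all_order all_algebra.
From mathcomp Require Import all_classical all_reals all_analysis.
From mathcomp Require Import complex.
From mathcomp Require Import Rstruct Rstruct_topology.

Set Implicit Arguments.
Unset Strict Implicit.
Unset Printing Implicit Defensive.

Import Order.TTheory GRing.Theory Num.Theory.
Import numFieldNormedType.Exports.
Local Open Scope ring_scope.
Local Open Scope classical_set_scope.

Notation RR := Rdefinitions.R.

(* Ground set {1,...,9} is encoded as 'I_9 (element i+1 <-> ordinal i).      *)
(* We start from an explicit integer realization of the (standard) Pappus    *)
(* configuration: 1,2,3 on one line, 4,5,6 on another, 7 = 15 n 24,          *)
(* 8 = 16 n 34, 9 = 26 n 35, so that 7,8,9 are collinear (Pappus).           *)
(* The non-Pappus oriented matroid is obtained by "bending" the line 789:    *)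
(* its chirotope equals the Pappus chirotope on every ordered triple except   *)
(* the (ordered) triples formed by 7,8,9, where chi(7,8,9) = +1 (and chi is  *)
(* extended alternatingly).                                                  *)

Definition pappus_coords : seq (seq int) :=
  [:: [:: 0; 0; 1]; [:: 1; 0; 1]; [:: 3; 0; 1];
      [:: 0; 1; 1]; [:: 2; 1; 1]; [:: 5; 1; 1];
      [:: 2; 1; 3]; [:: 15; 3; 8]; [:: 13; 2; 5]]%Z.

Definition pappus_pt (e : 'I_9) (c : 'I_3) : int :=
  nth 0 (nth [::] pappus_coords e) c.

Definition det3 (u v w : 'I_3 -> int) : int :=
  u 0 * (v 1 * w 2 - v 2 * w 1) - u 1 * (v 0 * w 2 - v 2 * w 0)
  + u 2 * (v 0 * w 1 - v 1 * w 0).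

Definition pappus_det (i j k : 'I_9) : int :=
  det3 (pappus_pt i) (pappus_pt j) (pappus_pt k).

(* alternating correction on the triples made of 7,8,9 (ordinals 6,7,8):
   the sign of the permutation (i,j,k) of (7,8,9), computed as the
   determinant of the corresponding permutation matrix. *)
Definition is789 (i j k : 'I_9) : bool :=
  [&& 6 <= i, 6 <= j, 6 <= k & uniq [:: i; j; k]]%N.

Definition unit789 (e : 'I_9) (c : 'I_3) : int := ((e : nat) == c + 6)%N%:R.

Definition chi789 (i j k : 'I_9) : int :=
  det3 (unit789 i) (unit789 j) (unit789 k).

Definition chi (i j k : 'I_9) : int :=
  if is789 i j k then chi789 i j k else sgz (pappus_det i j k).

Definition signvec := 'I_9 -> int.

Definition compose (X Y : signvec) : signvec :=
  fun e => if X e != 0 then X e else Y e.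

(* For a rank-3 chirotope, the cocircuits are exactly the nonzero sign
   vectors e |-> chi(a,b,e) (a,b : E); when a,b are dependent this vector is
   zero, which is harmless below. *)
Definition cocirc (a b : 'I_9) : signvec := fun e => chi a b e.

Definition covector (X : signvec) : Prop :=
  exists s : seq ('I_9 * 'I_9),
    forall e, X e = foldr (fun ab acc => compose (cocirc ab.1 ab.2) acc)
                          (fun _ => 0) s e.

(* A tope is a covector with full support; we represent a full sign vector
   by T : {ffun 'I_9 -> bool} (true = '+', false = '-'). *)
Definition tvec := {ffun 'I_9 -> bool}.
Definition sv_of (T : tvec) : signvec := fun e => if T e then 1 else -1.
Definition is_tope (T : tvec) : Prop := covector (sv_of T).

(* S(X,Y) = { f : X_f = - Y_f <> 0 }; for full sign vectors: X_f <> Y_f. *)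
Definition sepset (X Y : tvec) : {set 'I_9} := [set f | X f != Y f].

Definition tpair := (tvec * tvec)%type.

Definition in_Q (p : tpair) : Prop := is_tope p.1 /\ is_tope p.2.

Definition Q_le (p q : tpair) : bool :=
  (sepset q.1 p.1 \subset sepset q.1 p.2) &&
  (sepset q.1 p.2 \subset sepset q.1 q.2).

(* |Q|: the points of R^{tpair} (product = Euclidean topology) that are
   convex combinations of the vertices of a chain of Q. *)
Definition realization_space := {ptws tpair -> RR}.

Definition geom_realization_Q : set realization_space :=
  [set x | (forall p, 0 <= x p) /\ (\sum_(p : tpair) x p = 1) /\
           (forall p, x p != 0 -> in_Q p) /\
           (forall p q, x p != 0 -> x q != 0 -> Q_le p q \/ Q_le q p)].

Definition CC := (RR)[i].
HB.instance Definition _ := PseudoPointedMetric.copy CC CC^o.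

Definition Cspace (r : nat) := {ptws 'I_r -> CC}.

(* A linear hyperplane in C^r is the zero set of a nonzero linear form
   z |-> \sum_i a_i z_i; an arrangement is a finite list of such forms. *)
Definition nonzero_form (r : nat) (a : 'I_r -> CC) : Prop := exists i, a i != 0.

Definition arrangement_complement (r : nat) (A : seq ('I_r -> CC))
  : set (Cspace r) :=
  [set z | forall a, a \in A -> \sum_(i < r) a i * z i != 0].

Section FundamentalGroup.
Context {T : topologicalType}.

Definition is_loop (S : set T) (x : T) (g : RR -> T) : Prop :=
  {within `[0, 1], continuous g} /\ g 0 = x /\ g 1 = x /\
  (forall t, 0 <= t <= 1 -> S (g t)).

Definition loop_homotopic (S : set T) (x : T) (g h : RR -> T) : Prop :=
  exists H : RR * RR -> T,
    {within `[0, 1] `*` `[0, 1], continuous H} /\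
    (forall t, 0 <= t <= 1 -> H (0, t) = g t /\ H (1, t) = h t) /\
    (forall s, 0 <= s <= 1 -> H (s, 0) = x /\ H (s, 1) = x) /\
    (forall s t, 0 <= s <= 1 -> 0 <= t <= 1 -> S (H (s, t))).

Definition loop_concat (g h : RR -> T) : RR -> T :=
  fun t => if t <= 2^-1 then g (2 * t) else h (2 * t - 1).

End FundamentalGroup.

(* pi_1(S1, x1) and pi_1(S2, x2) are isomorphic groups: there is a map on
   loops inducing a well-defined, injective, surjective homomorphism on
   homotopy classes. *)
Definition pi1_isomorphic {T1 T2 : topologicalType}
    (S1 : set T1) (x1 : T1) (S2 : set T2) (x2 : T2) : Prop :=
  exists f : (RR -> T1) -> (RR -> T2),
    (forall g, is_loop S1 x1 g -> is_loop S2 x2 (f g)) /\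
    (forall g h, is_loop S1 x1 g -> is_loop S1 x1 h ->
       (loop_homotopic S1 x1 g h <-> loop_homotopic S2 x2 (f g) (f h))) /\
    (forall k, is_loop S2 x2 k ->
       exists g, is_loop S1 x1 g /\ loop_homotopic S2 x2 (f g) k) /\
    (forall g h, is_loop S1 x1 g -> is_loop S1 x1 h ->
       loop_homotopic S2 x2 (f (loop_concat g h)) (loop_concat (f g) (f h))).

(* Main.v *)
(* Homomorphisms from a fundamental group G to the rationals form the space
   H^1(G); a pair (a, b) of them lifts to the rational Heisenberg group iff the
   cup product of a and b vanishes. Both for |Q| and for the complement of an
   arrangement, H^1 has a basis indexed by the ground set (crossing or winding
   numbers), the pairs (e_i - e_k, e_j - e_k) with i, j, k collinear lift, and
   a pair that lifts satisfies one linear condition for each element of each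
   rank-two flat, since the loop around the flat commutes with the meridians.

   For the non-Pappus matroid, the Pluecker relations show that a plane
   satisfying these conditions is the plane of sum-zero vectors supported on
   one of the eight lines. An isomorphism of the two groups therefore induces
   an isomorphism of the spaces H^1 which matches the planes of the lines of
   the arrangement with those of the eight lines. Three lines form a triangle
   iff their planes satisfy a linear relation, so the arrangement contains nine
   hyperplanes with the eight incidences of the non-Pappus configuration. By
   Pappus's theorem the last three are then collinear too, but no line is left
   to which this ninth collinear triple could correspond. *)

(* No presentation of either group is computed. A group is probed only through its representations
   in the rationals and in the rational Heisenberg group, obtained by developing local cocycles
   along paths. They are defined on the fundamental groupoid, because the meridians and the loops
   around flats have no common base point. The two sides are not symmetric. In general only a
   necessary condition for lifting is established. For the eight lines the Pluecker relations turn
   it into a classification, but an arrangement may have further planes that satisfy it, so a line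
   of the matroid cannot be sent back to the arrangement by the same reasoning. Instead, its 2-form
   is paired with a minor of the matrix on H^1: if no collinear triple were mapped to this line the
   pairing would vanish, while a direct evaluation gives 2. Nothing bounds the arrangement a priori.
   That at most three hyperplanes contain a flat of codimension two follows from the isomorphism,
   and forms spanning only a plane are a separate case of Pappus's theorem. *)
Require Import Defs.
From HB Require Import structures.
From mathcomp Require Import all_boot all_order all_algebra.
From mathcomp Require Import all_classical all_reals all_analysis.
From mathcomp Require Import complex.
From mathcomp Require Import Rstruct Rstruct_topology.
From mathcomp Require Import ring lra zify.
Set Implicit Arguments.
Unset Strict Implicit.
Unset Printing Implicit Defensive.
Import Order.TTheory GRing.Theory Num.Theory.
Import numFieldNormedType.Exports.
Local Open Scope ring_scope.
Local Open Scope classical_set_scope.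

(** * Paths and homotopies *)

Section Continuity.
Context {X : topologicalType}.
Implicit Types f g : X -> RR.

Lemma cont_id : continuous (@id X). Proof. by move=> x. Qed.
Lemma cont_cst (Y : topologicalType) (c : Y) : continuous (fun _ : X => c).
Proof. by move=> x; apply: cvg_cst. Qed.
Lemma cont_comp (Y Z : topologicalType) (f : Y -> Z) (g : X -> Y) :
  continuous g -> continuous f -> continuous (fun x => f (g x)).
Proof. by move=> cg cf x; apply: continuous_comp; [apply: cg | apply: cf]. Qed.
Lemma cont_add f g :
  continuous f -> continuous g -> continuous (fun x => f x + g x).
Proof. by move=> cf cg x; apply: (@cvgD _ RR^o); [apply: cf | apply: cg]. Qed.
Lemma cont_opp f : continuous f -> continuous (fun x => - f x).
Proof. by move=> cf x; apply: (@cvgN _ RR^o); apply: cf. Qed.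
Lemma cont_mul f g :
  continuous f -> continuous g -> continuous (fun x => f x * g x).
Proof. by move=> cf cg x; apply: (@cvgM RR); [apply: cf | apply: cg]. Qed.
Lemma cont_max f g :
  continuous f -> continuous g -> continuous (fun x => Num.max (f x) (g x)).
Proof. by move=> cf cg x; apply: continuous_max; [apply: cf | apply: cg]. Qed.
Lemma cont_min f g :
  continuous f -> continuous g -> continuous (fun x => Num.min (f x) (g x)).
Proof. by move=> cf cg x; apply: continuous_min; [apply: cf | apply: cg]. Qed.
Lemma cont_pair (Y Z : topologicalType) (f : X -> Y) (g : X -> Z) :
  continuous f -> continuous g -> continuous (fun x => (f x, g x)).
Proof. by move=> cf cg x; apply: cvg_pair; [apply: cf | apply: cg]. Qed.
Lemma cont_fst (Y Z : topologicalType) (f : X -> Y * Z) :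
  continuous f -> continuous (fun x => (f x).1).
Proof. by move=> cf; apply: cont_comp => // x; apply: cvg_fst. Qed.
Lemma cont_snd (Y Z : topologicalType) (f : X -> Y * Z) :
  continuous f -> continuous (fun x => (f x).2).
Proof. by move=> cf; apply: cont_comp => // x; apply: cvg_snd. Qed.

(** Where [p x] is nonzero only one branch is seen nearby; on the zero set of [p] both branches have
    the same value, so a neighbourhood that serves both of them is taken. *)
Lemma cont_glue (Y : topologicalType) (p : X -> RR) (f g : X -> Y) :
  continuous p -> continuous f -> continuous g ->
  (forall x, p x = 0 -> f x = g x) ->
  continuous (fun x => if p x <= 0 then f x else g x).
Proof.
move=> cp cf cg fg x W /= WW.
change (nbhs x [set y | W (if p y <= 0 then f y else g y)]); move: WW.
have [px|px|px] := ltgtP (p x) 0.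
- move=> /cf Wf; change (nbhs x [set y | W (f y)]) in Wf.
  have h : nbhs x [set y | p y < 0] := cp x [set r : RR | r < 0] (lt_nbhsl px).
  by apply: (filterS2 _ _ h Wf) => y /= /ltW ->.
- move=> /cg Wg; change (nbhs x [set y | W (g y)]) in Wg.
  have h : nbhs x [set y | 0 < p y] := cp x [set r : RR | 0 < r] (lt_nbhsr px).
  by apply: (filterS2 _ _ h Wg) => y /= /lt_geF ->.
- move=> Wx; have /cf Wf := Wx; change (nbhs x [set y | W (f y)]) in Wf.
  move: Wx; rewrite fg // => /cg Wg; change (nbhs x [set y | W (g y)]) in Wg.
  by apply: (filterS2 _ _ Wf Wg) => y /= ? ?; case: ifP.
Qed.

End Continuity.

Ltac cont := repeat lazymatch goal with
  | |- continuous (fun _ => ?c) => exact: cont_cst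
  | |- continuous (fun x => x) => exact: cont_id
  | |- continuous (fun x => GRing.add (@?f x) (@?g x)) => apply: cont_add
  | |- continuous (fun x => GRing.opp (@?f x)) => apply: cont_opp
  | |- continuous (fun x => GRing.mul (@?f x) (@?g x)) => apply: cont_mul
  | |- continuous (fun x => Num.max (@?f x) (@?g x)) => apply: cont_max
  | |- continuous (fun x => Num.min (@?f x) (@?g x)) => apply: cont_min
  | |- continuous (fun x => (@?f x, @?g x)) => apply: cont_pair
  | |- continuous (fun x => fst (@?f x)) => apply: cont_fst
  | |- continuous (fun x => snd (@?f x)) => apply: cont_snd
  | |- continuous GRing.opp => apply: cont_opp
  | |- continuous (GRing.add ?a) => apply: cont_add
  | |- continuous (GRing.mul ?a) => apply: cont_mul
  | |- continuous (Num.max ?a) => apply: cont_max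
  | |- continuous (Num.min ?a) => apply: cont_min
  | |- continuous (pair ?a) => apply: cont_pair
  | |- continuous fst => apply: cont_fst
  | |- continuous snd => apply: cont_snd
  | |- continuous _ => first [assumption | exact: cont_id]
  end.

Ltac clear_eq := repeat match goal with
  | H : @eq (Topological.sort _) _ _ |- _ => clear H end.
Ltac tlra := clear_eq; lra.

Definition clamp (t : RR) : RR := Num.max 0 (Num.min 1 t).

Lemma clamp_cont : continuous clamp.
Proof. by rewrite /clamp; cont. Qed.

Lemma clamp_id t : 0 <= t <= 1 -> clamp t = t.
Proof. by rewrite /clamp => ?; case: (lerP 1 t) => ?; case: lerP => ?; lra. Qed.

Lemma clamp_itv t : 0 <= clamp t <= 1.
Proof.
by rewrite /clamp le_max lexx ge_max ler01 ge_min lexx.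
Qed.

Lemma clamp0 : clamp 0 = 0. Proof. by apply: clamp_id; lra. Qed.
Lemma clamp1 : clamp 1 = 1. Proof. by apply: clamp_id; lra. Qed.

(** [clamp] retracts the line onto [0, 1], so precomposing with it trades continuity within the
    interval for continuity everywhere. *)
Lemma within_clamp (T : topologicalType) (g : RR -> T) :
  {within `[0, 1], continuous g} -> continuous (fun t => g (clamp t)).
Proof.
move=> /subspace_continuousP gc t W /= nW.
have := gc (clamp t); rewrite /= in_itv /= clamp_itv => /(_ isT W nW).
rewrite /nbhs /= /within => /= h.
have := @clamp_cont t _ h; rewrite /nbhs /=.
apply: filterS => s; apply; by rewrite /= in_itv /= clamp_itv.
Qed.

Lemma within_clamp2 (T : topologicalType) (H : RR * RR -> T) :
  {within `[0, 1] `*` `[0, 1], continuous H} ->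
  continuous (fun p : RR * RR => H (clamp p.1, clamp p.2)).
Proof.
move=> /subspace_continuousP gc t W /= nW.
have := gc (clamp t.1, clamp t.2).
have hin s : (`[0, 1] `*` `[0, 1])%classic (clamp s.1, clamp s.2 : RR).
  by split; rewrite /= in_itv /= clamp_itv.
move=> /(_ (hin t) W nW); rewrite /nbhs /= /within => /= h.
have cc : continuous (fun p : RR * RR => (clamp p.1, clamp p.2)).
  by apply: cont_pair; apply: cont_comp clamp_cont; cont.
have := cc t _ h; rewrite /nbhs /=.
by apply: filterS => s; apply; apply: hin.
Qed.

Section Paths.
Context {T : topologicalType}.
Implicit Types (S : set T) (x y z : T) (g h : RR -> T).

(* Paths and homotopies are parametrised by all of R and stay in S outside
   [0, 1] too, so that reparametrisations never have to be clamped. *)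
Definition path S x y g : Prop :=
  [/\ continuous g, g 0 = x, g 1 = y & forall t, S (g t)].

Definition htpy S x y g h : Prop :=
  exists H : RR * RR -> T,
    [/\ continuous H,
        forall t, 0 <= t <= 1 -> H (0, t) = g t /\ H (1, t) = h t,
        forall s, H (s, 0) = x /\ H (s, 1) = y
      & forall p, S (H p)].

Definition cst x : RR -> T := fun _ => x.
Definition rev g : RR -> T := fun t => g (1 - t).

Lemma path_clamp S x g : is_loop S x g -> path S x x (fun t => g (clamp t)).
Proof.
move=> [gc [g0 [g1 gS]]]; split; first exact: within_clamp.
- by rewrite clamp0.
- by rewrite clamp1.
- by move=> t; apply: gS; apply: clamp_itv.
Qed.

Lemma path_loop S x g : path S x x g -> is_loop S x g.
Proof.
move=> [gc g0 g1 gS]; split; first exact: continuous_subspaceT.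
by split.
Qed.

Lemma htpy_clamp S x g h : loop_homotopic S x g h ->
  htpy S x x (fun t => g (clamp t)) (fun t => h (clamp t)).
Proof.
move=> [H [Hc [H01 [Hx HS]]]]; exists (fun p => H (clamp p.1, clamp p.2)); split.
- exact: within_clamp2.
- by move=> t t01 /=; rewrite clamp0 clamp1; apply: H01; apply: clamp_itv.
- by move=> s /=; rewrite clamp0 clamp1; apply: Hx; apply: clamp_itv.
- by move=> p; apply: HS; apply: clamp_itv.
Qed.

Lemma htpy_loop S x g h : htpy S x x g h -> loop_homotopic S x g h.
Proof.
move=> [H [Hc H01 Hx HS]]; exists H; split; first exact: continuous_subspaceT.
by split=> //; split=> // s t _ _; apply: HS.
Qed.

Lemma htpy_eq S x y g h : path S x y g ->
  (forall t, 0 <= t <= 1 -> g t = h t) -> htpy S x y g h.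
Proof.
move=> [gc g0 g1 gS] gh; exists (fun p => g p.2); split.
- by apply: cont_comp gc; cont.
- by move=> t /gh.
- by [].
- by move=> p; apply: gS.
Qed.

Lemma htpy_refl S x y g : path S x y g -> htpy S x y g g.
Proof. by move=> pg; apply: htpy_eq. Qed.

Lemma htpy_sym S x y g h : htpy S x y g h -> htpy S x y h g.
Proof.
move=> [H [Hc H01 Hx HS]]; exists (fun p => H (1 - p.1, p.2)); split.
- by apply: cont_comp Hc; cont.
- move=> t t01; have [h0 h1] := H01 t t01.
  by rewrite /= subr0 subrr.
- by move=> s /=; apply: Hx.
- by move=> p; apply: HS.
Qed.

Lemma htpy_trans S x y g h k :
  htpy S x y g h -> htpy S x y h k -> htpy S x y g k.
Proof.
move=> [H [Hc H01 Hx HS]] [K [Kc K01 Kx KS]].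
(* On the seam [H] and [K] are only known to agree for times in [0, 1], hence the clamped time. *)
exists (fun p => if p.1 - 2^-1 <= 0 then H (2 * p.1, clamp p.2)
                 else K (2 * p.1 - 1, clamp p.2)); split.
- have cc : continuous (fun p : RR * RR => clamp p.2).
    by apply: cont_comp clamp_cont; cont.
  apply: cont_glue => [||| [s t] /= s12].
  + by cont.
  + by apply: cont_comp Hc; cont.
  + by apply: cont_comp Kc; cont.
  + have -> : 2 * s = 1 by tlra.
    rewrite subrr; have t01 := clamp_itv t.
    by rewrite (H01 _ t01).2 (K01 _ t01).1.
- move=> t t01 /=; rewrite clamp_id // mulr0 ifT; last by tlra.
  rewrite ifF; last by tlra.
  have -> : 2 * 1 - 1 = 1 :> RR by tlra.
  by rewrite (H01 _ t01).1 (K01 _ t01).2.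
- move=> s /=; rewrite clamp0 clamp1.
  by case: ifP => _; [apply: Hx | apply: Kx].
- by move=> p; case: ifP => _.
Qed.

Lemma path_cst S x : S x -> path S x x (cst x).
Proof. by move=> Sx; split=> //; apply: cont_cst. Qed.

Lemma path_rev S x y g : path S x y g -> path S y x (rev g).
Proof.
move=> [gc g0 g1 gS]; split; rewrite /rev ?subr0 ?subrr //.
by apply: cont_comp gc; cont.
Qed.

Lemma path_cat S x y z g h :
  path S x y g -> path S y z h -> path S x z (loop_concat g h).
Proof.
move=> [gc g0 g1 gS] [hc h0 h1 hS]; split.
- have -> : loop_concat g h =
      fun t => if t - 2^-1 <= 0 then g (2 * t) else h (2 * t - 1).
    by apply/funext => t; rewrite /loop_concat subr_le0.
  apply: cont_glue => [||| t t12]; first by cont.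
  + by apply: cont_comp gc; cont.
  + by apply: cont_comp hc; cont.
  + have -> : 2 * t = 1 by tlra.
    by rewrite subrr g1.
- by rewrite /loop_concat ifT ?mulr0 //; tlra.
- rewrite /loop_concat ifF; last by tlra.
  by have -> : 2 * 1 - 1 = 1 :> RR by tlra.
- by move=> t; rewrite /loop_concat; case: ifP.
Qed.

Lemma htpy_cat S x y z g g' h h' :
  htpy S x y g g' -> htpy S y z h h' ->
  htpy S x z (loop_concat g h) (loop_concat g' h').
Proof.
move=> [H [Hc H01 Hx HS]] [K [Kc K01 Kx KS]].
exists (fun p => if p.2 - 2^-1 <= 0 then H (p.1, 2 * p.2)
                 else K (p.1, 2 * p.2 - 1)); split.
- apply: cont_glue => [||| [s t] /= s12].
  + by cont.
  + by apply: cont_comp Hc; cont.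
  + by apply: cont_comp Kc; cont.
  + have -> : 2 * t = 1 by tlra.
    by rewrite subrr (Hx s).2 (Kx s).1.
- move=> t t01 /=; rewrite /loop_concat subr_le0; case: ifP => t12.
    by apply: H01; tlra.
  by apply: K01; tlra.
- move=> s /=; rewrite mulr0 ifT; last by tlra.
  rewrite ifF; last by tlra.
  have -> : 2 * 1 - 1 = 1 :> RR by tlra.
  by rewrite (Hx s).1 (Kx s).2.
- by move=> p; case: ifP => _.
Qed.

(** Two curves in the parameter plane with common ends are joined by the straight-line homotopy,
    which [F] carries into [S]. The groupoid laws below reduce to this: both paths are written as
    one map after two reparametrisations. *)
Lemma htpy_map2 S (F : RR * RR -> T) (u v : RR -> RR * RR) :
  continuous F -> (forall p, S (F p)) -> continuous u -> continuous v ->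
  u 0 = v 0 -> u 1 = v 1 ->
  htpy S (F (u 0)) (F (u 1)) (fun t => F (u t)) (fun t => F (v t)).
Proof.
move=> Fc FS uc vc uv0 uv1.
exists (fun p => F ((1 - p.1) * (u p.2).1 + p.1 * (v p.2).1,
                    (1 - p.1) * (u p.2).2 + p.1 * (v p.2).2)).
have cu : continuous (fun p : RR * RR => u p.2) by apply: cont_comp uc; cont.
have cv : continuous (fun p : RR * RR => v p.2) by apply: cont_comp vc; cont.
split=> //.
- by apply: cont_comp Fc; cont.
- move=> t _ /=; rewrite subr0 subrr !mul1r !mul0r !add0r !addr0.
  by rewrite -!surjective_pairing.
- move=> s /=; rewrite -uv0 -uv1 -!mulrDl subrK !mul1r.
  by rewrite -!surjective_pairing.
Qed.

Lemma htpy_map1 S x y (F : RR -> T) (u v : RR -> RR) :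
  continuous F -> (forall p, S (F p)) -> continuous u -> continuous v ->
  u 0 = v 0 -> u 1 = v 1 -> F (u 0) = x -> F (u 1) = y ->
  htpy S x y (fun t => F (u t)) (fun t => F (v t)).
Proof.
move=> Fc FS uc vc uv0 uv1 <- <-.
apply: (@htpy_map2 S (fun p => F p.1) (fun t => (u t, 0)) (fun t => (v t, 0))).
- by apply: cont_comp Fc; cont.
- by [].
- by cont.
- by cont.
- by rewrite uv0.
- by rewrite uv1.
Qed.

Lemma htpy_catA S x y z w a b c :
  path S x y a -> path S y z b -> path S z w c ->
  htpy S x w (loop_concat (loop_concat a b) c) (loop_concat a (loop_concat b c)).
Proof.
move=> pa pb pc; have [Fc F0 F1 FS] := path_cat (path_cat pa pb) pc.
(* The maximum is the piecewise linear map with slopes 1/2, 1, 2 that takes the breaks 1/2 and 3/4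
   of one bracketing to the breaks 1/4 and 1/2 of the other. *)
have -> : loop_concat a (loop_concat b c) = fun t =>
    loop_concat (loop_concat a b) c
      (Num.max (t * 2^-1) (Num.max (t - 4^-1) (2 * t - 1))).
  apply/funext => t; rewrite /loop_concat.
  case: (lerP (t - 4^-1) (2 * t - 1)) => h1;
    case: (lerP (t / 2)) => h2; do ! (case: ifP => ? //);
    solve [ by exfalso; tlra | by congr (a _); tlra | by congr (b _); tlra
          | by congr (c _); tlra ].
apply: (@htpy_map1 _ x w _ id); try by cont.
- by case: (lerP (0 - 4^-1)) => ?; case: lerP => ?; tlra.
- by case: (lerP (1 - 4^-1)) => ?; case: lerP => ?; tlra.
Qed.

Lemma htpy_catV S x y g : path S x y g ->
  htpy S x x (loop_concat g (rev g)) (cst x).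
Proof.
move=> [gc g0 g1 gS].
have -> : loop_concat g (rev g) = fun t => g (Num.min (2 * t) (2 - 2 * t)).
  apply/funext => t; rewrite /loop_concat /rev; case: (lerP (2 * t)) => h;
    case: ifP => ? //; try (by exfalso; tlra); by congr (g _); tlra.
have -> : cst x = fun t => g ((fun _ => 0) t) by apply/funext => t; rewrite g0.
apply: (@htpy_map1 _ x x g); try by cont.
- by case: lerP => ?; tlra.
- by case: lerP => ?; tlra.
- by rewrite -g0; congr (g _); case: lerP => ?; tlra.
- by rewrite -g0; congr (g _); case: lerP => ?; tlra.
Qed.

Lemma htpy_cat1 S x y g : path S x y g -> htpy S x y (loop_concat g (cst y)) g.
Proof.
move=> [gc g0 g1 gS].
have -> : loop_concat g (cst y) = fun t => g (Num.min (2 * t) 1).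
  apply/funext => t; rewrite /loop_concat /cst; case: (lerP (2 * t)) => h;
    case: ifP => ? //; by exfalso; tlra.
apply: (@htpy_map1 _ x y g _ id); try by cont.
- by case: lerP => ?; tlra.
- by case: lerP => ?; tlra.
- by rewrite -g0; congr (g _); case: lerP => ?; tlra.
- by rewrite -g1; congr (g _); case: lerP => ?; tlra.
Qed.

Lemma htpy_1cat S x y g : path S x y g -> htpy S x y (loop_concat (cst x) g) g.
Proof.
move=> [gc g0 g1 gS].
have -> : loop_concat (cst x) g = fun t => g (Num.max 0 (2 * t - 1)).
  apply/funext => t; rewrite /loop_concat /cst; case: (lerP 0) => h;
    case: ifP => ? //; first by rewrite -g0; congr (g _); tlra.
  by exfalso; tlra.
apply: (@htpy_map1 _ x y g _ id); try by cont.
- by case: lerP => ?; tlra.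
- by case: lerP => ?; tlra.
- by rewrite -g0; congr (g _); case: lerP => ?; tlra.
- by rewrite -g1; congr (g _); case: lerP => ?; tlra.
Qed.

Lemma path_clamp2 S x y g : path S x y g -> path S x y (fun t => g (clamp t)).
Proof.
move=> [gc g0 g1 gS]; split; rewrite ?clamp0 ?clamp1 //.
by apply: cont_comp gc; exact: clamp_cont.
Qed.

End Paths.

(** * Representations of the fundamental groupoid *)

Section Groupoid.
Context {T : topologicalType} {G : groupType}.
Implicit Types (S : set T) (x y z : T) (g h : RR -> T) (rho : (RR -> T) -> G).

Definition loop_rep S z rho : Prop :=
  (forall g h, is_loop S z g -> is_loop S z h -> loop_homotopic S z g h ->
     rho g = rho h) /\
  (forall g h, is_loop S z g -> is_loop S z h ->
     rho (loop_concat g h) = (rho g * rho h)%g).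

Definition grpd_rep S rho : Prop :=
  (forall x y g h, path S x y g -> path S x y h -> htpy S x y g h ->
     rho g = rho h) /\
  (forall x y z g h, path S x y g -> path S y z h ->
     rho (loop_concat g h) = (rho g * rho h)%g).

Definition path_connected S : Prop :=
  forall x y, S x -> S y -> exists g, path S x y g.

Lemma path_in S x y g : path S x y g -> S x /\ S y.
Proof. by move=> [_ <- <- gS]. Qed.

Lemma grpd_ext S z rho : S z -> path_connected S -> loop_rep S z rho ->
  exists2 R, grpd_rep S R & forall g, is_loop S z g ->
    R (fun t => g (clamp t)) = rho g.
Proof.
move=> Sz Sc [rhoH rhoM].
have /choice[tau tauP] x : exists g, S x -> path S z x g /\ (x = z -> g = cst z).
  have [->|xz] := pselect (x = z).
    by exists (cst z) => _; split=> //; apply: path_cst.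
  have [Sx|nSx] := pselect (S x); last by exists (cst z).
  by have [g gP] := Sc z x Sz Sx; exists g.
pose L g := loop_concat (loop_concat (tau (g 0)) g) (rev (tau (g 1))).
have tauE x : S x -> path S z x (tau x) by move=> /tauP[].
have rtE x : S x -> path S x z (rev (tau x)) by move=> /tauE/path_rev.
have rhoE g h : path S z z g -> path S z z h -> htpy S z z g h -> rho g = rho h.
  by move=> pg ph gh; apply: rhoH; [exact: path_loop|exact: path_loop|exact: htpy_loop].
have Lp x y g : path S x y g -> path S z z (L g).
  move=> pg; have [Sx Sy] := path_in pg; have [_ g0 g1 _] := pg.
  rewrite /L g0 g1; apply: path_cat (rtE _ Sy).
  exact: path_cat (tauE _ Sx) pg.
exists (fun g => rho (L g)); first split.
- move=> x y g h pg ph gh; apply: rhoE; [exact: Lp pg | exact: Lp ph |].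
  have [Sx Sy] := path_in pg; have [_ g0 g1 _] := pg; have [_ h0 h1 _] := ph.
  rewrite /L g0 g1 h0 h1; apply: htpy_cat (htpy_refl (rtE _ Sy)).
  exact: htpy_cat (htpy_refl (tauE _ Sx)) gh.
- move=> x y w g h pg ph.
  rewrite -rhoM; [| exact: path_loop (Lp _ _ _ pg)| exact: path_loop (Lp _ _ _ ph)].
  have [Sx Sy] := path_in pg; have [_ Sw] := path_in ph.
  have [_ g0 g1 _] := pg; have [_ h0 h1 _] := ph.
  have pgh := path_cat pg ph; have [_ gh0 gh1 _] := pgh.
  apply: rhoE; [exact: Lp pgh |
    exact: path_cat (Lp _ _ _ pg) (Lp _ _ _ ph) |].
  rewrite /L gh0 gh1 g0 g1 h0 h1.
  have pA := path_cat (tauE _ Sx) pg.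
  have ptB := path_cat (path_cat (tauE _ Sy) ph) (rtE _ Sw).
  have pB := path_cat ph (rtE _ Sw).
  apply: htpy_trans (htpy_sym (htpy_catA pA (rtE _ Sy) ptB)).
  apply: htpy_trans (htpy_trans _ _).
  + apply: (@htpy_trans _ _ _ _ _ (loop_concat (loop_concat (loop_concat
      (tau x) g) h) (rev (tau w)))).
      apply: htpy_cat (htpy_refl (rtE _ Sw)).
      exact: htpy_sym (htpy_catA (tauE _ Sx) pg ph).
    exact: htpy_catA pA ph (rtE _ Sw).
  + apply: (htpy_cat (htpy_sym (htpy_cat1 pA)) (htpy_refl pB)).
  (* The constant path at the middle point is replaced by a run along the tail and back, which
     splits the path into two loops at the base point. *)
  + have c1 : htpy S y y (cst y) (loop_concat (rev (tau y)) (tau y)).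
      have := htpy_sym (htpy_catV (rtE _ Sy)).
      suff -> : rev (rev (tau y)) = tau y by [].
      by apply/funext => t; rewrite /rev subKr.
    have pV := path_cat (rtE _ Sy) (tauE _ Sy).
    apply: (@htpy_trans _ _ _ _ _ (loop_concat (loop_concat (loop_concat
      (tau x) g) (loop_concat (rev (tau y)) (tau y)))
      (loop_concat h (rev (tau w))))).
      apply: htpy_cat (htpy_refl pB).
      exact: htpy_cat (htpy_refl pA) c1.
    apply: (@htpy_trans _ _ _ _ _ (loop_concat (loop_concat (loop_concat
      (loop_concat (tau x) g) (rev (tau y))) (tau y))
      (loop_concat h (rev (tau w))))).
      apply: htpy_cat (htpy_refl pB).
      exact: htpy_sym (htpy_catA pA (rtE _ Sy) (tauE _ Sy)).
    have pAr := path_cat pA (rtE _ Sy).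
    apply: (htpy_trans (htpy_catA pAr (tauE _ Sy) pB)).
    apply: (@htpy_trans _ _ _ _ _ (loop_concat (loop_concat (loop_concat
      (tau x) g) (rev (tau y))) (loop_concat (loop_concat (tau y) h) (rev (tau w))))).
      apply: htpy_cat (htpy_refl pAr) _.
      exact: htpy_sym (htpy_catA (tauE _ Sy) ph (rtE _ Sw)).
    exact: htpy_catA pA (rtE _ Sy) ptB.
- move=> g lg; have pg := path_clamp lg; rewrite /L clamp0 clamp1.
  have [_ [g0 [g1 _]]] := lg; rewrite g0 g1 (tauP z Sz).2 //.
  have -> : rev (cst z) = cst z by [].
  transitivity (rho (fun t => g (clamp t))).
    have p1 := path_cat (path_cst Sz) pg.
    apply: rhoE => //; first exact: path_cat p1 (path_cst Sz).
    exact: htpy_trans (htpy_cat1 p1) (htpy_1cat pg).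
  apply: rhoH => //; first exact: path_loop pg.
  apply: htpy_loop; apply: htpy_eq => // t t01.
  by rewrite clamp_id.
Qed.

Lemma grpd_loop S z rho : grpd_rep S rho ->
  loop_rep S z (fun g => rho (fun t => g (clamp t))).
Proof.
move=> [rhoH rhoM]; split=> [g h lg lh gh|g h lg lh].
  apply: rhoH (path_clamp lg) (path_clamp lh) (htpy_clamp gh).
have pg := path_clamp lg; have ph := path_clamp lh.
rewrite -(rhoM _ _ _ _ _ pg ph).
have pgh := path_cat pg ph.
suff e t : 0 <= t <= 1 -> loop_concat (fun t => g (clamp t))
    (fun t => h (clamp t)) t = loop_concat g h (clamp t).
  apply/esym; apply: (rhoH z z) => //; last exact: htpy_eq pgh e.
  have := path_clamp (path_loop pgh); congr path; apply/funext => s.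
  by rewrite e ?clamp_itv // clamp_id ?clamp_itv.
move=> t01; rewrite /loop_concat (clamp_id t01); case: ifP => t12.
  by rewrite clamp_id //; lra.
by rewrite clamp_id //; lra.
Qed.

Lemma grpd_cst S rho x : grpd_rep S rho -> S x -> rho (cst x) = 1%g.
Proof.
move=> [rhoH rhoM] Sx; have p := path_cst Sx.
have := rhoM _ _ _ _ _ p p.
rewrite (rhoH _ _ _ _ (path_cat p p) p (htpy_cat1 p)) => e.
by apply: (@mulgI _ (rho (cst x))); rewrite mulg1 -e.
Qed.

Lemma grpd_rev S rho x y g : grpd_rep S rho -> path S x y g ->
  rho (rev g) = (rho g)^-1%g.
Proof.
move=> rP pg; have [rhoH rhoM] := rP; have [Sx Sy] := path_in pg.
have := rhoM _ _ _ _ _ pg (path_rev pg).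
rewrite (rhoH _ _ _ _ (path_cat pg (path_rev pg)) (path_cst Sx) (htpy_catV pg)).
rewrite (grpd_cst rP Sx) => e.
by apply: (@mulgI _ (rho g)); rewrite -e mulgV.
Qed.

Lemma grpd_eq S rho x y g h : grpd_rep S rho -> path S x y g -> path S x y h ->
  (forall t, 0 <= t <= 1 -> g t = h t) -> rho g = rho h.
Proof. by move=> [rhoH _] pg ph e; apply: (rhoH x y) => //; apply: htpy_eq. Qed.

(** The two ways around the square are the images under [F] of two curves [u] and [v] in the
    parameter plane with the same ends. *)
Lemma grpd_square S rho (F : RR * RR -> T) : grpd_rep S rho ->
  continuous F -> (forall p, S (F p)) ->
  (rho (fun t => F (0, t)) * rho (fun s => F (s, 1%R)) =
   rho (fun s => F (s, 0)) * rho (fun t => F (1%R, t)))%g.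
Proof.
move=> [rhoH rhoM] Fc FS.
have pF (u : RR -> RR * RR) : continuous u ->
    path S (F (u 0)) (F (u 1)) (fun t => F (u t)).
  by move=> uc; split=> //; apply: cont_comp Fc.
have p1 := pF (fun t => (0, t)) (ltac:(cont)).
have p2 := pF (fun s => (s, 1)) (ltac:(cont)).
have p3 := pF (fun s => (s, 0)) (ltac:(cont)).
have p4 := pF (fun t => (1, t)) (ltac:(cont)).
rewrite -(rhoM _ _ _ _ _ p1 p2) -(rhoM _ _ _ _ _ p3 p4).
apply: (rhoH (F (0, 0)) (F (1, 1))); [exact: path_cat p1 p2|exact: path_cat p3 p4|].
pose u (t : RR) : RR * RR := (Num.max 0 (2 * t - 1), Num.min (2 * t) 1).
pose v (t : RR) : RR * RR := (Num.min (2 * t) 1, Num.max 0 (2 * t - 1)).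
have -> : loop_concat (fun t => F (0, t)) (fun s => F (s, 1)) = fun t => F (u t).
  apply/funext => t; rewrite /loop_concat /u; case: (lerP 0) => ?;
    case: (lerP (2 * t)) => ?; case: ifP => ? //; try (by exfalso; lra);
    by congr (F (_, _)); lra.
have -> : loop_concat (fun s => F (s, 0)) (fun t => F (1, t)) = fun t => F (v t).
  apply/funext => t; rewrite /loop_concat /v; case: (lerP 0) => ?;
    case: (lerP (2 * t)) => ?; case: ifP => ? //; try (by exfalso; lra);
    by congr (F (_, _)); lra.
have u0 : u 0 = (0, 0).
  by rewrite /u; congr (_, _); case: lerP => ?; lra.
have u1 : u 1 = (1, 1).
  by rewrite /u; congr (_, _); case: lerP => ?; lra.
have v0 : v 0 = (0, 0).
  by rewrite /v; congr (_, _); case: lerP => ?; lra.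
have v1 : v 1 = (1, 1).
  by rewrite /v; congr (_, _); case: lerP => ?; lra.
rewrite -u0 -u1; apply: htpy_map2; rewrite ?u0 ?u1 ?v0 ?v1 //.
- by rewrite /u; cont.
- by rewrite /v; cont.
Qed.

Definition sub g (a b : RR) : RR -> T := fun t => g (a + t * (b - a)).

Lemma path_sub S x y g a b : path S x y g -> path S (g a) (g b) (sub g a b).
Proof.
move=> [gc g0 g1 gS]; split; rewrite /sub ?mul0r ?addr0 ?mul1r 1?addrC ?subrK //.
by apply: cont_comp gc; cont.
Qed.

(** The parameters may come in any order: the homotopy slides the argument of [g] along the line,
    where backtracking can be contracted. *)
Lemma grpd_sub S rho x y g a b d : grpd_rep S rho -> path S x y g ->
  rho (sub g a d) = (rho (sub g a b) * rho (sub g b d))%g.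
Proof.
move=> [rhoH rhoM] pg; have [gc g0 g1 gS] := pg.
have pab := path_sub a b pg; have pbd := path_sub b d pg.
rewrite -(rhoM _ _ _ _ _ pab pbd).
apply: (rhoH (g a) (g d)); [exact: path_sub pg | exact: path_cat pab pbd |].
have -> : loop_concat (sub g a b) (sub g b d) = fun t =>
    g (a + Num.min (2 * t) 1 * (b - a) + Num.max 0 (2 * t - 1) * (d - b)).
  apply/funext => t; rewrite /loop_concat /sub; case: (lerP 0) => ?;
    case: (lerP (2 * t)) => ?; case: ifP => ? //; try (by exfalso; clear_eq; lra).
  + congr g; have -> : 2 * t = 1 by clear_eq; lra.
    by ring.
  + by congr g; clear_eq; ring.
  + by congr g; clear_eq; ring.
apply: (@htpy_map1 _ _ _ _ g); try by cont.
- by case: (lerP (2 * 0)) => ?; case: lerP => ?; clear_eq; lra.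
- by case: (lerP (2 * 1)) => ?; case: lerP => ?; clear_eq; lra.
- by congr g; clear_eq; ring.
- by congr g; clear_eq; ring.
Qed.

Lemma grpd_sub01 S rho x y g : grpd_rep S rho -> path S x y g ->
  rho (sub g 0 1) = rho g.
Proof.
move=> rP pg; have [gc g0 g1 gS] := pg; apply: (grpd_eq rP _ pg).
  by have := path_sub 0 1 pg; rewrite g0 g1.
by move=> t _; rewrite /sub subr0 mulr1 add0r.
Qed.

End Groupoid.

(** * Monodromy of local cocycles *)

Section Monodromy.
Context {T : topologicalType}.
Implicit Types (S V : set T) (g h : RR -> T).

(** Compactness of the square yields a Lebesgue number [e], and cells of side [1/N] below [e] are
    small enough. *)
Lemma grid_cover S (P : set T -> Prop) (H : RR * RR -> T) : continuous H ->
  (forall p, S (H p)) -> (forall x, S x -> exists2 V, nbhs x V & P V) ->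
  exists2 N, (0 < N)%N & forall i j, (i < N)%N -> (j < N)%N -> exists2 V, P V &
    forall s t : RR, i%:R / N%:R <= s <= i.+1%:R / N%:R ->
      j%:R / N%:R <= t <= j.+1%:R / N%:R -> V (H (s, t)).
Proof.
move=> Hc HS cov.
pose K : set (RR * RR) := `[0, 1] `*` `[0, 1].
have /compact_near_coveringP Kc : compact K.
  by apply: compact_setX; apply: segment_compact.
pose Q (e : RR) (p : RR * RR) := exists2 V, P V &
  forall q, `|q.1 - p.1| < e -> `|q.2 - p.2| < e -> V (H q).
have : \forall e \near 0^'+, K `<=` Q e.
  apply: Kc => p _.
  have [V nV PV] := cov _ (HS p).
  have := Hc p _ nV => /=.
  change (nbhs p [set q | V (H q)] -> \forall x' \near p & i \near 0^'+, Q i x').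
  move=> /nbhs_ballP[d /= d0 dV].
  have d2 : 0 < d / 2 by rewrite divr_gt0.
  exists (ball p (d / 2), [set e : RR | e < d / 2]).
    split; first exact: nbhsx_ballx.
    exact: nbhs_right_lt.
  case=> q e [/= [q1 q2] ed]; exists V => // r r1 r2; apply: dV.
  rewrite /ball /= in q1 q2; split; rewrite /ball /=.
    have -> : p.1 - r.1 = (p.1 - q.1) - (r.1 - q.1) by ring.
    by apply: (le_lt_trans (ler_normB _ _)); lra.
  have -> : p.2 - r.2 = (p.2 - q.2) - (r.2 - q.2) by ring.
  by apply: (le_lt_trans (ler_normB _ _)); lra.
move=> near_e.
have [e [e0 He]] : exists e : RR, 0 < e /\ K `<=` Q e.
  near (0^'+ : set_system RR) => e; exists e; split; last by near: e.
  by near: e; apply: nbhs_right_gt.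
pose N := (Num.bound (e^-1)).+1.
have N0 : (0 < N%:R :> RR) by rewrite ltr0n.
have Ne : N%:R^-1 < e.
  rewrite -[ltRHS]invrK ltf_pV2 ?posrE ?invr_gt0 //.
  apply: (lt_le_trans (archi_boundP _)); first by rewrite invr_ge0 ltW.
  by rewrite ler_nat.
exists N => // i j iN jN.
have inK k : (k < N)%N -> 0 <= (k%:R / N%:R : RR) <= 1.
  move=> kN; rewrite divr_ge0 ?ler0n //= ler_pdivrMr // mul1r ler_nat.
  exact: ltnW.
have [|V PV HV] := He (i%:R / N%:R, j%:R / N%:R).
  by split; rewrite /= in_itv /=; apply: inK.
exists V => // s t sP tP; apply: HV => /=.
  move: sP; rewrite -addn1 natrD mulrDl mul1r => sP.
  by rewrite ger0_norm; lra.
move: tP; rewrite -addn1 natrD mulrDl mul1r => tP.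
by rewrite ger0_norm; lra.
Unshelve. all: by end_near. Qed.

Lemma path_cover S (P : set T -> Prop) g : continuous g -> (forall t, S (g t)) ->
  (forall x, S x -> exists2 V, nbhs x V & P V) ->
  exists2 N, (0 < N)%N & forall i, (i < N)%N -> exists2 V, P V &
    forall t : RR, i%:R / N%:R <= t <= i.+1%:R / N%:R -> V (g t).
Proof.
move=> gc gS cov.
have cc : continuous (fun p : RR * RR => g p.1) by apply: cont_comp gc; cont.
have [N N0 HN] := grid_cover cc (fun p => gS p.1) cov.
exists N => // i iN; have [V PV HV] := HN i 0 iN N0.
exists V => // t tP; apply: (HV t 0) => //.
by rewrite mul0r lexx mul1r invr_ge0 ler0n.
Qed.

Context {G : groupType}.
Implicit Types (c : T -> T -> G) (f : nat -> G).

Fixpoint gprod f n : G := if n is m.+1 then (gprod f m * f m)%g else 1%g.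

Lemma eq_gprod f f' n : (forall i, (i < n)%N -> f i = f' i) ->
  gprod f n = gprod f' n.
Proof.
elim: n => //= n IH e; rewrite IH ?e // => i iN; apply: e.
exact: ltnW.
Qed.

Lemma gprod_add f m n :
  gprod f (m + n) = (gprod f m * gprod (fun i => f (m + i)%N) n)%g.
Proof.
by elim: n => [|n IH]; rewrite ?addn0 ?mulg1 // addnS /= IH mulgA.
Qed.

Lemma gprod_mul f m n :
  gprod f (m * n) = gprod (fun i => gprod (fun j => f (i * n + j)%N) n) m.
Proof. by elim: m => [|m IH] //=; rewrite mulSnr gprod_add IH. Qed.

(** Along a fine subdivision the factors [F] at interior points cancel. Representations are
    identified by this criterion below: they are compared on short paths, up to a change of frame
    [F]. *)
Lemma grpd_local S (rho sigma : (RR -> T) -> G) (F : T -> G) :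
  grpd_rep S rho -> grpd_rep S sigma ->
  (forall x, S x -> exists2 V, nbhs x V & forall y z g, path S y z g ->
     (forall t, 0 <= t <= 1 -> V (g t)) ->
     rho g = ((F y)^-1 * sigma g * F z)%g) ->
  forall x y g, path S x y g -> rho g = ((F x)^-1 * sigma g * F y)%g.
Proof.
move=> rP sP loc x y g pg; have [gc g0 g1 gS] := pg.
have [N N0 HN] := path_cover gc gS loc.
have N0' : (0 < N%:R :> RR) by rewrite ltr0n.
pose q (n : nat) : RR := n%:R / N%:R.
have key n : (n <= N)%N -> rho (sub g 0 (q n)) =
    ((F x)^-1 * sigma (sub g 0 (q n)) * F (g (q n)))%g.
  rewrite /q; elim: n => [_|n IH nN].
    have -> : sub g 0 (0%:R / N%:R) = cst x.
      by apply/funext => t; rewrite /sub mul0r subrr mulr0 addr0 g0.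
    have Sx := (path_in pg).1.
    rewrite (grpd_cst rP Sx) (grpd_cst sP Sx) mulg1 mul0r g0.
    by rewrite mulVg.
  rewrite (grpd_sub 0 (n%:R / N%:R) _ rP pg) (grpd_sub 0 (n%:R / N%:R) _ sP pg).
  rewrite (IH (ltnW nN)).
  have [V HV VP] := HN n nN.
  rewrite (HV _ _ _ (path_sub (n%:R / N%:R) (n.+1%:R / N%:R) pg)).
    by rewrite !mulgA mulgK.
  move=> t t01; apply: VP; rewrite -[n.+1]addn1 natrD mulrDl mul1r.
  have : 0 < N%:R^-1 :> RR by rewrite invr_gt0.
  move: (N%:R^-1) => w w0; nra.
have := key N (leqnn _).
rewrite /q divff ?gt_eqF // g1.
by rewrite (grpd_sub01 rP pg) (grpd_sub01 sP pg).
Qed.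

Definition cocycle_on S c V : Prop := forall a b d, V a -> V b -> V d ->
  S a -> S b -> S d -> (c a b * c b d = c a d)%g.

Definition local_cocycle S c : Prop :=
  forall x, S x -> exists2 V, nbhs x V & cocycle_on S c V.

Lemma cocycle_refl S c V x : cocycle_on S c V -> V x -> S x -> c x x = 1%g.
Proof.
move=> cV Vx Sx; apply: (@mulgI _ (c x x)).
by rewrite mulg1 cV.
Qed.

Definition fine_for S c N g : Prop := (0 < N)%N /\ forall i, (i < N)%N ->
  exists2 V, cocycle_on S c V &
    forall t : RR, i%:R / N%:R <= t <= i.+1%:R / N%:R -> V (g t).

Definition develop c N g : G :=
  gprod (fun i => c (g (i%:R / N%:R)) (g (i.+1%:R / N%:R))) N.

Lemma natr_split (N M i j : nat) : (0 < N)%N -> (0 < M)%N ->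
  (i * M + j)%:R / (N * M)%:R = i%:R / N%:R + j%:R / (N * M)%:R :> RR.
Proof.
move=> N0 M0; rewrite !natrM !natrD mulrDl natrM.
have N0' : N%:R != 0 :> RR by rewrite pnatr_eq0 -lt0n.
have M0' : M%:R != 0 :> RR by rewrite pnatr_eq0 -lt0n.
by field; rewrite N0' M0'.
Qed.

(** The new steps inside one old step stay in a set where [c] is a cocycle, so their product
    telescopes. *)
Lemma develop_refine S c N M g : (forall t, S (g t)) -> (0 < M)%N ->
  fine_for S c N g ->
  fine_for S c (N * M) g /\ develop c (N * M) g = develop c N g.
Proof.
move=> gS M0 [N0 gN].
have N0' : 0 < N%:R :> RR by rewrite ltr0n.
have M0' : 0 < M%:R :> RR by rewrite ltr0n.
have NM0 : 0 < (N * M)%:R :> RR by rewrite ltr0n muln_gt0 N0.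
have bnd i j : (j <= M)%N ->
    i%:R / N%:R <= ((i * M + j)%:R / (N * M)%:R : RR) <= i.+1%:R / N%:R.
  move=> jM; rewrite natr_split // lerDl divr_ge0 ?ler0n //=.
  rewrite -addn1 natrD mulrDl lerD2l mul1r ler_pdivrMr //.
  by rewrite natrM mulrA mulVf ?mul1r ?ler_nat // gt_eqF.
split.
  split; first by rewrite muln_gt0 N0.
  move=> k kNM; have iN : (k %/ M < N)%N by rewrite ltn_divLR.
  have [V cV VP] := gN _ iN; exists V => // t tP; apply: VP.
  have jM : (k %% M < M)%N by rewrite ltn_mod.
  have /andP[b1 _] := bnd (k %/ M)%N _ (ltnW jM).
  have /andP[_ b2] := bnd (k %/ M)%N _ jM.
  rewrite -divn_eq in b1.
  rewrite addnS -divn_eq in b2.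
  move/andP: tP => [t1 t2].
  by rewrite (le_trans b1 t1) (le_trans t2 b2).
rewrite /develop gprod_mul; apply: eq_gprod => i iN.
have [V cV VP] := gN _ iN.
have -> : i.+1%:R / N%:R = (i * M + M)%:R / (N * M)%:R :> RR.
  rewrite natr_split // -addn1 natrD mulrDl mul1r natrM; congr (_ + _).
  by field; rewrite !gt_eqF.
suff key n : (n <= M)%N ->
    gprod (fun j => c (g ((i * M + j)%:R / (N * M)%:R))
       (g ((i * M + j).+1%:R / (N * M)%:R))) n =
    c (g (i%:R / N%:R)) (g ((i * M + n)%:R / (N * M)%:R)) by exact: key.
elim: n => [_|n IH nM] /=.
  rewrite addn0 natrM natrM -mulf_div divff ?gt_eqF // mulr1.
  rewrite (cocycle_refl cV) //; apply: VP.
  by rewrite lexx ler_pM2r ?invr_gt0 // ler_nat leqnSn.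
rewrite IH 1?ltnW // -addnS (cV (g (i%:R / N%:R))) //; apply: VP; try exact: bnd.
- by have := bnd i 0 isT; rewrite addn0 natrM natrM -mulf_div divff ?gt_eqF // mulr1.
- by apply: bnd; apply: ltnW.
Qed.

(** The value on a path is the product of [c] along a fine subdivision. Common refinements show that
    it does not depend on the subdivision; a homotopy is cut into small squares, and one row of the
    grid is pushed to the next. *)
Theorem monodromy S c : local_cocycle S c ->
  exists2 R : (RR -> T) -> G, grpd_rep S R &
    forall x y g V, path S x y g -> cocycle_on S c V ->
      (forall t, 0 <= t <= 1 -> V (g t)) -> R g = c x y.
Proof.
move=> cS.
have fineE g : continuous g -> (forall t, S (g t)) -> exists N, fine_for S c N g.
  move=> gc gS; have [N N0 HN] := path_cover gc gS cS.
  by exists N.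
have uniqN g N N' : (forall t, S (g t)) -> fine_for S c N g ->
    fine_for S c N' g -> develop c N g = develop c N' g.
  move=> gS fN fN'; have [N0 _] := fN; have [N0' _] := fN'.
  rewrite -(develop_refine gS N0' fN).2 -(develop_refine gS N0 fN').2.
  by rewrite mulnC.
(* The value shared by all fine subdivisions; the default 1 is taken only by maps that have none. *)
have /choice[R RP] g : exists v : G, (forall t, S (g t)) -> forall N,
    fine_for S c N g -> v = develop c N g.
  have [[N fN]|nf] := pselect (exists N, fine_for S c N g).
    by exists (develop c N g) => gS N' fN'; apply: uniqN fN'.
  by exists 1%g => gS N fN; case: nf; exists N.
exists R; first split.
- move=> x y g h [gc g0 g1 gS] [hc h0 h1 hS] [H [Hc H01 Hx HS]].
  have [N N0 HN] := grid_cover Hc HS cS.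
  have N0' : 0 < N%:R :> RR by rewrite ltr0n.
  pose row j t := H (j%:R / N%:R, t).
  have in01 i : (i <= N)%N -> 0 <= (i%:R / N%:R : RR) <= 1.
    move=> iN; rewrite divr_ge0 ?ler0n //= ler_pdivrMr // mul1r.
    by rewrite ler_nat.
  have ends j : (j%:R / N%:R <= (j%:R / N%:R : RR) <= j.+1%:R / N%:R)
     /\ (j%:R / N%:R <= (j.+1%:R / N%:R : RR) <= j.+1%:R / N%:R).
    by rewrite !lexx ler_pM2r ?invr_gt0 // ler_nat leqnSn.
  have dev_row j : (j <= N)%N -> develop c N (row 0%N) = develop c N (row j).
    elim: j => // j IH jN; rewrite IH; last exact: ltnW.
    pose q (n : nat) : RR := n%:R / N%:R.
    (* The partial products along two consecutive rows differ by the vertical step at column [n]; at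
       the last column this step is trivial because the homotopy fixes the end point. *)
    suff key n : (n <= N)%N ->
      (gprod (fun i => c (row j (q i)) (row j (q i.+1))) n
        * c (row j (q n)) (row j.+1 (q n)) =
       gprod (fun i => c (row j.+1 (q i)) (row j.+1 (q i.+1))) n)%g.
      have := key N (leqnn _); rewrite /q divff ?gt_eqF // /row.
      rewrite !(Hx _).2.
      have [V cV VP] := HN j N.-1 jN (ltac:(by rewrite prednK)).
      rewrite [c y y](cocycle_refl cV) ?mulg1 //.
        rewrite -(Hx (j%:R / N%:R)).2; apply: VP; first exact: (ends j).1.
        rewrite prednK // divff ?gt_eqF // lexx andbT.
        by rewrite ler_pdivrMr // mul1r ler_nat leq_pred.
      by rewrite -(Hx 0).2.
    rewrite /q; elim: n => [_|n IHn nN] /=.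
      rewrite mul0r /row !(Hx _).1 mul1g.
      have [V cV VP] := HN j 0%N jN N0.
      apply: (cocycle_refl cV); last by rewrite -(Hx 0).1.
      rewrite -(Hx (j%:R / N%:R)).1; apply: VP; first exact: (ends j).1.
      by rewrite mul0r lexx divr_ge0 ?ler0n.
    rewrite -IHn; last exact: ltnW.
    have [V cV VP] := HN j n jN nN.
    have [e1 e2] := ends j; have [f1 f2] := ends n.
    rewrite -!mulgA; congr (_ * _)%g.
    by rewrite !cV //; solve [exact: HS | by apply: VP].
  have fine_row j (f : RR -> T) : (j <= N)%N ->
      (forall t, 0 <= t <= 1 -> row j t = f t) ->
      fine_for S c N f.
    move=> jN e; split=> // i iN.
    (* Row [N] is the far side of the last row of cells, so it uses the cells of index [N.-1]. *)
    pose j' := if (j < N)%N then j else N.-1.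
    have [V cV VP] := HN j' i (ltac:(rewrite /j'; case: ifP => //; rewrite prednK //)) iN.
    exists V => // t tP; rewrite -e; last first.
      have /andP[a1 _] := in01 i (ltnW iN).
      have /andP[_ a2] := in01 i.+1 iN.
      move/andP: tP => [t1 t2].
      by rewrite (le_trans a1 t1) (le_trans t2 a2).
    apply: VP => //; rewrite /j'; case: ifP => jN'; first exact: (ends j).1.
    have -> : j = N.-1.+1 by lia.
    by have := (ends N.-1).2; rewrite prednK.
  have g_row t : 0 <= t <= 1 -> row 0%N t = g t.
    by move=> t01; rewrite /row mul0r (H01 _ t01).1.
  have h_row t : 0 <= t <= 1 -> row N t = h t.
    by move=> t01; rewrite /row divff ?gt_eqF // (H01 _ t01).2.
  rewrite (RP g gS N (fine_row _ _ (leq0n N) g_row)).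
  rewrite (RP h hS N (fine_row _ _ (leqnn N) h_row)).
  transitivity (develop c N (row 0%N)).
    by apply: eq_gprod => i iN; rewrite !g_row ?in01 // ltnW.
  rewrite (dev_row N (leqnn N)).
  by apply: eq_gprod => i iN; rewrite !h_row ?in01 // ltnW.
- move=> x y z g h pg ph.
  have [gc g0 g1 gS] := pg; have [hc h0 h1 hS] := ph.
  have [N1 fN1] := fineE g gc gS; have [N2 fN2] := fineE h hc hS.
  have [gN _] := develop_refine gS fN2.1 fN1.
  have [hN _] := develop_refine hS fN1.1 fN2.
  move: gN hN; rewrite [(N2 * N1)%N]mulnC; move: (N1 * N2)%N => N gN hN.
  have N0 := gN.1; have N0' : 0 < N%:R :> RR by rewrite ltr0n.
  have [_ _ _ ghS] := path_cat pg ph.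
  have catl i : (i <= N)%N -> loop_concat g h (i%:R / (N + N)%:R) = g (i%:R / N%:R).
    move=> iN; rewrite /loop_concat ifT.
      by congr g; rewrite natrD; field; rewrite !gt_eqF ?addr_gt0.
    rewrite natrD ler_pdivrMr; last by lra.
    have : i%:R <= N%:R :> RR by rewrite ler_nat.
    by lra.
  have catr i : loop_concat g h ((N + i)%:R / (N + N)%:R) = h (i%:R / N%:R).
    case: i => [|i].
      by rewrite addn0 catl // divff ?gt_eqF // mul0r g1 h0.
    rewrite /loop_concat ifF.
      by congr h; rewrite !natrD; field; rewrite !gt_eqF ?addr_gt0.
    apply/negbTE; rewrite -ltNge natrD ltr_pdivlMr; last by rewrite natrD; lra.
    rewrite natrD.
    have : 0 < i.+1%:R :> RR by rewrite ltr0n.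
    by lra.
  have fgh : fine_for S c (N + N) (loop_concat g h).
    split; first by rewrite addn_gt0 N0.
    have NN0 : 0 < (N + N)%:R :> RR by rewrite ltr0n addn_gt0 N0.
    move=> i iN; have [iN'|iN'] := ltnP i N.
      have [V cV VP] := gN.2 i iN'; exists V => // t /andP[t1 t2].
      have tt : t <= 2^-1.
        apply: (le_trans t2); rewrite ler_pdivrMr // natrD.
        have : i.+1%:R <= N%:R :> RR by rewrite ler_nat.
        by lra.
      rewrite /loop_concat tt; apply: VP.
      move: t1 t2; rewrite ler_pdivrMr // ler_pdivlMr // natrD => t1 t2.
      by rewrite ler_pdivrMr // ler_pdivlMr //; lra.
    have iE : i = (N + (i - N))%N by lia.
    have [V cV VP] := hN.2 (i - N)%N (ltac:(lia)).
    exists V => // t /andP[]; rewrite {1}iE ler_pdivrMr // ler_pdivlMr // => t1.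
    rewrite {1}iE => t2.
    have -> : loop_concat g h t = h (2 * t - 1).
      rewrite /loop_concat; case: ifP => // t12.
      have -> : t = 2^-1.
        have : (N + (i - N))%:R >= N%:R :> RR by rewrite ler_nat leq_addr.
        move: t1; rewrite [(N + N)%:R]natrD => t1 t3.
        apply/le_anti; rewrite t12 /=.
        rewrite -(ler_pM2r N0'); lra.
      by rewrite divff ?pnatr_eq0 // subrr g1 h0.
    apply: VP; rewrite ler_pdivrMr // ler_pdivlMr //.
    move: t1 t2; rewrite -addnS !natrD => t1 t2; lra.
  rewrite (RP _ gS N gN) (RP _ hS N hN) (RP _ ghS _ fgh) /develop gprod_add.
  congr (_ * _)%g; apply: eq_gprod => i iN.
    by rewrite !catl // ltnW.
  by rewrite -addnS !catr.
- move=> x y g V [gc g0 g1 gS] cV gV.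
  rewrite (RP g gS 1%N).
    by rewrite /develop /= mul1g mul0r divr1 g0 g1.
  split=> // i; rewrite ltnS leqn0 => /eqP ->; exists V => // t.
  by rewrite mul0r divr1; exact: gV.
Qed.

End Monodromy.

(** * The realization of the tope-pairs poset *)

Definition radd : Type := rat.
HB.instance Definition _ := Choice.on radd.
Fact radd_mulgA : associative (fun x y : radd => (x + y)%R : radd).
Proof. by move=> x y z; rewrite addrA. Qed.
Fact radd_mul1g : left_id (0 : rat) (fun x y : radd => (x + y)%R : radd).
Proof. by move=> x; rewrite add0r. Qed.
Fact radd_mulg1 : right_id (0 : rat) (fun x y : radd => (x + y)%R : radd).
Proof. by move=> x; rewrite addr0. Qed.
Fact radd_mulVg :
  left_inverse (0 : rat) (fun x : radd => - x) (fun x y : radd => (x + y)%R : radd).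
Proof. by move=> x; rewrite addNr. Qed.
Fact radd_mulgV :
  right_inverse (0 : rat) (fun x : radd => - x) (fun x y : radd => (x + y)%R : radd).
Proof. by move=> x; rewrite addrN. Qed.
HB.instance Definition _ := isGroup.Build radd
  radd_mulgA radd_mul1g radd_mulg1 radd_mulVg radd_mulgV.

Lemma raddM (x y : radd) : (x * y)%g = (x + y :> rat). Proof. by []. Qed.
Lemma raddV (x : radd) : (x^-1)%g = (- x :> rat). Proof. by []. Qed.

(* (a, b, c) stands for the upper unitriangular matrix [[1,a,c],[0,1,b],[0,0,1]]. *)
Definition heis : Type := (rat * rat * rat)%type.
HB.instance Definition _ := Choice.on heis.
Definition hmul (x y : heis) : heis :=
  (x.1.1 + y.1.1, x.1.2 + y.1.2, x.2 + y.2 + x.1.1 * y.1.2).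
Definition hone : heis := (0, 0, 0).
Definition hinv (x : heis) : heis := (- x.1.1, - x.1.2, - x.2 + x.1.1 * x.1.2).
Fact hmulA : associative hmul.
Proof. by move=> [[a b] c] [[a' b'] c'] [[x y] z]; congr (_, _, _) => /=; ring. Qed.
Fact hmul1 : left_id hone hmul.
Proof. by move=> [[a b] c]; congr (_, _, _) => /=; ring. Qed.
Fact hmulr1 : right_id hone hmul.
Proof. by move=> [[a b] c]; congr (_, _, _) => /=; ring. Qed.
Fact hmulV : left_inverse hone hinv hmul.
Proof. by move=> [[a b] c]; congr (_, _, _) => /=; ring. Qed.
Fact hmulrV : right_inverse hone hinv hmul.
Proof. by move=> [[a b] c]; congr (_, _, _) => /=; ring. Qed.
HB.instance Definition _ := isGroup.Build heis hmulA hmul1 hmulr1 hmulV hmulrV.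

Definition ha (x : heis) : radd := x.1.1.
Definition hb (x : heis) : radd := x.1.2.
Lemma haM x y : ha (x * y)%g = (ha x * ha y)%g. Proof. by []. Qed.
Lemma hbM x y : hb (x * y)%g = (hb x * hb y)%g. Proof. by []. Qed.

(** The two products differ only in the corner entry, and there by this determinant. *)
Lemma heis_commute (x y : heis) : (x * y)%g = (y * x)%g ->
  (ha x : rat) * hb y = (ha y : rat) * hb x.
Proof. by move=> [_ _]; lra. Qed.

Lemma grpd_morph (T : topologicalType) (G H : groupType) (S : set T)
    (rho : (RR -> T) -> G) (f : G -> H) :
  (forall x y, f (x * y)%g = (f x * f y)%g) -> grpd_rep S rho ->
  grpd_rep S (fun g => f (rho g)).
Proof.
move=> fM [rH rM]; split=> [x y g h pg ph gh|x y z g h pg ph].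
  by rewrite (rH x y g h).
by rewrite (rM x y z g h) // fM.
Qed.

Lemma cont_ptws (X : topologicalType) (I : choiceType) (V : topologicalType)
    (f : X -> {ptws I -> V}) :
  (forall i, continuous (fun x => f x i)) -> continuous f.
Proof.
move=> fc x; apply/cvg_sup => i U.
case=> W [[B oB <-] /= Bfx] /filterS; apply.
by apply: fc; apply: open_nbhs_nbhs; split.
Qed.

Lemma cont_eval (I : choiceType) (V : topologicalType) (i : I) :
  continuous (fun f : {ptws I -> V} => f i).
Proof. exact: (@proj_continuous I (fun=> V) i). Qed.

(** * Representations over the realization and cocycles on chains *)

Notation QQ := geom_realization_Q.
Section Realization.
Implicit Types (v w u : tpair) (x y z : realization_space).

Definition vertex v : realization_space := fun p => (p == v)%:R.

Definition qcomp v w := Q_le v w || Q_le w v.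

Lemma Q_le_refl v : Q_le v v.
Proof.
rewrite /Q_le subxx andbT; apply/fintype.subsetP => f.
by rewrite !inE eqxx.
Qed.

Lemma qcompxx v : qcomp v v.
Proof. by rewrite /qcomp Q_le_refl. Qed.

Lemma qcompC v w : qcomp v w = qcomp w v.
Proof. by rewrite /qcomp orbC. Qed.

Definition seg x y : RR -> realization_space :=
  fun t p => (1 - clamp t) * x p + clamp t * y p.

(** For points of the realization this is the condition for the segment between them to stay in
    it. *)
Definition joined x y := forall v w, x v != 0 -> y w != 0 -> qcomp v w.

Lemma QQ_joined x : QQ x -> joined x x.
Proof. by move=> [_ [_ [_ xc]]] v w xv xw; apply/orP; apply: xc. Qed.

Lemma joinedC x y : joined x y -> joined y x.
Proof. by move=> xy v w yv xw; rewrite qcompC; apply: xy. Qed.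

Lemma QQ_comb (a : RR) x y : 0 <= a <= 1 -> QQ x -> QQ y -> joined x y ->
  QQ (fun p => (1 - a) * x p + a * y p).
Proof.
move=> /andP[a0 a1] Qx Qy xy.
have [x0 [x1 [xQ xc]]] := Qx; have [y0 [y1 [yQ yc]]] := Qy.
have sup p : (1 - a) * x p + a * y p != 0 -> x p != 0 \/ y p != 0.
  have [->|] := eqVneq (x p) 0; last by left.
  have [->|] := eqVneq (y p) 0; last by right.
  by rewrite !mulr0 addr0 eqxx.
split; first by move=> p; rewrite addr_ge0 // mulr_ge0 // subr_ge0.
split.
  by rewrite big_split /= -!mulr_sumr x1 y1 !mulr1 subrK.
split=> [p /sup[/xQ|/yQ] //|p q /sup[xp|yp] /sup[xq|yq]].
- exact: xc.
- by apply/orP; apply: xy.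
- by apply/orP; apply: joinedC xy _ _ _ _.
- exact: yc.
Qed.

Lemma joined_comb (a : RR) x y z : joined x z -> joined y z ->
  joined (fun p => (1 - a) * x p + a * y p) z.
Proof.
move=> xz yz v w; have [->|xv _] := eqVneq (x v) 0; last exact: xz.
have [->|yv _] := eqVneq (y v) 0; last exact: yz.
by rewrite !mulr0 addr0 eqxx.
Qed.

Lemma QQ_vertex v : in_Q v -> QQ (vertex v).
Proof.
move=> Qv; split; first by move=> p; rewrite ler0n.
split.
  rewrite (bigD1 v) //= /vertex eqxx big1 ?addr0 // => p /negbTE ->.
  by [].
have sup p : vertex v p != 0 -> p = v.
  by rewrite /vertex; case: (p =P v) => // _; rewrite eqxx.
split=> [p /sup -> //|p q /sup -> /sup ->].
by left; apply: Q_le_refl.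
Qed.

Lemma vertex_supp v p : vertex v p != 0 -> p = v.
Proof. by rewrite /vertex; case: (p =P v) => // _; rewrite eqxx. Qed.

Lemma joined_vertex v w : qcomp v w -> joined (vertex v) (vertex w).
Proof. by move=> vw p q /vertex_supp -> /vertex_supp ->. Qed.

Lemma joined_vertexr x v : QQ x -> x v != 0 -> joined x (vertex v).
Proof. by move=> Qx xv p q xp /vertex_supp ->; apply: (QQ_joined Qx). Qed.

Definition pcont {X : topologicalType} (f : X -> realization_space) :=
  cont_ptws (f := f).

Lemma cont_comb (X : topologicalType) (a : X -> RR) (f g : X -> realization_space) :
  continuous a -> continuous f -> continuous g ->
  continuous (fun s => (fun p => (1 - a s) * f s p + a s * g s p) : realization_space).
Proof.
move=> ac fc gc; apply: pcont => p.
have fp : continuous (fun s => f s p) by apply: cont_comp fc (@cont_eval _ _ p).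
have gp : continuous (fun s => g s p) by apply: cont_comp gc (@cont_eval _ _ p).
by cont.
Qed.

Lemma path_seg x y : QQ x -> QQ y -> joined x y -> path QQ x y (seg x y).
Proof.
move=> Qx Qy xy; split.
- by apply: cont_comb; [exact: clamp_cont | exact: cont_cst | exact: cont_cst].
- by apply/funext => p; rewrite /seg clamp0 subr0 mul1r mul0r addr0.
- by apply/funext => p; rewrite /seg clamp1 subrr mul1r mul0r add0r.
- by move=> t; apply: QQ_comb => //; apply: clamp_itv.
Qed.

Section QRep.
Context {G : groupType}.
Implicit Type rho : (RR -> realization_space) -> G.

(** The triangle is parametrised by a square whose side [s.1 = 0] is collapsed to [x]; the other
    three sides of the square are those of the triangle. *)
Lemma seg_triangle rho x y z : grpd_rep QQ rho -> QQ x -> QQ y -> QQ z ->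
  joined x y -> joined y z -> joined x z ->
  rho (seg x z) = (rho (seg x y) * rho (seg y z))%g.
Proof.
move=> rP Qx Qy Qz xy yz xz.
pose F (s : RR * RR) : realization_space := fun p =>
  (1 - clamp s.1) * x p + clamp s.1 * ((1 - clamp s.2) * y p + clamp s.2 * z p).
have cl1 : continuous (fun s : RR * RR => clamp s.1).
  by apply: cont_comp clamp_cont; cont.
have cl2 : continuous (fun s : RR * RR => clamp s.2).
  by apply: cont_comp clamp_cont; cont.
have FS s : QQ (F s).
  apply: QQ_comb => //; first exact: clamp_itv.
    by apply: QQ_comb => //; apply: clamp_itv.
  by apply: joinedC; apply: joined_comb; apply: joinedC.
have Fc : continuous F.
  apply: cont_comb => //; first exact: cont_cst.
  by apply: cont_comb => //; exact: cont_cst.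
have := grpd_square rP Fc FS.
have -> : (fun t => F (0, t)) = cst x.
  by apply/funext => t; apply/funext => p; rewrite /F /= clamp0 subr0 mul1r mul0r addr0.
have -> : (fun s => F (s, 1)) = seg x z.
  by apply/funext => t; apply/funext => p; rewrite /F /= clamp1 subrr mul1r mul0r add0r.
have -> : (fun s => F (s, 0)) = seg x y.
  by apply/funext => t; apply/funext => p; rewrite /F /= clamp0 subr0 mul1r mul0r addr0.
have -> : (fun s => F (1, s)) = seg y z.
  by apply/funext => t; apply/funext => p; rewrite /F /= clamp1 subrr mul1r mul0r add0r.
by rewrite (grpd_cst rP Qx) mul1g.
Qed.

Definition edge rho v w := rho (seg (vertex v) (vertex w)).

Definition chain_cocycle (e : tpair -> tpair -> G) : Prop :=
  forall v w u, in_Q v -> in_Q w -> in_Q u ->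
    qcomp v w -> qcomp w u -> qcomp v u ->
    e v u = (e v w * e w u)%g.

Lemma edge_cocycle rho : grpd_rep QQ rho -> chain_cocycle (edge rho).
Proof.
move=> rP v w u Qv Qw Qu vw wu vu.
by apply: seg_triangle => //; solve [exact: QQ_vertex | exact: joined_vertex].
Qed.

(** A vertex of largest barycentric coordinate, chosen discontinuously: it turns functions of edges
    into functions of pairs of points. The displayed pair is the default argument that the arg max
    requires. *)
Definition top_vertex x : tpair :=
  [arg max_(p > (finfun (fun=> true), finfun (fun=> true))) (x p : RR)]%O.

Lemma top_vertexP x p : x p <= x (top_vertex x).
Proof. by rewrite /top_vertex; case: arg_maxP => // q _ h; exact: h. Qed.

Lemma QQ_pos x : QQ x -> exists p, 0 < x p.
Proof.
move=> [x0 [x1 _]]; apply: contrapT => /forallNP n.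
have : \sum_p x p = 0.
  apply: big1 => p _; apply/le_anti; rewrite x0 andbT leNgt.
  exact/negP/n.
by rewrite x1 => /eqP; rewrite oner_eq0.
Qed.

Lemma top_vertex_gt0 x : QQ x -> 0 < x (top_vertex x).
Proof. by move=> /QQ_pos[p xp]; apply: lt_le_trans xp (top_vertexP x p). Qed.

Lemma top_vertexK v : top_vertex (vertex v) = v.
Proof.
apply/eqP; have := top_vertexP (vertex v) v; rewrite /vertex eqxx.
by case: eqP => // _; rewrite ler10.
Qed.

Lemma top_vertexQ x : QQ x -> in_Q (top_vertex x).
Proof.
move=> Qx; have [_ [_ [xQ _]]] := Qx; apply: xQ.
by rewrite gt_eqF // top_vertex_gt0.
Qed.

(** The first condition puts [y] in the open star of every vertex supporting [x]; the second keeps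
    the top vertices of all these [y] inside one chain, the support of [x]. *)
Definition star_nbhd x : set realization_space :=
  [set y | (forall v, 0 < x v -> 0 < y v) /\ forall v, x v != 0 \/ v != top_vertex y].

(** A vertex [v] outside the support of [x] has a smaller coordinate than some [q]. This persists
    near [x], so [v] is not a top vertex there. Only finitely many vertices are involved. *)
Lemma star_nbhdP x : QQ x -> nbhs x (star_nbhd x).
Proof.
move=> Qx; have [x0 _] := Qx.
have lt_near v w : x v < x w -> \forall y \near x, (y : realization_space) v < y w.
  move=> xvw.
  have c : continuous (fun y : realization_space => y w - y v).
    have cv := @cont_eval tpair RR v; have cw := @cont_eval tpair RR w.
    by apply: cont_add => //; apply: cont_opp.
  have := c x [set r | 0 < r]; rewrite /= => h.
  have d0 : 0 < x w - x v by rewrite subr_gt0.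
  have := h (lt_nbhsr d0).
  by rewrite /nbhs /=; apply: filterS => y /=; rewrite subr_gt0.
have pos_near v : \forall y \near x, 0 < x v -> 0 < (y : realization_space) v.
  have [xv|xv] := ltP 0 (x v); last by near=> y.
  have c := @cont_eval tpair RR v.
  have := c x [set r | 0 < r] (lt_nbhsr xv).
  by rewrite /nbhs /=; apply: filterS.
have [q xq] := QQ_pos Qx.
have out_near v : \forall y \near x, x v != 0 \/ v != top_vertex y.
  have [xv|xv] := eqVneq (x v) 0; last by near=> y; left.
  have vq : x v < x q by rewrite xv.
  have := lt_near _ _ vq; apply: filterS => y yvq; right.
  apply: contraTneq yvq => ->; rewrite -leNgt; exact: top_vertexP.
have h1 := @filter_forall _ _ _ _ (nbhs_filter x) pos_near.
have h2 := @filter_forall _ _ _ _ (nbhs_filter x) out_near.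
exact: filterI h1 h2.
Unshelve. all: by end_near. Qed.

Lemma star_top x y : star_nbhd x y -> x (top_vertex y) != 0.
Proof. by move=> [_ /(_ (top_vertex y))[//|]]; rewrite eqxx. Qed.

(** The top vertices of points near [z] belong to the chain supporting [z], where the rule for [e]
    applies, so [c] is a local cocycle. On the segment from [v] to [w] the top vertex is always one
    of these two. *)
Lemma chain_rep e : chain_cocycle e ->
  exists2 rho, grpd_rep QQ rho &
   (forall x y z g, path QQ x y g -> (forall t, 0 <= t <= 1 -> star_nbhd z (g t)) ->
      QQ z -> rho g = e (top_vertex x) (top_vertex y)) /\
   (forall v w, in_Q v -> in_Q w -> qcomp v w -> edge rho v w = e v w).
Proof.
move=> eC.
pose c x y := e (top_vertex x) (top_vertex y).
have cS x : QQ x -> cocycle_on QQ c (star_nbhd x).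
  move=> Qx a b d Va Vb Vd Qa Qb Qd; apply/esym; have xc := QQ_joined Qx.
  by apply: eC; solve [exact: top_vertexQ | apply: xc; exact: star_top].
have [|rho rP rE] := @monodromy _ _ QQ c.
  by move=> x Qx; exists (star_nbhd x); [exact: star_nbhdP | exact: cS].
exists rho => //; split=> [x y z g pg gz Qz|v w Qv Qw vw].
  by apply: rE pg (cS z Qz) gz.
have jvw := joined_vertex vw.
rewrite /edge (rE _ _ _ [set y | top_vertex y = v \/ top_vertex y = w]
  (path_seg (QQ_vertex Qv) (QQ_vertex Qw) jvw)) /c ?top_vertexK //.
- move=> a b d Va Vb Vd Qa Qb Qd; apply/esym; rewrite /c.
  have cc r r' : r = v \/ r = w -> r' = v \/ r' = w -> qcomp r r'.
    by move=> [] -> [] ->; rewrite ?qcompxx // qcompC.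
  by apply: eC; solve [exact: top_vertexQ | exact: cc].
- move=> t _ /=.
  have Qs : QQ (seg (vertex v) (vertex w) t).
    by apply: QQ_comb; [exact: clamp_itv|exact: QQ_vertex|exact: QQ_vertex|].
  have := top_vertex_gt0 Qs; move: (top_vertex _) => p.
  rewrite /seg /vertex; case: eqP => [->|_]; first by left.
  by case: eqP => [->|_]; [right | rewrite !mulr0 addr0 ltxx].
Qed.

(* Every representation of the fundamental groupoid is determined by its
   values on edges: each short piece of a path stays in the open star of a
   vertex, and stars are cones. *)
Lemma grpd_edges rho (sigma : (RR -> realization_space) -> G) e P :
  grpd_rep QQ rho -> grpd_rep QQ sigma -> 
  (forall x y z g, path QQ x y g -> (forall t, 0 <= t <= 1 -> star_nbhd z (g t)) ->
      QQ z -> sigma g = e (top_vertex x) (top_vertex y)) ->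
  (forall v w, in_Q v -> in_Q w -> qcomp v w ->
     edge rho v w = ((P v)^-1 * e v w * P w)%g) ->
  exists F, forall x y g, path QQ x y g -> rho g = ((F x)^-1 * sigma g * F y)%g.
Proof.
move=> rP sP sE eP.
(* The frame at [x] combines the given frame at its top vertex with the value of [rho] on the
   segment from that vertex to [x]. *)
pose F x := (P (top_vertex x) * rho (seg (vertex (top_vertex x)) x))%g.
exists F; apply: grpd_local => // z Qz.
exists (star_nbhd z); first exact: star_nbhdP.
move=> x y g pg gz; rewrite (sE _ _ _ _ pg gz Qz).
have [gc g0 g1 gS] := pg; have [Qx Qy] := path_in pg.
have zx : star_nbhd z x by rewrite -g0; apply: gz; rewrite lexx ler01.
have zy : star_nbhd z y by rewrite -g1; apply: gz; rewrite lexx ler01.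
pose v := top_vertex z; have Qv := top_vertexQ Qz; have QV := QQ_vertex Qv.
have supp a : star_nbhd z a -> a v != 0.
  by move=> [/(_ v) h _]; rewrite gt_eqF // h // top_vertex_gt0.
have jv a : QQ a -> star_nbhd z a -> joined a (vertex v).
  by move=> Qa /supp; apply: joined_vertexr.
have gcone : rho g = (rho (seg x (vertex v)) * rho (seg (vertex v) y))%g.
  (* The path is coned off to the vertex [v], which lies in the support of every [g t]. *)
  pose H (s : RR * RR) : realization_space := fun p =>
    (1 - clamp s.1) * g (clamp s.2) p + clamp s.1 * vertex v p.
  have Hc : continuous H.
    apply: cont_comb; [| |exact: cont_cst].
      by apply: cont_comp clamp_cont; cont.
    apply: (cont_comp (g := fun s : RR * RR => clamp s.2)) gc.
    by apply: cont_comp clamp_cont; cont.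
  have HS s : QQ (H s).
    apply: QQ_comb => //; first exact: clamp_itv.
    by apply: jv => //; apply: gz; apply: clamp_itv.
  have := grpd_square rP Hc HS.
  have -> : (fun t => H (0, t)) = fun t => g (clamp t).
    by apply/funext => t; apply/funext => p; rewrite /H /= clamp0 subr0 mul1r mul0r addr0.
  have -> : (fun s => H (s, 1)) = seg y (vertex v).
    by apply/funext => t; apply/funext => p; rewrite /H /= clamp1 g1.
  have -> : (fun s => H (s, 0)) = seg x (vertex v).
    by apply/funext => t; apply/funext => p; rewrite /H /= clamp0 g0.
  have -> : (fun t => H (1, t)) = cst (vertex v).
    by apply/funext => t; apply/funext => p; rewrite /H /= clamp1 subrr mul1r mul0r add0r.
  rewrite (grpd_cst rP QV) mulg1.
  have -> : rho (fun t => g (clamp t)) = rho g.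
    apply: (grpd_eq rP _ pg); last by move=> t t01; rewrite clamp_id.
    exact: path_clamp2 pg.
  have jy := jv y Qy zy.
  have e1 : (rho (seg y (vertex v)) * rho (seg (vertex v) y) = 1)%g.
    rewrite -(seg_triangle rP Qy QV Qy) //; [|exact: joinedC|exact: QQ_joined].
    have -> : seg y y = cst y.
      by apply/funext => t; apply/funext => p; rewrite /seg -mulrDl subrK mul1r.
    exact: grpd_cst rP Qy.
  by move=> <-; rewrite -mulgA e1 mulg1.
have half a : QQ a -> star_nbhd z a ->
    rho (seg a (vertex v)) = ((rho (seg (vertex (top_vertex a)) a))^-1 *
      edge rho (top_vertex a) v)%g.
  move=> Qa za; apply: (@mulgI _ (rho (seg (vertex (top_vertex a)) a))).
  have Qt := QQ_vertex (top_vertexQ Qa).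
  have ta := joined_vertexr Qa (lt0r_neq0 (top_vertex_gt0 Qa)).
  have tv : qcomp (top_vertex a) v.
    apply: (QQ_joined Qa); first by rewrite gt_eqF // top_vertex_gt0.
    exact: supp.
  rewrite mulVKg -seg_triangle //; [exact: joinedC|exact: jv|].
  exact: joined_vertex.
have half' a : QQ a -> star_nbhd z a ->
    rho (seg (vertex v) a) = (edge rho v (top_vertex a) *
      rho (seg (vertex (top_vertex a)) a))%g.
  move=> Qa za.
  have Qt := QQ_vertex (top_vertexQ Qa).
  have ta := joined_vertexr Qa (lt0r_neq0 (top_vertex_gt0 Qa)).
  have tv : qcomp v (top_vertex a).
    apply: (QQ_joined Qa); last by rewrite gt_eqF // top_vertex_gt0.
    exact: supp.
  apply: seg_triangle => //; [exact: joined_vertex|exact: joinedC|].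
  by apply: joinedC; apply: jv.
rewrite gcone half // half' //.
have cmp a : star_nbhd z a -> QQ a -> qcomp (top_vertex a) v.
  move=> za Qa; apply: (QQ_joined Qa); first by rewrite gt_eqF // top_vertex_gt0.
  exact: supp.
have xy : qcomp (top_vertex x) (top_vertex y).
  by apply: (QQ_joined Qz); exact: star_top.
have := edge_cocycle rP (top_vertexQ Qx) Qv (top_vertexQ Qy) (cmp _ zx Qx)
  (ltac:(rewrite qcompC; exact: cmp)) xy.
rewrite -!mulgA ![(edge _ _ _ * (edge _ _ _ * _))%g]mulgA => <-.
rewrite eP //; try exact: top_vertexQ.
by rewrite /F invgM !mulgA.
Qed.

End QRep.

End Realization.

(** * The non-Pappus topes *)

Definition det3n (u v w : nat -> int) : int :=
  u 0%N * (v 1%N * w 2%N - v 2%N * w 1%N) - u 1%N * (v 0%N * w 2%N - v 2%N * w 0%N)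
  + u 2%N * (v 0%N * w 1%N - v 1%N * w 0%N).

(** Convertible with [chi], but on natural numbers, where [vm_compute] can evaluate it. *)
Definition chin (i j k : nat) : int :=
  if [&& 6 <= i, 6 <= j, 6 <= k & uniq [:: i; j; k]]%N then
    let e (a c : nat) : int := (a == c + 6)%N%:R in det3n (e i) (e j) (e k)
  else let p a c : int := nth 0 (nth [::] pappus_coords a) c in
    sgz (det3n (p i) (p j) (p k)).

Lemma chiE (i j k : 'I_9) : chi i j k = chin i j k.
Proof. by []. Qed.

Definition bits : Type := seq bool.
Definition bit (b : bits) (e : nat) : bool := nth false b e.
Definition sgn (b : bool) : int := if b then 1 else -1.

Fixpoint binary (n k : nat) : bits :=
  if n is m.+1 then odd k :: binary m k./2 else [::].

(* The topes, in binary, each with two cocircuits whose composition it is. *)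
Definition tope_table : seq (nat * (nat * nat * (nat * nat))) :=
  [:: (0, (3, 4, (1, 0))); (32, (3, 4, (7, 1))); (48, (3, 8, (5, 2))); (304, (3, 8, (4, 7)));
      (8, (0, 3, (6, 5))); (24, (3, 4, (1, 7))); (88, (6, 5, (1, 4))); (56, (3, 4, (6, 8)));
      (312, (3, 8, (6, 7))); (440, (6, 7, (4, 1))); (120, (6, 5, (7, 8))); (376, (6, 8, (0, 1)));
      (248, (0, 5, (6, 2))); (504, (6, 7, (0, 8))); (4, (5, 2, (8, 0))); (36, (5, 2, (4, 7)));
      (292, (4, 2, (7, 1))); (420, (4, 7, (8, 6))); (308, (4, 2, (3, 1))); (436, (3, 2, (4, 1)));
      (444, (6, 2, (4, 7))); (508, (6, 2, (3, 0))); (6, (5, 1, (7, 4))); (262, (8, 0, (6, 7)));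
      (294, (5, 1, (4, 0))); (422, (7, 1, (4, 0))); (438, (4, 1, (3, 0))); (502, (4, 0, (7, 8)));
      (510, (3, 1, (7, 4))); (1, (0, 3, (2, 6))); (9, (0, 3, (1, 4))); (73, (0, 4, (2, 3)));
      (89, (0, 4, (1, 7))); (217, (0, 5, (2, 4))); (249, (0, 8, (1, 3))); (505, (0, 8, (2, 5)));
      (3, (1, 0, (7, 4))); (67, (2, 6, (7, 8))); (75, (1, 3, (7, 4))); (203, (7, 4, (8, 6)));
      (91, (1, 4, (3, 0))); (219, (1, 7, (4, 0))); (475, (2, 4, (6, 7))); (507, (0, 1, (7, 4)));
      (7, (1, 0, (8, 7))); (263, (8, 0, (2, 5))); (135, (7, 6, (4, 1))); (391, (5, 0, (2, 4)));
      (71, (2, 6, (3, 0))); (199, (2, 3, (4, 1))); (455, (8, 6, (0, 1))); (423, (4, 0, (8, 7)));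
      (487, (4, 0, (2, 3))); (503, (4, 0, (1, 7))); (207, (2, 4, (7, 6))); (463, (2, 4, (7, 1)));
      (479, (2, 4, (3, 1))); (511, (0, 1, (8, 7)))].

Definition topes : seq bits := [seq binary 9 t.1 | t <- tope_table].

Definition tope_witness (t : nat * (nat * nat * (nat * nat))) : bool :=
  let: (k, ((a, b), (c, d))) := t in
  all (fun e => sgn (bit (binary 9 k) e) ==
      (if chin a b e != 0 then chin a b e else
       if chin c d e != 0 then chin c d e else 0))
    (iota 0 9).

(* Signed circuits on four elements, by the Grassmann-Pluecker relations. *)
Definition circuit (a b c d : nat) : seq (nat * int) :=
  [:: (a, chin b c d); (b, - chin a c d); (c, chin a b d); (d, - chin a b c)].

Definition circuits : seq (seq (nat * int)) :=
  [seq circuit q.1.1 q.1.2 q.2.1 q.2.2 |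
    q <- [seq (x, y) | x <- [seq (a, b) | a <- iota 0 9, b <- iota 0 9],
                       y <- [seq (c, d) | c <- iota 0 9, d <- iota 0 9]] &
    (q.1.1 < q.1.2 < q.2.1)%N && (q.2.1 < q.2.2)%N].

Definition orthogonal (c : seq (nat * int)) (X : nat -> int) : bool :=
  all (fun p => p.2 * X p.1 == 0) c ||
  (has (fun p => 0 < p.2 * X p.1) c && has (fun p => p.2 * X p.1 < 0) c).

Lemma tope_table_ok : all tope_witness tope_table.
Proof. by vm_compute. Qed.

Lemma cocircuits_orthogonal :
  all (fun c => all (fun a => all (fun b => orthogonal c (chin a b)) (iota 0 9))
     (iota 0 9)) circuits.
Proof. by vm_compute. Qed.

Fixpoint all_bits (n : nat) : seq bits :=
  if n is m.+1 then [seq b :: s | b <- [:: false; true], s <- all_bits m]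
  else [:: [::]].

(** Completeness of the table: among all 512 sign vectors only the listed ones pass the test against
    the circuits, a test that every covector passes. *)
Lemma orthogonal_topes :
  all (fun b => (b \in topes) || ~~ all (fun c => orthogonal c (fun e => sgn (bit b e)))
    circuits) (all_bits 9).
Proof. by vm_compute. Qed.

Definition flip (b : bits) (X : seq nat) : bits :=
  [seq bit b e (+) (e \in X) | e <- iota 0 9].

(* The rank-two flats; the triples are the lines, written (i, m, k) so that
   no tope separates m from both i and k. *)
Definition line_table : seq (nat * nat * nat) :=
  [:: (0, 1, 2); (0, 6, 4); (0, 7, 5); (1, 6, 3); (1, 8, 5); (2, 7, 3);
      (2, 8, 4); (3, 4, 5)]%N.
Definition pair_table : seq (nat * nat) :=
  [:: (0, 3); (0, 8); (1, 4); (1, 7); (2, 5); (2, 6); (3, 8); (4, 7); (5, 6);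
      (6, 7); (6, 8); (7, 8)]%N.
Definition flat_table : seq (seq nat) :=
  [seq [:: t.1.1; t.1.2; t.2] | t <- line_table] ++
  [seq [:: t.1; t.2] | t <- pair_table].

(** One of the elements separating [T] from [R] is a wall of [T], so [T] can be left along a
    geodesic towards [R]. *)
Lemma topes_adjacent :
  all (fun T => all (fun R => (T == R) ||
    has (fun f => (bit T f != bit R f) && (flip T [:: f] \in topes)) (iota 0 9))
    topes) topes.
Proof. by vm_compute. Qed.

(** The two topes [T] and [flip T X] are opposite around the flat, and [i] is a wall of both. *)
Lemma topes_around_flat :
  all (fun X => all (fun i => has (fun T => [&& flip T [:: i] \in topes,
     flip T X \in topes & flip (flip T X) [:: i] \in topes]) topes) X) flat_table.
Proof. by vm_compute. Qed.

Lemma topes_line :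
  all (fun t => all (fun T => ~~ ((bit T t.1.2 != bit T t.1.1) &&
    (bit T t.1.2 != bit T t.2))) topes) line_table.
Proof. by vm_compute. Qed.

Lemma topes_wall : all (fun f => has (fun T => flip T [:: f] \in topes) topes) (iota 0 9).
Proof. by vm_compute. Qed.

Section Topes.
Local Open Scope set_scope.

(* Conversion should not unfold the tables, which are meant for [vm_compute]. *)
Strategy opaque [topes circuits flat_table line_table tope_table].

Definition tbits (T : tvec) : bits := [seq T (inord e) | e <- iota 0 9].
Definition tofb (b : bits) : tvec := [ffun e : 'I_9 => bit b e].

Lemma bit_map (F : nat -> bool) e : (e < 9)%N ->
  bit [seq F x | x <- iota 0 9] e = F e.
Proof. by move=> e9; rewrite /bit (nth_map 0%N) ?size_iota // nth_iota. Qed.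

Lemma tbitsE T (e : 'I_9) : bit (tbits T) e = T e.
Proof. by rewrite bit_map // inord_val. Qed.

Lemma tbitsK T : tofb (tbits T) = T.
Proof. by apply/ffunP => e; rewrite ffunE tbitsE. Qed.

Lemma all_bitsP n (b : bits) : size b = n -> b \in all_bits n.
Proof.
elim: n b => [|n IH] [|x b] //= [sb].
rewrite mem_cat; case: x; rewrite ?mem_cat map_f ?IH ?orbT //.
Qed.

Lemma mem_circuits c : c \in circuits ->
  forall p, p \in c -> (p.1 < 9)%N.
Proof.
have : all (fun c => all (fun p => (p.1 < 9)%N) c) circuits by vm_compute.
by move=> /allP h /h /allP.
Qed.

Lemma orthogonal_ext c (X Y : nat -> int) :
  (forall p, p \in c -> p.2 * X p.1 = p.2 * Y p.1) ->
  orthogonal c X = orthogonal c Y.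
Proof.
move=> e; rewrite /orthogonal; congr (_ || (_ && _)).
- by apply: eq_in_all => p pc; rewrite /= e.
- by apply: eq_in_has => p pc; rewrite /= e.
- by apply: eq_in_has => p pc; rewrite /= e.
Qed.

(** Composition overwrites only zeros of [X]. If [X] has terms of both signs on the circuit, they
    survive; otherwise [X] vanishes on the support of the circuit, where the composition equals
    [Y]. *)
Lemma orthogonal_compose c (X Y : nat -> int) : orthogonal c X -> orthogonal c Y ->
  orthogonal c (fun e => if X e != 0 then X e else Y e).
Proof.
move=> /orP[/allP X0|/andP[/hasP[p pc pX] /hasP[q qc qX]]] oY; last first.
  apply/orP; right; apply/andP; split; apply/hasP.
    exists p => //; case: eqP => [X0|//]; by rewrite X0 mulr0 ltxx in pX.
  exists q => //; case: eqP => [X0|//]; by rewrite X0 mulr0 ltxx in qX.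
rewrite (@orthogonal_ext _ _ Y) // => p pc; case: eqP => //= /eqP Xp.
by have := X0 p pc; rewrite mulf_eq0 (negbTE Xp) orbF => /eqP ->; rewrite !mul0r.
Qed.

Lemma ord9_iota (e : 'I_9) : (e : nat) \in iota 0 9.
Proof. by rewrite mem_iota /= ltn_ord. Qed.

Lemma covector_orthogonal c X : covector X -> c \in circuits ->
  orthogonal c (fun e => X (inord e)).
Proof.
move=> [s sX] cc.
have -> : X = foldr (fun ab acc => compose (cocirc ab.1 ab.2) acc) (fun _ => 0) s.
  by apply/funext.
elim: s {X sX} => [|[a b] s IH] /=.
  by apply/orP; left; apply/allP => p _; rewrite mulr0.
apply: (orthogonal_compose (X := fun e => cocirc a b (inord e)) _ IH).
rewrite (@orthogonal_ext _ _ (chin a b)).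
  have /allP/(_ c cc)/allP/(_ _ (ord9_iota a))/allP := cocircuits_orthogonal.
  by apply; apply: ord9_iota.
by move=> p pc; congr (_ * _); rewrite /cocirc chiE inordK // (mem_circuits cc).
Qed.

(** The table writes each tope as a composition of two cocircuits. Conversely a full covector is
    orthogonal to all circuits, and the enumeration leaves only the table. *)
Lemma topeP (T : tvec) : is_tope T <-> tbits T \in topes.
Proof.
split=> [Tt|/mapP[t tt eT]].
  have := allP orthogonal_topes (tbits T) (all_bitsP _).
  rewrite size_map size_iota => /(_ erefl) /orP[//|/negP[]].
  apply/allP => c cc; have := covector_orthogonal Tt cc.
  congr is_true; apply: orthogonal_ext => p pc.
  by congr (_ * _); rewrite /sv_of /sgn bit_map // (mem_circuits cc).
have := allP tope_table_ok t tt.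
case: t tt eT => k [[a b] [c d]] tt eT; rewrite /tope_witness => /allP w.
have lt9 : (a < 9)%N && (b < 9)%N && (c < 9)%N && (d < 9)%N.
  have : all (fun t => [&& t.2.1.1 < 9, t.2.1.2 < 9, t.2.2.1 < 9 & t.2.2.2 < 9]%N)
    tope_table by vm_compute.
  by move/allP/(_ _ tt)/and4P => /= -[-> -> -> ->].
move: lt9 => /andP[/andP[/andP[a9 b9] c9] d9].
exists [:: (Ordinal a9, Ordinal b9); (Ordinal c9, Ordinal d9)] => e /=.
rewrite /compose /cocirc !chiE /=.
have := w e (ord9_iota e); change (binary 9 k) with (binary 9 (k, (a, b, (c, d))).1).
by rewrite -eT tbitsE => /eqP.
Qed.

Definition flipT (T : tvec) (X : {set 'I_9}) : tvec := [ffun e => T e (+) (e \in X)].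

Lemma tbits_flip T (X : seq nat) :
  flip (tbits T) X = tbits (flipT T [set e : 'I_9 | (e : nat) \in X]).
Proof.
apply/eq_in_map => e; rewrite mem_iota /= => e9.
by rewrite bit_map // ffunE inE inordK.
Qed.

Lemma bit_eqP (T R : tvec) : tbits T = tbits R -> T = R.
Proof. by move=> e; rewrite -[T]tbitsK e tbitsK. Qed.

Lemma tbits_tofb b : b \in topes -> tbits (tofb b) = b.
Proof.
have : all (fun b => size b == 9%N) topes by vm_compute.
move=> /allP h /h /eqP sb; apply: (@eq_from_nth _ false).
  by rewrite size_map size_iota.
move=> i; rewrite size_map size_iota => i9.
by rewrite [LHS]bit_map // ffunE inordK.
Qed.

Lemma tope_adjacent T R : is_tope T -> is_tope R -> T <> R ->
  exists2 f, T f != R f & is_tope (flipT T [set f]).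
Proof.
move=> /topeP tT /topeP tR TR.
have /orP[/eqP/bit_eqP/TR[]|/hasP[f]] := allP (allP topes_adjacent _ tT) _ tR.
rewrite mem_iota /= => f9 /andP[d t].
exists (Ordinal f9); first by rewrite -!tbitsE.
have ef : [set e : 'I_9 | (e : nat) \in [:: f]] = [set (Ordinal f9 : 'I_9)].
  by apply/setP => e; rewrite !inE -val_eqE.
by apply/topeP; move: t; rewrite tbits_flip ef.
Qed.

Definition flats : seq {set 'I_9} := [seq [set e : 'I_9 | (e : nat) \in X] | X <- flat_table].

Lemma tope_around_flat X i : X \in flats -> i \in X -> exists T,
  [/\ is_tope T, is_tope (flipT T [set i]), is_tope (flipT T X) &
     is_tope (flipT (flipT T X) [set i])].
Proof.
move=> /mapP[Y YF ->]; rewrite inE => iY.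
have /hasP[b bt /and3P[b1 b2 b3]] := allP (allP topes_around_flat _ YF) _ iY.
have ei : [set e : 'I_9 | (e : nat) \in [:: (i : nat)]] = [set i].
  by apply/setP => e; rewrite !inE -val_eqE.
exists (tofb b); rewrite -ei; split; apply/topeP; rewrite -?tbits_flip tbits_tofb //.
Qed.

Lemma tope_wall (f : 'I_9) : exists2 T, is_tope T & is_tope (flipT T [set f]).
Proof.
have /hasP[b bt b1] := allP topes_wall _ (ord9_iota f).
have ei : [set e : 'I_9 | (e : nat) \in [:: (f : nat)]] = [set f].
  by apply/setP => e; rewrite !inE -val_eqE.
by exists (tofb b); rewrite -?ei; apply/topeP; rewrite -?tbits_flip tbits_tofb.
Qed.

Definition lines : seq ('I_9 * 'I_9 * 'I_9) :=
  [seq (inord t.1.1, inord t.1.2, inord t.2) | t <- line_table].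

Lemma tope_line i m k T : (i, m, k) \in lines -> is_tope T ->
  ~~ ((T m != T i) && (T m != T k)).
Proof.
move=> /mapP[[[i' m'] k'] t [-> -> ->]] /topeP tT.
have := allP (allP topes_line _ t) _ tT.
have : all (fun t => [&& t.1.1 < 9, t.1.2 < 9 & t.2 < 9]%N) line_table by vm_compute.
move=> /allP/(_ _ t)/and3P[/= i9 m9 k9].
by rewrite -!tbitsE !inordK.
Qed.

End Topes.

(** * Representations determining a combinatorial structure *)

Definition delta {I : finType} (i k j : I) : rat := (j == i)%:R - (j == k)%:R.

Section Spec.
Context {T : topologicalType} {I : finType}.
Implicit Types (S : set T) (a b : I -> rat) (g L : RR -> T).

(* [flat X] holds for the rank-two flats of a matroid on I, and [line i j k]
   for (enough) triples of distinct elements of a flat. *)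
Definition comb (alpha : I -> (RR -> T) -> radd) a g : rat :=
  \sum_i a i * (alpha i g : rat).

(* The loop around a flat commutes with the meridians of its elements, and two
   elements of the Heisenberg group commute iff their images (a, b) in its
   abelianization have determinant 0. *)
Definition flat_condition (flat : {set I} -> Prop) a b : Prop :=
  forall X i, flat X -> i \in X ->
    (\sum_(j in X) a j) * b i = (\sum_(j in X) b j) * a i.

Definition grpd_lifts S (alpha : I -> (RR -> T) -> radd) a b : Prop :=
  exists2 R : (RR -> T) -> heis, grpd_rep S R & forall x L, path S x x L ->
    (ha (R L) : rat) = comb alpha a L /\ (hb (R L) : rat) = comb alpha b L.

Definition loop_lifts S z (alpha : I -> (RR -> T) -> radd) a b : Prop :=
  exists2 R : (RR -> T) -> heis, loop_rep S z R & forall L, is_loop S z L ->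
    (ha (R L) : rat) = comb alpha a L /\ (hb (R L) : rat) = comb alpha b L.

(** What is retained of a group: a basis of H^1 indexed by [I], some pairs that lift, and a
    condition necessary for lifting. It is not claimed that the condition suffices. *)
Definition grpd_spec S alpha (flat : {set I} -> Prop) (line : I -> I -> I -> Prop) :=
  [/\ forall i, grpd_rep S (alpha i),
      forall R : (RR -> T) -> radd, grpd_rep S R -> exists a,
        forall x L, path S x x L -> (R L : rat) = comb alpha a L,
      forall a, (forall x L, path S x x L -> comb alpha a L = 0) -> forall i, a i = 0,
      forall i j k, line i j k -> grpd_lifts S alpha (delta i k) (delta j k)
    & forall a b, grpd_lifts S alpha a b -> flat_condition flat a b].

Definition loop_spec S z alpha (flat : {set I} -> Prop) (line : I -> I -> I -> Prop) :=
  [/\ forall i, loop_rep S z (alpha i),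
      forall R : (RR -> T) -> radd, loop_rep S z R -> exists a,
        forall L, is_loop S z L -> (R L : rat) = comb alpha a L,
      forall a, (forall L, is_loop S z L -> comb alpha a L = 0) -> forall i, a i = 0,
      forall i j k, line i j k -> loop_lifts S z alpha (delta i k) (delta j k)
    & forall a b, loop_lifts S z alpha a b -> flat_condition flat a b].

Lemma conj_path (G : groupType) S (R : (RR -> T) -> G) z x t L :
  grpd_rep S R -> path S z x t -> path S x x L ->
  path S z z (loop_concat (loop_concat t L) (rev t)) /\
  R (loop_concat (loop_concat t L) (rev t)) = (R t * R L * (R t)^-1)%g.
Proof.
move=> rP pt pL; have [_ rM] := rP.
have ptL := path_cat pt pL; have pr := path_rev pt.
split; first exact: path_cat ptL pr.
by rewrite (rM _ _ _ _ _ ptL pr) (rM _ _ _ _ _ pt pL) (grpd_rev rP pt).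
Qed.

Lemma raddJ (x y : radd) : (x * y * x^-1)%g = y.
Proof. by rewrite !raddM raddV; ring. Qed.

Lemma conj_radd S (R : (RR -> T) -> radd) z x t L :
  grpd_rep S R -> path S z x t -> path S x x L ->
  R (loop_concat (loop_concat t L) (rev t)) = R L.
Proof. by move=> rP pt pL; rewrite (conj_path rP pt pL).2 raddJ. Qed.

Lemma clamp_radd (G : groupType) S (R : (RR -> T) -> G) x y L : grpd_rep S R ->
  path S x y L -> R (fun s => L (clamp s)) = R L.
Proof.
move=> rP pL; apply: (grpd_eq rP _ pL); first exact: path_clamp2.
by move=> s s01; rewrite clamp_id.
Qed.

(** Moving a loop to the base point conjugates its value. Neither [radd] nor the abelianization
    [(ha, hb)] of the Heisenberg group sees this. *)
Lemma spec_transfer S z alpha flat line : S z -> path_connected S ->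
  grpd_spec S alpha flat line ->
  loop_spec S z (fun i g => alpha i (fun t => g (clamp t))) flat line.
Proof.
move=> Sz Sc [gi gii giii giv gv].
have combC a z' x t L : path S z' x t -> path S x x L ->
    comb alpha a (loop_concat (loop_concat t L) (rev t)) = comb alpha a L.
  move=> pt pL; apply: eq_bigr => i _; congr (_ * _).
  exact: (conj_radd (gi i) pt pL).
have combE a L x : path S x x L ->
    comb (fun i g => alpha i (fun t => g (clamp t))) a L = comb alpha a L.
  move=> pL; apply: eq_bigr => i _; congr (_ * _).
  exact: (clamp_radd (gi i) pL).
split.
- by move=> i; apply: grpd_loop.
- move=> R /(grpd_ext Sz Sc)[R' /gii[a Ha] R'E]; exists a => L lL.
  by rewrite -(R'E _ lL) (Ha z _ (path_clamp lL)).
- move=> a Ha; apply: giii => x L pL.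
  have [t pt] := Sc z x Sz (path_in pL).1.
  have p := path_cat (path_cat pt pL) (path_rev pt).
  by rewrite -(combC a z x t L pt pL) -(combE _ _ _ p); apply: Ha; apply: path_loop p.
- move=> i j k /giv[R rP RE]; exists (fun g => R (fun t => g (clamp t))).
    exact: grpd_loop.
  by move=> L lL; apply: (RE z); apply: path_clamp.
- move=> a b [R rP RE]; apply: gv.
  have [R' r'P R'E] := grpd_ext Sz Sc rP; exists R' => // x L pL.
  have [t pt] := Sc z x Sz (path_in pL).1.
  have [p e] := conj_path r'P pt pL.
  have [ea eb] := RE _ (path_loop p).
  rewrite -(R'E _ (path_loop p)) (clamp_radd r'P p) e !(haM, hbM) in ea eb.
  rewrite -(combC a z x t L pt pL) -(combC b z x t L pt pL).
  rewrite -(combE _ _ _ p) -(combE _ _ _ p) -ea -eb.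
  have haV (y : heis) : ha y^-1%g = (ha y)^-1%g by [].
  have hbV (y : heis) : hb y^-1%g = (hb y)^-1%g by [].
  by rewrite haV hbV !raddJ.
Qed.

End Spec.

(** * Transport of representations along an isomorphism of fundamental groups *)

Lemma lhtpy_trans (T : topologicalType) (S : set T) x g h k :
  is_loop S x g -> is_loop S x k ->
  loop_homotopic S x g h -> loop_homotopic S x h k -> loop_homotopic S x g k.
Proof.
move=> lg lk /htpy_clamp gh /htpy_clamp hk.
have H := htpy_trans gh hk.
apply: htpy_loop; apply: htpy_trans (htpy_trans _ H) _.
  apply: htpy_sym; apply: htpy_eq (path_clamp lg) _ => t t01.
  by rewrite clamp_id.
by apply: htpy_eq (path_clamp lk) _ => t t01; rewrite clamp_id.
Qed.

Lemma lhtpy_sym (T : topologicalType) (S : set T) x g h :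
  is_loop S x g -> is_loop S x h ->
  loop_homotopic S x g h -> loop_homotopic S x h g.
Proof.
move=> lg lh /htpy_clamp gh.
apply: htpy_loop; apply: htpy_trans (htpy_trans _ (htpy_sym gh)) _.
  apply: htpy_sym; apply: htpy_eq (path_clamp lh) _ => t t01.
  by rewrite clamp_id.
by apply: htpy_eq (path_clamp lg) _ => t t01; rewrite clamp_id.
Qed.

(** [is_loop] only asks for continuity within [0, 1]; the concatenation of the clamped loops is
    continuous everywhere and agrees with the given one there. *)
Lemma is_loop_cat (T : topologicalType) (S : set T) x g h :
  is_loop S x g -> is_loop S x h -> is_loop S x (loop_concat g h).
Proof.
move=> lg lh; have := path_clamp (path_loop (path_cat (path_clamp lg) (path_clamp lh))).
have e t : 0 <= t <= 1 -> loop_concat (fun t => g (clamp t))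
    (fun t => h (clamp t)) t = loop_concat g h t.
  move=> t01; rewrite /loop_concat; case: ifP => t12; rewrite clamp_id //; lra.
move=> [c c0 c1 cS]; rewrite clamp0 e ?lexx ?ler01 // in c0.
rewrite clamp1 e ?lexx ?ler01 // in c1.
split; last first.
  split=> //; split=> // t t01.
  by have := cS t; rewrite e clamp_id.
apply: (@subspace_eq_continuous _ _ _ (fun t => loop_concat (fun t => g (clamp t))
    (fun t => h (clamp t)) (clamp t))).
  move=> t; rewrite inE /= in_itv /= => t01.
  by rewrite clamp_id // e.
exact: continuous_subspaceT.
Qed.

Section Iso.
Context {T1 T2 : topologicalType} (S1 : set T1) (z1 : T1) (S2 : set T2) (z2 : T2).
Hypothesis iso : pi1_isomorphic S1 z1 S2 z2.

(** The isomorphism is just a map [f] on loops. A section [e], chosen loop by loop up to homotopy,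
    carries representations the other way; injectivity of [f] on classes makes the result well
    defined and multiplicative. *)
Lemma iso_reps : exists f : (RR -> T1) -> (RR -> T2),
  [/\ forall g, is_loop S1 z1 g -> is_loop S2 z2 (f g),
      forall (G : groupType) (R : (RR -> T2) -> G), loop_rep S2 z2 R ->
        loop_rep S1 z1 (fun g => R (f g)) &
      forall (G : groupType) (R : (RR -> T1) -> G), loop_rep S1 z1 R ->
        exists2 R' : (RR -> T2) -> G, loop_rep S2 z2 R' &
          (forall g, is_loop S1 z1 g -> R' (f g) = R g) /\
          (forall k, is_loop S2 z2 k -> exists g, [/\ is_loop S1 z1 g,
              loop_homotopic S2 z2 (f g) k & R' k = R g])].
Proof.
have [f [fl [fh [fs fm]]]] := iso; exists f; split=> //.
  move=> G R [rh rm]; split=> [g h lg lh gh|g h lg lh].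
    by apply: rh; [exact: fl|exact: fl|apply/fh].
  rewrite -rm; [|exact: fl|exact: fl].
  apply: rh; [| |exact: fm].
    by apply: fl; apply: is_loop_cat.
  by apply: is_loop_cat; apply: fl.
move=> G R [rh rm].
have /choice[e eP] k : exists g, is_loop S2 z2 k ->
    is_loop S1 z1 g /\ loop_homotopic S2 z2 (f g) k.
  have [lk|nk] := pselect (is_loop S2 z2 k); last by exists (cst z1).
  by have [g gk] := fs k lk; exists g.
exists (fun k => R (e k)); last first.
  split=> [g lg|k lk]; last first.
    by have [a b] := eP k lk; exists (e k).
  have [a b] := eP _ (fl _ lg); apply: rh => //.
  by apply/fh.
split=> [k k' lk lk' kk'|k k' lk lk'].
  have [a b] := eP _ lk; have [a' b'] := eP _ lk'.
  apply: rh => //; apply/fh => //.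
  apply: lhtpy_trans b _; [exact: fl|exact: fl|].
  apply: lhtpy_trans kk' _ => //; first exact: fl.
  by apply: lhtpy_sym b' => //; exact: fl.
have [a b] := eP _ lk; have [a' b'] := eP _ lk'.
have lkk := is_loop_cat lk lk'; have [a2 b2] := eP _ lkk.
rewrite -rm //; apply: rh => //; first exact: is_loop_cat.
apply/fh => //; first exact: is_loop_cat.
have la := fl _ a; have la' := fl _ a'; have l2 := fl _ a2.
have laa := fl _ (is_loop_cat a a').
apply: lhtpy_trans b2 _ => //.
apply: (lhtpy_sym laa lkk).
apply: (lhtpy_trans laa lkk (fm _ _ a a')).
apply: htpy_loop.
have H := htpy_cat (htpy_clamp b) (htpy_clamp b').
have ee g h : is_loop S2 z2 g -> is_loop S2 z2 h ->
    htpy S2 z2 z2 (loop_concat (fun t => g (clamp t)) (fun t => h (clamp t)))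
      (loop_concat g h).
  move=> lg lh; apply: htpy_eq; first exact: path_cat (path_clamp lg) (path_clamp lh).
  move=> t t01; rewrite /loop_concat; case: ifP => t12; rewrite clamp_id //; lra.
apply: htpy_trans (htpy_sym (ee _ _ la la')) _.
exact: htpy_trans H (ee _ _ lk lk').
Qed.

Context {I J : finType} (al : I -> (RR -> T1) -> radd) (be : J -> (RR -> T2) -> radd).
Context (flat1 : {set I} -> Prop) (line1 : I -> I -> I -> Prop).
Context (flat2 : {set J} -> Prop) (line2 : J -> J -> J -> Prop).
Hypothesis spec1 : loop_spec S1 z1 al flat1 line1.
Hypothesis spec2 : loop_spec S2 z2 be flat2 line2.

(** [M] and [N] are the matrices of the induced maps on H^1 in the two bases. Lifts travel with the
    representations, so a pair lifting on one side satisfies the flat condition of the other. *)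
Lemma spec_iso : exists (M : J -> I -> rat) (N : I -> J -> rat),
  [/\ forall j j', \sum_i M j i * N i j' = (j == j')%:R,
      forall i i', \sum_j N i j * M j i' = (i == i')%:R,
      forall a b c, line2 a b c -> flat_condition flat1
        (fun i => \sum_j delta a c j * M j i) (fun i => \sum_j delta b c j * M j i) &
      forall a b c, line1 a b c -> flat_condition flat2
        (fun j => \sum_i delta a c i * N i j) (fun j => \sum_i delta b c i * N i j)].
Proof.
have [f [fl pull push]] := iso_reps.
have [r1 s1 i1 l1 u1] := spec1; have [r2 s2 i2 l2 u2] := spec2.
have /choice[M MP] j : exists a : I -> rat, forall L, is_loop S1 z1 L ->
    (be j (f L) : rat) = comb al a L by exact: s1 (pull _ _ (r2 j)).
have /choice[N NP] i : exists b : J -> rat, forall L, is_loop S1 z1 L ->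
    (al i L : rat) = comb be b (f L).
  have [R' R'P [e1 _]] := push _ _ (r1 i); have [b bP] := s2 _ R'P.
  by exists b => L lL; rewrite -e1 // bP //; exact: fl.
have tr1 a L : is_loop S1 z1 L ->
    comb be a (f L) = comb al (fun i => \sum_j a j * M j i) L.
  move=> lL; rewrite /comb; under eq_bigr => j _ do rewrite MP // mulr_sumr.
  rewrite exchange_big; apply: eq_bigr => i _ /=; rewrite mulr_suml.
  by apply: eq_bigr => j _; rewrite mulrA.
have tr2 b L : is_loop S1 z1 L ->
    comb al b L = comb be (fun j => \sum_i b i * N i j) (f L).
  move=> lL; rewrite /comb; under eq_bigr => i _ do rewrite NP // mulr_sumr.
  rewrite exchange_big; apply: eq_bigr => j _ /=; rewrite mulr_suml.
  by apply: eq_bigr => i _; rewrite mulrA.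
have combB (K : finType) (T : topologicalType) (ga : K -> (RR -> T) -> radd) a b L :
    comb ga (fun k => a k - b k) L = comb ga a L - comb ga b L.
  by rewrite /comb -sumrB; apply: eq_bigr => k _; rewrite mulrBl.
have comb1 (K : finType) (T : topologicalType) (ga : K -> (RR -> T) -> radd) k L :
    comb ga (fun k' => (k == k')%:R) L = ga k L.
  rewrite /comb (bigD1 k) //= eqxx mul1r big1 ?addr0 // => k' /negbTE.
  by rewrite eq_sym => ->; rewrite mul0r.
exists M, N; split.
- move=> j j'; apply/eqP; rewrite -subr_eq0; apply/eqP; move: j'.
  apply: i2 => L lL.
  have [R' R'P [_ e2]] := push _ _ (pull _ _ (r2 j)).
  have [g [lg gL _]] := e2 _ lL.
  have [r2h _] := r2 j.
  have combL a : comb be a L = comb be a (f g).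
    apply: eq_bigr => k _; congr (_ * _); apply: (r2 k).1 => //; first exact: fl.
    by apply: lhtpy_sym gL => //; exact: fl.
  rewrite combL combB comb1 MP //.
  by rewrite -(tr2 (M j)) // subrr.
- move=> i i'; apply/eqP; rewrite -subr_eq0; apply/eqP; move: i'.
  apply: i1 => L lL; rewrite combB comb1 -tr1 //.
  by rewrite -NP // subrr.
- move=> a b c /l2[R RP RE]; apply: u1; exists (fun g => R (f g)); first exact: pull.
  move=> L lL; have [ea eb] := RE _ (fl _ lL).
  by rewrite -!tr1.
- move=> a b c /l1[R RP RE]; apply: u2.
  have [R' R'P [_ e2]] := push _ _ RP; exists R' => // L lL.
  have [g [lg gL ->]] := e2 _ lL.
  have combL d : comb be d L = comb be d (f g).
    apply: eq_bigr => k _; congr (_ * _); apply: (r2 k).1 => //; first exact: fl.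
    by apply: lhtpy_sym gL => //; exact: fl.
  by have [ea eb] := RE _ lg; rewrite !combL -!tr2.
Qed.

End Iso.

(** * Geodesics of the tope graph *)

Section QSpec.
Local Open Scope set_scope.
Implicit Types (T U R W : tvec) (v w u : tpair).

(** [U] lies on a geodesic from [T] to [R]. In these terms [(T, R)] is below [(T', R')] when [T'],
    [T], [R], [R'] follow each other on a geodesic. *)
Definition between T U R : Prop := forall f, (T f != U f) ==> (T f != R f).

Lemma sepsetP T U R : reflect (between T U R) (sepset T U \subset sepset T R).
Proof.
apply: (iffP idP) => [/fintype.subsetP h f|h].
  by apply/implyP; have := h f; rewrite !inE.
by apply/fintype.subsetP => f; rewrite !inE; apply/implyP/h.
Qed.

Lemma Q_leP v w : reflect (between w.1 v.1 v.2 /\ between w.1 v.2 w.2) (Q_le v w).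
Proof.
by apply: (iffP andP) => [[/sepsetP a /sepsetP b]|[/sepsetP a /sepsetP b]].
Qed.

Ltac bits := repeat match goal with
  | |- context [fun_of_fin ?T ?f] => case: (fun_of_fin T f) end.

Lemma between_l T R : between T T R. Proof. by move=> f; rewrite eqxx. Qed.
Lemma between_r T R : between T R R. Proof. by move=> f; apply/implyP. Qed.

Lemma Q_le_between v w u : Q_le v w -> Q_le w u -> between u.1 w.1 v.1.
Proof.
by move=> /Q_leP[a b] /Q_leP[c d] f; move: (a f) (b f) (c f) (d f); bits.
Qed.

Lemma Q_le_trans v w u : Q_le v w -> Q_le w u -> Q_le v u.
Proof.
move=> /Q_leP[a b] /Q_leP[c d]; apply/Q_leP.
by split=> f; move: (a f) (b f) (c f) (d f); bits.
Qed.

Lemma Q_le_anti v w : Q_le v w -> Q_le w v -> v.1 = w.1.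
Proof.
move=> /Q_leP[a b] /Q_leP[c d]; apply/ffunP => f.
by move: (a f) (b f) (c f) (d f); bits.
Qed.

Lemma Q_leTR T U R : between T U R -> Q_le (T, U) (T, R).
Proof. by move=> h; apply/Q_leP; split=> //; apply: between_l. Qed.

Lemma Q_leRT T U R : between T U R -> Q_le (U, R) (T, R).
Proof. by move=> h; apply/Q_leP; split=> //; apply: between_r. Qed.

Section Geodesic.
Context {G : groupType}.
Implicit Type m : tvec -> tvec -> G.

(* Multiplicative along geodesics of the tope graph: a representation of the
   Deligne groupoid. *)
Definition geodesic m : Prop := forall T U R, is_tope T -> is_tope U -> is_tope R ->
  between T U R -> m T R = (m T U * m U R)%g.

(** The pair [(T, R)] is sent to the object [T]. A step down in the poset becomes the positive path
    between first components, a step up its inverse. *)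
Definition geo_edge m v w : G := if Q_le v w then (m w.1 v.1)^-1%g else m v.1 w.1.

Lemma geodesic_id m T : geodesic m -> is_tope T -> m T T = 1%g.
Proof.
move=> mP tT; apply: (@mulgI _ (m T T)).
by rewrite mulg1 -mP //; apply: between_l.
Qed.

Lemma geo_edgeV m v w : geodesic m -> in_Q v -> in_Q w -> qcomp v w ->
  geo_edge m v w = (geo_edge m w v)^-1%g.
Proof.
move=> mP [v1 v2] [w1 w2] /orP[] h; rewrite /geo_edge h.
  case: ifP => [h'|//]; have e := Q_le_anti h h'.
  by rewrite e geodesic_id // !invg1.
case: ifP => [h'|_]; last by rewrite invgK.
by rewrite (Q_le_anti h h') geodesic_id // !invg1.
Qed.

Lemma geo_edgeM m v w u : geodesic m -> in_Q v -> in_Q w -> in_Q u ->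
  Q_le v w -> Q_le w u -> geo_edge m v u = (geo_edge m v w * geo_edge m w u)%g.
Proof.
move=> mP [v1 _] [w1 _] [u1 _] vw wu.
rewrite /geo_edge vw wu (Q_le_trans vw wu) -invgM; congr (_^-1)%g.
by apply: mP => //; apply: Q_le_between vw wu.
Qed.

Lemma geo_chain m : geodesic m -> chain_cocycle (geo_edge m).
Proof.
move=> mP v w u Qv Qw Qu vw wu vu.
have M := geo_edgeM mP; have V := geo_edgeV mP.
have inv x y z : (x = y * z)%g -> forall y' : G, (y = y'^-1)%g -> (z = y' * x)%g.
  by move=> {x} -> y' ->; rewrite mulVKg.
have inv' x y z : (x = y * z)%g -> forall z' : G, (z = z'^-1)%g -> (y = x * z')%g.
  by move=> {x} -> z' ->; rewrite mulgVK.
(* Eight ways to orient the three comparabilities; each follows from the monotone rule [M] by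
   inverting edges with [V]. *)
have [vw'|vw'] := orP vw; have [wu'|wu'] := orP wu; have [vu'|vu'] := orP vu.
- exact: M.
- exact: M.
- exact: (inv' _ _ _ (M v u w Qv Qu Qw vu' wu') _ (V _ _ Qu Qw (ltac:(by rewrite qcompC)))).
- have e := inv' _ _ _ (M u v w Qu Qv Qw vu' vw') _ (V _ _ Qv Qw vw).
  by rewrite (V v u) // e invgM -(V v w) // -(V w u).
- exact: (inv _ _ _ (M w v u Qw Qv Qu vw' vu') _ (V _ _ Qw Qv (ltac:(by rewrite qcompC)))).
- have e := M w u v Qw Qu Qv wu' vu'.
  rewrite (V v w) // e invgM -(V v u) //.
  by rewrite -mulgA mulVg mulg1.
- rewrite (V v u) // (M u w v Qu Qw Qv wu' vw') invgM -(V v w) //.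
  by rewrite -(V w u).
- rewrite (V v u) // (M u w v Qu Qw Qv wu' vw') invgM -(V v w) //.
  by rewrite -(V w u).
Qed.

(* Up to a coboundary, every chain cocycle comes from this geodesic map. *)
Definition edge_geo (e : tpair -> tpair -> G) T R : G :=
  (e (T, T) (T, R) * e (T, R) (R, R))%g.

(** When [T], [U], [R] are in geodesic order, the pairs [(T, U)], [(U, U)], [(U, R)] and the
    diagonal ones all lie below [(T, R)], so every zigzag through them can be straightened there. *)
Lemma chain_geo e : chain_cocycle e -> geodesic (edge_geo e).
Proof.
move=> eP T U R tT tU tR TUR; rewrite /edge_geo.
have le v w : Q_le v w -> qcomp v w by rewrite /qcomp => ->.
have ge v w : Q_le w v -> qcomp v w by rewrite /qcomp => ->; rewrite orbT.
have TTTU := Q_leTR (@between_l T U); have TTTR := Q_leTR (@between_l T R).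
have UUUR := Q_leTR (@between_l U R); have UUTU := Q_leRT (@between_r T U).
have RRTR := Q_leRT (@between_r T R); have RRUR := Q_leRT (@between_r U R).
have TUTR := Q_leTR TUR; have URTR := Q_leRT TUR.
have UUTR := Q_le_trans UUUR URTR.
rewrite (eP (T, T) (T, U) (T, R)) //; try by [apply: le | split].
rewrite (eP (T, U) (U, U) (T, R)) //; try by [apply: le | apply: ge | split].
rewrite (eP (U, U) (U, R) (T, R)) //; try by [apply: le | apply: ge | split].
rewrite (eP (U, R) (T, R) (R, R)) //; try by [apply: le | apply: ge | split].
by rewrite !mulgA.
Qed.

(** The coboundary compares [v] with the diagonal pair [(v.1, v.1)], which lies below it. *)
Lemma chain_geo_edge e v w : chain_cocycle e -> in_Q v -> in_Q w -> qcomp v w ->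
  e v w = ((e (v.1, v.1) v)^-1 * geo_edge (edge_geo e) v w * e (w.1, w.1) w)%g.
Proof.
move=> eP; have gP := chain_geo eP.
have le a b : Q_le a b -> qcomp a b by rewrite /qcomp => ->.
have ge a b : Q_le b a -> qcomp a b by rewrite /qcomp => ->; rewrite orbT.
have eid a : in_Q a -> e a a = 1%g.
  move=> Qa; have c := qcompxx a; apply: (@mulgI _ (e a a)).
  by rewrite mulg1 -(eP a a a).
have eV a b : in_Q a -> in_Q b -> qcomp a b -> e a b = (e b a)^-1%g.
  move=> Qa Qb ab; apply: (@mulIg _ (e b a)).
  by rewrite mulVg -(eP a b a) ?eid ?qcompxx // qcompC.
have main a b : in_Q a -> in_Q b -> Q_le a b ->
    e a b = ((e (a.1, a.1) a)^-1 * geo_edge (edge_geo e) a b * e (b.1, b.1) b)%g.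
  case: a b => [T R] [T' R'] /= [tT tR] [tT' tR'] h; rewrite /geo_edge h /=.
  have [b1 b2] := Q_leP _ _ h; rewrite /= in b1 b2.
  have TTTR := Q_leTR (@between_l T R); have TTb := Q_le_trans TTTR h.
  have b3 : between T' T R' by move=> f; move: (b1 f) (b2 f); bits.
  have l1 := Q_leTR b3.
  have TTT'T := Q_leRT (@between_r T' T).
  have T'T'T'T := Q_leTR (@between_l T' T).
  have T'T'b := Q_leTR (@between_l T' R').
  apply: (@mulgI _ (e (T, T) (T, R))); rewrite !mulgA mulgV mul1g.
  rewrite -eP //; try by [split | exact: le].
  rewrite (eP (T, T) (T', T) (T', R')) //; try by [split | exact: le].
  rewrite (eP (T', T') (T', T) (T', R')) //; try by [split | exact: le].
  rewrite /edge_geo invgM mulgA mulgVK; congr (_ * _)%g.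
  by apply: eV; try by [split | exact: le].
move=> Qv Qw /orP[h|h]; first exact: main.
rewrite (eV v w) //; last exact: ge.
rewrite (main w v) // !invgM invgK mulgA; congr (_ * _ * _)%g.
by rewrite -(geo_edgeV gP) //; exact: ge.
Qed.

Lemma geo_edge_geo m T R : geodesic m -> is_tope T -> is_tope R ->
  edge_geo (geo_edge m) T R = m T R.
Proof.
move=> mP tT tR; rewrite /edge_geo /geo_edge (Q_leTR (@between_l T R)) /=.
rewrite geodesic_id // invg1 mul1g; case: ifP => // h.
have e := Q_le_anti h (Q_leRT (@between_r T R)); rewrite /= in e.
by rewrite e geodesic_id // invg1.
Qed.

End Geodesic.

(** Only the passage from the negative to the positive side counts, so that crossing a wall and
    coming back has value 1. *)
Definition crossing (f : 'I_9) T R : radd := (~~ T f && R f)%:R.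

Lemma crossing_geo f : geodesic (crossing f).
Proof.
move=> T U R _ _ _ /(_ f); rewrite /crossing raddM.
by case: (T f); case: (U f); case: (R f) => //= _; rewrite ?addr0 ?add0r.
Qed.

Lemma crossing_pair f T R : (crossing f T R + crossing f R T : rat) = (T f != R f)%:R.
Proof. by rewrite /crossing; case: (T f); case: (R f). Qed.

(* A representation in an abelian group is determined up to a coboundary by
   the values of the meridians T -> R -> T with T, R adjacent. *)
Lemma geodesic_span (m : tvec -> tvec -> radd) : geodesic m ->
  exists (a : 'I_9 -> rat) (P : tvec -> rat), forall T R, is_tope T -> is_tope R ->
    (m T R : rat) = \sum_f a f * crossing f T R + P R - P T.
Proof.
move=> mP.
(* The value of [T -> R -> T] depends on the wall [f] alone. For [T] and [U] on the same side of
   [f], compare the two geodesics from [T] to [W] and the two from [R] to [U]. *)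
have mu_eq f T R U W : is_tope T -> is_tope R -> is_tope U -> is_tope W ->
    R = flipT T [set f] -> W = flipT U [set f] ->
    (m T R : rat) + m R T = (m U W : rat) + m W U.
  have aux T' R' U' W' : is_tope T' -> is_tope R' -> is_tope U' -> is_tope W' ->
      R' = flipT T' [set f] -> W' = flipT U' [set f] -> T' f = U' f ->
      (m T' R' : rat) + m R' T' = (m U' W' : rat) + m W' U'.
    move=> tT tR tU tW eR eW TU.
    have bR x : R' x = T' x (+) (x == f) by rewrite eR !ffunE !inE.
    have bW x : W' x = U' x (+) (x == f) by rewrite eW !ffunE !inE.
    have e1 : (m T' W' : rat) = m T' U' + m U' W'.
      apply: mP => // x; rewrite ?bR ?bW.
      case: (x =P f) => [->|_]; first by rewrite TU; case: (U' f).
      by rewrite addbF; case: (T' x); case: (U' x).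
    have e2 : (m T' W' : rat) = m T' R' + m R' W'.
      apply: mP => // x; rewrite ?bR ?bW.
      case: (x =P f) => [->|_]; first by rewrite TU; case: (U' f).
      by rewrite addbF; case: (T' x); case: (U' x).
    have e3 : (m R' U' : rat) = m R' T' + m T' U'.
      apply: mP => // x; rewrite ?bR ?bW.
      case: (x =P f) => [->|_]; first by rewrite TU; case: (U' f).
      by rewrite addbF; case: (T' x); case: (U' x).
    have e4 : (m R' U' : rat) = m R' W' + m W' U'.
      apply: mP => // x; rewrite ?bR ?bW.
      case: (x =P f) => [->|_]; first by rewrite TU; case: (U' f).
      by rewrite addbF; case: (T' x); case: (U' x).
    by lra.
  move=> tT tR tU tW eR eW.
  have [TU|TU] := eqVneq (T f) (U f); first exact: aux.
  rewrite [RHS]addrC; apply: aux => //.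
    rewrite eW; apply/ffunP => x; rewrite !ffunE !inE.
    by rewrite -addbA addbb addbF.
  by rewrite eW ffunE inE eqxx addbT; case: (T f) (U f) TU => [] [].
have /choice[a aP] f : exists a : rat, forall T R, is_tope T -> is_tope R ->
    R = flipT T [set f] -> (m T R : rat) + m R T = a.
  have [[T [R [tT tR e]]]|none] :=
      pselect (exists T R, [/\ is_tope T, is_tope R & R = flipT T [set f]]).
    by exists ((m T R : rat) + m R T) => U W tU tW e'; apply: mu_eq e.
  by exists 0 => T R tT tR e; case: none; exists T, R.
(* Without its meridian part, [m'] is antisymmetric on adjacent topes and hence has the potential
   [m' B], by induction on the distance. *)
pose m' T R : rat := m T R - \sum_f a f * crossing f T R.
have m'P T U R : is_tope T -> is_tope U -> is_tope R -> between T U R ->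
    m' T R = m' T U + m' U R.
  move=> tT tU tR b; rewrite /m' (mP T U R) //.
  have -> : \sum_f a f * (crossing f T R : rat) =
     \sum_f a f * (crossing f T U : rat) + \sum_f a f * (crossing f U R : rat).
    rewrite -big_split /=; apply: eq_bigr => f _.
    by rewrite -mulrDr (@crossing_geo f T U R).
  by rewrite raddM; lra.
have adj0 f T R : is_tope T -> is_tope R -> R = flipT T [set f] ->
    m' T R + m' R T = 0.
  move=> tT tR e; rewrite /m'.
  have := aP f T R tT tR e.
  have : \sum_g a g * (crossing g T R : rat) + \sum_g a g * (crossing g R T : rat) = a f.
    rewrite -big_split /= (bigD1 f) //= -mulrDr crossing_pair e.
    rewrite ffunE inE eqxx big1.
      by case: (T f); rewrite /= mulr1 addr0.
    move=> g gf; rewrite -mulrDr crossing_pair ffunE inE (negbTE gf).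
    by rewrite addbF eqxx mulr0.
  by lra.
have [B tB] : exists B, is_tope B.
  by have [T tT _] := tope_wall ord0; exists T.
have step f U V : is_tope U -> is_tope V -> V = flipT U [set f] ->
    m' U V = m' B V - m' B U.
  move=> tU tV e.
  have [BU|BU] := eqVneq (B f) (U f).
    rewrite (m'P B U V) //; first by lra.
    move=> x; rewrite e ffunE inE; case: (x =P f) => [->|_].
      by rewrite BU eqxx.
    by rewrite addbF; apply/implyP.
  have := adj0 f U V tU tV e.
  rewrite (m'P B V U) //; first by lra.
  move=> x; rewrite e ffunE inE; case: (x =P f) => [->|_].
    by rewrite BU implybT.
  by rewrite addbF; apply/implyP.
have pot n : forall T R, is_tope T -> is_tope R -> (#|sepset T R| <= n)%N ->
    m' T R = m' B R - m' B T.
  elim: n => [|n IH] T R tT tR c.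
    have -> : T = R.
      apply/ffunP => f; apply/eqP; apply: contraTT c => d.
      by rewrite -ltnNge card_gt0; apply/set0Pn; exists f; rewrite inE.
    have := m'P R R R tR tR tR (@between_l R R); lra.
  have [->|/eqP TR] := eqVneq T R.
    have := m'P R R R tR tR tR (@between_l R R); lra.
  have [f fTR tU] := tope_adjacent tT tR TR.
  have b : between T (flipT T [set f]) R.
    move=> x; rewrite ffunE inE; case: (x =P f) => [->|_]; first by rewrite fTR implybT.
    by rewrite addbF eqxx.
  suff cl : (#|sepset (flipT T [set f]) R| <= n)%N.
    have := m'P T (flipT T [set f]) R tT tU tR b.
    have := step f T (flipT T [set f]) tT tU erefl.
    by have := IH (flipT T [set f]) R tU tR cl; lra.
  rewrite -ltnS; apply: leq_trans c.
  apply: proper_card; apply/properP; split.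
    apply/fintype.subsetP => x; rewrite !inE ffunE inE.
    by case: (x =P f) => [->|_]; rewrite ?fTR // addbF.
  exists f; first by rewrite inE.
  by rewrite !inE ffunE inE eqxx addbT; case: (T f) (R f) fTR => [] [].
exists a, (m' B) => T R tT tR.
have := pot _ T R tT tR (leqnn _); rewrite /m'; lra.
Qed.

End QSpec.

(** * First cohomology and lifting pairs of the tope-pairs poset *)

Section QSpecProof.
Local Open Scope set_scope.
Implicit Types (T U R W : tvec) (v w u : tpair).

(** [half] moves the meridian of [i] at a tope along the half turn around [X] to the opposite tope,
    because both [A1] and [B1] lie on geodesics from [A0] to [B0]. Two half turns make the full
    one. *)
Lemma full_twist_commute (G : groupType) (m : tvec -> tvec -> G) T0 (X : {set 'I_9}) i :
  let T1 := flipT T0 [set i] in let R0 := flipT T0 X in let R1 := flipT R0 [set i] in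
  geodesic m -> i \in X -> is_tope T0 -> is_tope T1 -> is_tope R0 -> is_tope R1 ->
  ((m T0 T1 * m T1 T0) * (m T0 R0 * m R0 T0) =
   (m T0 R0 * m R0 T0) * (m T0 T1 * m T1 T0))%g.
Proof.
move=> T1 R0 R1 mP iX tT0 tT1 tR0 tR1.
have half A0 A1 B0 B1 : is_tope A0 -> is_tope A1 -> is_tope B0 -> is_tope B1 ->
    (forall f, A1 f = A0 f (+) (f == i)) -> (forall f, B0 f = A0 f (+) (f \in X)) ->
    (forall f, B1 f = B0 f (+) (f == i)) ->
    (m A0 A1 * m A1 A0 * m A0 B0 = m A0 B0 * (m B0 B1 * m B1 B0))%g.
  move=> tA0 tA1 tB0 tB1 A1E B0E B1E.
  have b1 : between A0 A1 B0.
    move=> f; rewrite A1E B0E; case: (f =P i) => [->|_]; first by rewrite iX implybb.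
    by rewrite addbF eqxx.
  have b2 : between A1 B0 B1.
    move=> f; rewrite B1E A1E B0E; case: (f =P i) => [->|_]; last by rewrite !addbF implybb.
    by rewrite iX eqxx.
  have b3 : between A1 A0 B1.
    move=> f; rewrite B1E A1E B0E; case: (f =P i) => [->|_]; last by rewrite !addbF eqxx.
    by rewrite iX; case: (A0 i).
  have b4 : between A0 B1 B0.
    move=> f; rewrite B1E B0E; case: (f =P i) => [->|_]; last by rewrite !addbF implybb.
    by rewrite iX; case: (A0 i).
  have e1 := mP _ _ _ tA0 tA1 tB0 b1; have e2 := mP _ _ _ tA1 tB0 tB1 b2.
  have e3 := mP _ _ _ tA1 tA0 tB1 b3; have e4 := mP _ _ _ tA0 tB1 tB0 b4.
  rewrite [in LHS]e4 -!mulgA [(m A1 A0 * _)%g]mulgA -e3 e2 !mulgA.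
  by rewrite -e1.
have T1E f : T1 f = T0 f (+) (f == i) by rewrite ffunE inE.
have R0E f : R0 f = T0 f (+) (f \in X) by rewrite ffunE.
have R1E f : R1 f = R0 f (+) (f == i) by rewrite ffunE inE.
have T0E f : T0 f = R0 f (+) (f \in X) by rewrite R0E -addbA addbb addbF.
have h1 := half T0 T1 R0 R1 tT0 tT1 tR0 tR1 T1E R0E R1E.
have h2 := half R0 R1 T0 T1 tR0 tR1 tT0 tT1 R1E T0E T1E.
by rewrite mulgA h1 -[LHS]mulgA h2 mulgA.
Qed.

Lemma QQ_connected : path_connected QQ.
Proof.
have toV x : QQ x -> exists g, path QQ x (vertex (top_vertex x)) g.
  move=> Qx; exists (seg x (vertex (top_vertex x))).
  apply: path_seg => //; first by apply: QQ_vertex; apply: top_vertexQ.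
  by apply: joined_vertexr => //; rewrite gt_eqF // top_vertex_gt0.
have vv v w : in_Q v -> in_Q w -> qcomp v w ->
    exists g, path QQ (vertex v) (vertex w) g.
  move=> Qv Qw vw; exists (seg (vertex v) (vertex w)).
  by apply: path_seg; [exact: QQ_vertex|exact: QQ_vertex|exact: joined_vertex].
have tr x y z : (exists g, path QQ x y g) -> (exists g, path QQ y z g) ->
    exists g, path QQ x z g.
  by move=> [g pg] [h ph]; exists (loop_concat g h); apply: path_cat pg ph.
have sy x y : (exists g, path QQ x y g) -> exists g, path QQ y x g.
  by move=> [g pg]; exists (rev g); apply: path_rev pg.
have VV v w : in_Q v -> in_Q w -> exists g, path QQ (vertex v) (vertex w) g.
  case: v w => [T R] [T' R'] [/= tT tR] [/= tT' tR'].
  apply: (tr _ (vertex (T, T))).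
    by apply: vv => //; rewrite /qcomp (Q_leTR (@between_l T R)) orbT.
  apply: (tr _ (vertex (T, T'))).
    by apply: vv => //; rewrite /qcomp (Q_leTR (@between_l T T')).
  apply: (tr _ (vertex (T', T'))).
    by apply: vv => //; rewrite /qcomp (Q_leRT (@between_r T T')) orbT.
  by apply: vv => //; rewrite /qcomp (Q_leTR (@between_l T' R')).
move=> x y Qx Qy; apply: (tr _ _ _ (toV x Qx)); apply: sy; apply: (tr _ _ _ (toV y Qy)).
by apply: VV; exact: top_vertexQ.
Qed.

Lemma tope_loop T R : is_tope T -> is_tope R -> exists2 L,
  path QQ (vertex (T, T)) (vertex (T, T)) L &
  forall (G : groupType) (rho : (RR -> realization_space) -> G), grpd_rep QQ rho ->
    rho L = (edge_geo (edge rho) T R * edge_geo (edge rho) R T)%g.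
Proof.
move=> tT tR.
have pe v w : in_Q v -> in_Q w -> qcomp v w ->
    path QQ (vertex v) (vertex w) (seg (vertex v) (vertex w)).
  move=> Qv Qw vw.
  by apply: path_seg; [exact: QQ_vertex|exact: QQ_vertex|exact: joined_vertex].
have p1 := pe (T, T) (T, R) (conj tT tT) (conj tT tR)
  (ltac:(by rewrite /qcomp (Q_leTR (@between_l T R)))).
have p2 := pe (T, R) (R, R) (conj tT tR) (conj tR tR)
  (ltac:(by rewrite /qcomp (Q_leRT (@between_r T R)) orbT)).
have p3 := pe (R, R) (R, T) (conj tR tR) (conj tR tT)
  (ltac:(by rewrite /qcomp (Q_leTR (@between_l R T)))).
have p4 := pe (R, T) (T, T) (conj tR tT) (conj tT tT)
  (ltac:(by rewrite /qcomp (Q_leRT (@between_r R T)) orbT)).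
have p12 := path_cat p1 p2; have p34 := path_cat p3 p4.
exists (loop_concat (loop_concat (seg (vertex (T, T)) (vertex (T, R)))
  (seg (vertex (T, R)) (vertex (R, R)))) (loop_concat (seg (vertex (R, R))
  (vertex (R, T))) (seg (vertex (R, T)) (vertex (T, T))))).
  exact: path_cat p12 p34.
move=> G rho [_ rM].
by rewrite (rM _ _ _ _ _ p12 p34) (rM _ _ _ _ _ p1 p2) (rM _ _ _ _ _ p3 p4).
Qed.

(** Signs of [T] and of [R] at three elements of a line give a lift of the two crossing differences;
    the corner entry is what makes [heis_bitsM] hold. That rule concerns the six sign triples
    allowed by [line_bits], those of the regions around the line. *)
Definition heis_bits (t1 t2 t3 r1 r2 r3 : bool) : heis :=
  ((~~ t1 && r1)%:R - (~~ t3 && r3)%:R, (~~ t2 && r2)%:R - (~~ t3 && r3)%:R,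
   [&& ~~ t1, ~~ t2, r2 & t3 || ~~ r3]%:R).

Definition line_bits (t1 t2 t3 : bool) : bool := ~~ ((t2 != t1) && (t2 != t3)).

Lemma heis_bitsM (t1 t2 t3 u1 u2 u3 r1 r2 r3 : bool) :
  line_bits t1 t2 t3 -> line_bits u1 u2 u3 -> line_bits r1 r2 r3 ->
  (t1 != u1) ==> (t1 != r1) -> (t2 != u2) ==> (t2 != r2) ->
  (t3 != u3) ==> (t3 != r3) ->
  heis_bits t1 t2 t3 r1 r2 r3 =
    (heis_bits t1 t2 t3 u1 u2 u3 * heis_bits u1 u2 u3 r1 r2 r3)%g.
Proof.
case: t1; case: t2; case: t3 => //= _; case: u1; case: u2; case: u3 => //= _;
  case: r1; case: r2; case: r3 => //= _ _ _ _; apply/eqP; vm_compute; reflexivity.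
Qed.

Lemma comb_rep (T : topologicalType) (S : set T) (I : finType)
    (alpha : I -> (RR -> T) -> radd) (a : I -> rat) :
  (forall i, grpd_rep S (alpha i)) ->
  grpd_rep S (fun g => comb alpha a g : radd).
Proof.
move=> aP; split=> [x y g h pg ph gh|x y z g h pg ph].
  by apply: eq_bigr => i _; rewrite ((aP i).1 x y g h).
rewrite raddM /comb -big_split /=; apply: eq_bigr => i _.
by rewrite ((aP i).2 x y z g h) // raddM mulrDr.
Qed.

Lemma comb_delta (T : topologicalType) (I : finType)
    (alpha : I -> (RR -> T) -> radd) i k g :
  comb alpha (delta i k) g = (alpha i g : rat) - alpha k g.
Proof.
rewrite /comb /delta; under eq_bigr => j _ do rewrite mulrBl.
rewrite sumrB; congr (_ - _).
  by rewrite (bigD1 i) //= eqxx mul1r big1 ?addr0 // => j /negbTE ->; rewrite mul0r.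
by rewrite (bigD1 k) //= eqxx mul1r big1 ?addr0 // => j /negbTE ->; rewrite mul0r.
Qed.

Lemma sum_mem (a : 'I_9 -> rat) (X : {set 'I_9}) :
  \sum_f a f * (f \in X)%:R = \sum_(f in X) a f.
Proof.
rewrite [RHS]big_mkcond /=; apply: eq_bigr => f _.
by case: ifP => _; rewrite ?mulr1 ?mulr0.
Qed.

Theorem QQ_spec : exists alpha : 'I_9 -> (RR -> realization_space) -> radd,
  grpd_spec QQ alpha (fun X => X \in flats) (fun i j k => (i, j, k) \in lines).
Proof.
have /choice[alpha aP] f : exists al : (RR -> realization_space) -> radd,
    grpd_rep QQ al /\
    (forall x y z g, path QQ x y g -> (forall t, 0 <= t <= 1 -> star_nbhd z (g t)) ->
      QQ z -> al g = geo_edge (crossing f) (top_vertex x) (top_vertex y)) /\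
    (forall v w, in_Q v -> in_Q w -> qcomp v w ->
      edge al v w = geo_edge (crossing f) v w).
  by have [al alP alE] := chain_rep (geo_chain (@crossing_geo f)); exists al.
have ar f := (aP f).1; have al f := (aP f).2.1; have ae f := (aP f).2.2.
have geoE f T R : is_tope T -> is_tope R ->
    edge_geo (edge (alpha f)) T R = crossing f T R.
  move=> tT tR; rewrite -(geo_edge_geo (@crossing_geo f)) // /edge_geo.
  by rewrite !ae //; rewrite /qcomp ?(Q_leTR (@between_l T R))
    ?(Q_leRT (@between_r T R)) ?orbT.
have combW a T R L : is_tope T -> is_tope R ->
    (forall (G : groupType) (rho : (RR -> realization_space) -> G), grpd_rep QQ rho ->
    rho L = (edge_geo (edge rho) T R * edge_geo (edge rho) R T)%g) ->
    comb alpha a L = \sum_f a f * (T f != R f)%:R.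
  move=> tT tR LE; apply: eq_bigr => f _; congr (_ * _).
  by rewrite LE // !geoE // raddM crossing_pair.
exists alpha; split.
- exact: ar.
- move=> R rP; have eC := edge_cocycle rP.
  have [a [P mE]] := geodesic_span (chain_geo eC).
  exists a.
  (* On edges [R] is this combination of crossings up to a coboundary. [grpd_edges] extends the
     comparison to all paths, and on loops the coboundary drops out. *)
  pose e' v w : radd := \sum_f a f * (geo_edge (crossing f) v w : rat).
  have [||F FE] := @grpd_edges _ R (fun g => comb alpha a g : radd) e'
     (fun v => (P v.1 + (edge R (v.1, v.1) v : rat)) : radd) rP (comb_rep a ar).
  + move=> x y z g pg gz Qz; apply: eq_bigr => f _; congr (_ * _).
    exact: al pg gz Qz.
  + move=> v w Qv Qw vw; rewrite (chain_geo_edge eC) // !raddM !raddV.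
    suff -> : (geo_edge (edge_geo (edge R)) v w : rat) = e' v w + P w.1 - P v.1.
      by rewrite /=; ring.
    have [[v1 _] [w1 _]] := (Qv, Qw).
    rewrite /e' /geo_edge; case: (Q_le v w); last by rewrite mE.
    under eq_bigr => f _ do rewrite raddV mulrN.
    by rewrite raddV mE // sumrN; ring.
  move=> x L pL; rewrite (FE _ _ _ pL) !raddM raddV.
  by ring.
- move=> a a0 f; have [T tT tR] := tope_wall f.
  have [L pL LE] := tope_loop tT tR.
  have := a0 _ _ pL; rewrite (combW _ _ _ _ tT tR LE) (bigD1 f) //= big1.
    by rewrite ffunE inE eqxx addr0 => <-; case: (T f); rewrite mulr1.
  move=> g gf; rewrite ffunE inE (negbTE gf) addbF eqxx mulr0.
  by [].
- move=> i m k imk.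
  pose mh T R := heis_bits (T i) (T m) (T k) (R i) (R m) (R k).
  have mhP : geodesic mh.
    move=> T U R tT tU tR b; apply: heis_bitsM; try exact: b.
    + exact: tope_line imk tT.
    + exact: tope_line imk tU.
    + exact: tope_line imk tR.
  have [rho rP [rl re]] := chain_rep (geo_chain mhP).
  exists rho => // x L pL; rewrite !comb_delta.
  have hae (j : 'I_9) (h : heis -> radd) :
      (forall x y, h (x * y)%g = (h x * h y)%g) ->
      (forall x, h (x^-1)%g = (h x)^-1%g) ->
      (forall T R, h (mh T R) = ((crossing j T R : rat) - crossing k T R : rat)) ->
      (h (rho L) : rat) = (alpha j L : rat) - alpha k L.
    move=> hM hV hE; rewrite -comb_delta.
    have := @grpd_local _ _ QQ (fun g => h (rho g)) (fun g => comb alpha (delta j k) g : radd)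
      (fun=> 1%g) (grpd_morph hM rP) (comb_rep _ ar).
    move=> /(_ _ x x L pL); rewrite invg1 mul1g mulg1; apply.
    move=> z Qz; exists (star_nbhd z); first exact: star_nbhdP.
    move=> y y' g pg gz; rewrite ?invg1 mul1g mulg1.
    rewrite (rl _ _ _ _ pg gz Qz) comb_delta !(al _ _ _ _ _ pg gz Qz).
    rewrite /geo_edge; case: ifP => _; last exact: hE.
    by rewrite hV hE !raddV; ring.
  by split; apply: hae.
- move=> a b [R rP RE] X i XF iX.
  have [T0 [tT0 tT1 tR0 tR1]] := tope_around_flat XF iX.
  (* [Lx] is the meridian of [i], [Ly] the full turn around [X], both starting from [T0]. *)
  have [Lx pLx LxE] := tope_loop tT0 tT1.
  have [Ly pLy LyE] := tope_loop tT0 tR0.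
  have c := full_twist_commute (chain_geo (edge_cocycle rP)) iX tT0 tT1 tR0 tR1.
  rewrite -(LxE _ _ rP) -(LyE _ _ rP) in c.
  have := heis_commute c.
  have [-> ->] := RE _ _ pLx; have [-> ->] := RE _ _ pLy.
  rewrite !(combW _ _ _ _ tT0 tT1 LxE) !(combW _ _ _ _ tT0 tR0 LyE).
  have e1 (d : 'I_9 -> rat) : \sum_f d f * (T0 f != flipT T0 [set i] f)%:R = d i.
    rewrite (bigD1 i) //= big1.
      by rewrite ffunE inE eqxx addr0; case: (T0 i); rewrite mulr1.
    by move=> g gf; rewrite ffunE inE (negbTE gf) addbF eqxx mulr0.
  have e2 (d : 'I_9 -> rat) : \sum_f d f * (T0 f != flipT T0 X f)%:R = \sum_(f in X) d f.
    rewrite -sum_mem; apply: eq_bigr => f _; congr (_ * _%:R); rewrite ffunE.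
    by case: (T0 f); case: (f \in X).
  by rewrite !e1 !e2 => h; rewrite mulrC [RHS]mulrC; rewrite mulrC in h; lra.
Qed.

End QSpecProof.

(** * Winding numbers *)

Local Notation Re := (@complex.Re RR).
Local Notation Im := (@complex.Im RR).

Lemma normC_ge_Im (x : RR[i]) : `|Im x|%:C%C <= `|x|.
Proof.
rewrite normc_def lecR -sqrtr_sqr ler_sqrt ?addr_ge0 ?sqr_ge0 //.
by rewrite lerDr sqr_ge0.
Qed.

Lemma normC_le (x : RR[i]) : `|x| <= (`|Re x| + `|Im x|)%:C%C.
Proof.
rewrite normc_def lecR -[leRHS]ger0_norm ?addr_ge0 // -sqrtr_sqr.
rewrite ler_sqrt ?sqr_ge0 // sqrrD !real_normK ?num_real //.
by rewrite -addrA lerD2l lerDr mulrn_wge0 // mulr_ge0.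
Qed.

(** The norm of [RR[i]] takes values in [RR[i]]; boxes in real and imaginary parts replace its
    balls, so that real arithmetic applies. *)
Lemma CC_nbhsP (z : CC) (A : set CC) : nbhs z A <-> exists2 e : RR, 0 < e &
  forall w : CC, `|Re w - Re z| < e -> `|Im w - Im z| < e -> A w.
Proof.
split.
  move=> /nbhs_ballP[e /= e0 eA]; move: e0; rewrite ltcE /= => /andP[/eqP Ie Re0].
  exists (Re e / 2); first by rewrite divr_gt0.
  move=> w w1 w2; apply: eA; rewrite /ball /=.
  apply: (le_lt_trans (normC_le _)); rewrite ltcE /= Ie eqxx /=.
  move: w1 w2; rewrite distrC [`|Im w - _|]distrC.
  by case: w z {A Ie} => [a b] [c d] /=; lra.
move=> [e e0 eA]; apply/nbhs_ballP; exists e%:C%C => /=; first by rewrite ltcR.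
move=> w; rewrite /ball /= => zw; apply: eA; rewrite distrC.
  have := le_lt_trans (normc_ge_Re _) zw; rewrite ltcR.
  by case: w {zw} z => [a b] [c d].
have := le_lt_trans (normC_ge_Im _) zw; rewrite ltcR.
by case: w {zw} z => [a b] [c d].
Qed.

Lemma cont_Re : continuous (Re : CC -> RR).
Proof.
move=> z A /nbhs_ballP[e /= e0 eA].
apply/(CC_nbhsP z); exists e => // w w1 _; apply: eA.
by rewrite /ball /= distrC.
Qed.

Lemma cont_Im : continuous (Im : CC -> RR).
Proof.
move=> z A /nbhs_ballP[e /= e0 eA].
apply/(CC_nbhsP z); exists e => // w _ w2; apply: eA.
by rewrite /ball /= distrC.
Qed.

Section ContC.
Context {X : topologicalType}.
Implicit Types f g : X -> CC.

Lemma cont_complex (a b : X -> RR) : continuous a -> continuous b ->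
  continuous (fun x => (a x +i* b x)%C : CC).
Proof.
move=> ac bc x A /CC_nbhsP[e e0 eA].
have na : nbhs x [set y | `|a y - a x| < e].
  by apply: (ac x [set r | `|r - a x| < e]); apply/nbhs_ballP; exists e => //= r;
    rewrite /ball /= distrC.
have nb : nbhs x [set y | `|b y - b x| < e].
  by apply: (bc x [set r | `|r - b x| < e]); apply/nbhs_ballP; exists e => //= r;
    rewrite /ball /= distrC.
change (nbhs x [set y | A (a y +i* b y)%C]).
by apply: (filterS2 _ _ na nb) => y /= ? ?; apply: eA.
Qed.

Lemma cont_Ref f : continuous f -> continuous (fun x => Re (f x)).
Proof. by move=> fc; apply: cont_comp fc cont_Re. Qed.
Lemma cont_Imf f : continuous f -> continuous (fun x => Im (f x)).
Proof. by move=> fc; apply: cont_comp fc cont_Im. Qed.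

Lemma cont_addC f g : continuous f -> continuous g ->
  continuous (fun x => f x + g x : CC).
Proof.
move=> fc gc; have fr := cont_Ref fc; have gr := cont_Ref gc.
have fi := cont_Imf fc; have gi := cont_Imf gc.
suff -> : (fun x => f x + g x : CC) = fun x =>
    ((Re (f x) + Re (g x)) +i* (Im (f x) + Im (g x)))%C.
  by apply: cont_complex; cont.
by apply/funext => x; case: (f x) (g x) => [a b] [c d].
Qed.

Lemma cont_mulC f g : continuous f -> continuous g ->
  continuous (fun x => f x * g x : CC).
Proof.
move=> fc gc; have fr := cont_Ref fc; have gr := cont_Ref gc.
have fi := cont_Imf fc; have gi := cont_Imf gc.
suff -> : (fun x => f x * g x : CC) = fun x =>
    ((Re (f x) * Re (g x) - Im (f x) * Im (g x)) +i*
     (Re (f x) * Im (g x) + Im (f x) * Re (g x)))%C.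
  by apply: cont_complex; cont.
by apply/funext => x; case: (f x) (g x) => [a b] [c d].
Qed.

Lemma cont_realC (a : X -> RR) : continuous a -> continuous (fun x => (a x)%:C%C : CC).
Proof. by move=> ac; apply: cont_complex => //; exact: cont_cst. Qed.

Lemma cont_sumC (I : finType) (F : I -> X -> CC) :
  (forall i, continuous (F i)) -> continuous (fun x => \sum_i F i x : CC).
Proof.
move=> Fc.
have H (s : seq I) : continuous (fun x => \sum_(i <- s) F i x : CC).
  elim: s => [|i s IH].
    have -> : (fun x => \sum_(i <- [::]) F i x : CC) = fun=> 0.
      by apply/funext => x; rewrite big_nil.
    exact: cont_cst.
  have -> : (fun x => \sum_(j <- i :: s) F j x : CC) =
      fun x => F i x + \sum_(j <- s) F j x.
    by apply/funext => x; rewrite big_cons.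
  exact: cont_addC.
exact: H.
Qed.

Lemma cont_invC f : continuous f -> (forall x, f x != 0) ->
  continuous (fun x => (f x)^-1 : CC).
Proof.
move=> fc f0; have fr := cont_Ref fc; have fi := cont_Imf fc.
have n0 x : Re (f x) ^+ 2 + Im (f x) ^+ 2 != 0.
  rewrite paddr_eq0 ?sqr_ge0 // !sqrf_eq0; move: (f0 x).
  by rewrite eq_complex /= negb_and.
have nc : continuous (fun x => (Re (f x) ^+ 2 + Im (f x) ^+ 2)^-1 : RR).
  move=> x; apply: (@cvgV RR^o); first exact: n0.
  apply: (@cont_add _ (fun x => Re (f x) * Re (f x)) (fun x => Im (f x) * Im (f x)));
    by cont.
suff -> : (fun x => (f x)^-1 : CC) = fun x =>
    ((Re (f x) * (Re (f x) ^+ 2 + Im (f x) ^+ 2)^-1) +i*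
     (- (Im (f x) * (Re (f x) ^+ 2 + Im (f x) ^+ 2)^-1)))%C.
  by apply: cont_complex; cont.
by apply/funext => x; case: (f x) => [a b]; congr Complex; rewrite /= mulNr.
Qed.

End ContC.

(** Continuity of [phi] is only asked after composition with maps into [S]: a quotient of linear
    forms is defined everywhere but continuous only where the denominator is nonzero. *)
Lemma grpd_pullback (T T' : topologicalType) (G : groupType) (S : set T) (S' : set T')
    (phi : T -> T') (R : (RR -> T') -> G) :
  (forall (X : topologicalType) (f : X -> T), continuous f -> (forall x, S (f x)) ->
     continuous (fun x => phi (f x))) ->
  (forall x, S x -> S' (phi x)) -> grpd_rep S' R ->
  grpd_rep S (fun g => R (fun t => phi (g t))).
Proof.
move=> phic phiS [rH rM].
have pp x y g : path S x y g -> path S' (phi x) (phi y) (fun t => phi (g t)).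
  by move=> [gc <- <- gS]; split=> //; [apply: phic | move=> t; apply: phiS].
split=> [x y g h pg ph [H [Hc H01 Hx HS]]|x y z g h pg ph].
  apply: rH (pp _ _ _ pg) (pp _ _ _ ph) _.
  exists (fun p => phi (H p)); split.
  - exact: phic.
  - by move=> t t01; have [-> ->] := H01 t t01.
  - by move=> s; have [-> ->] := Hx s.
  - by move=> p; apply: phiS.
rewrite -(rM _ _ _ _ _ (pp _ _ _ pg) (pp _ _ _ ph)); congr R.
by apply/funext => t; rewrite /loop_concat; case: ifP.
Qed.

Definition Cstar : set CC := [set z | z != 0].

(* Cocycle of the argument: the plane is cut along the negative real axis. *)
Definition upper (z : CC) : rat := (0 <= Im z)%R%:R.
Definition wc (z w : CC) : radd :=
  if (Re z < 0) && (Re w < 0) then upper z - upper w else 0.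

Lemma nbhs_Re_lt (z : CC) (a : RR) : Re z < a -> nbhs z [set w | Re w < a].
Proof. by move=> za; apply: (@cont_Re z [set r | r < a]); apply: lt_nbhsl. Qed.
Lemma nbhs_Re_gt (z : CC) (a : RR) : a < Re z -> nbhs z [set w | a < Re w].
Proof. by move=> za; apply: (@cont_Re z [set r | a < r]); apply: lt_nbhsr. Qed.
Lemma nbhs_Im_lt (z : CC) (a : RR) : Im z < a -> nbhs z [set w | Im w < a].
Proof. by move=> za; apply: (@cont_Im z [set r | r < a]); apply: lt_nbhsl. Qed.
Lemma nbhs_Im_gt (z : CC) (a : RR) : a < Im z -> nbhs z [set w | a < Im w].
Proof. by move=> za; apply: (@cont_Im z [set r | a < r]); apply: lt_nbhsr. Qed.

(** Either the real part stays positive near [z], or [z] is on the imaginary axis and the imaginary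
    part keeps its sign; the cut is not met. *)
Lemma wc_off (z : CC) : z != 0 -> 0 <= Re z ->
  exists2 V, nbhs z V & forall a b, V a -> V b -> wc a b = 0.
Proof.
rewrite eq_complex /= negb_and => z0; rewrite le0r => /orP[/eqP Rz|Rz]; last first.
  exists [set w | 0 < Re w]; first exact: nbhs_Re_gt.
  by move=> a b /= a0 b0; rewrite /wc (ltNge (Re a)) (ltW a0).
move: z0; rewrite Rz eqxx /= neq_lt => /orP[Iz|Iz].
  exists [set w | Im w < 0]; first exact: nbhs_Im_lt.
  by move=> a b /= a0 b0; rewrite /wc /upper !leNgt a0 b0 subrr if_same.
exists [set w | 0 < Im w]; first exact: nbhs_Im_gt.
by move=> a b /= a0 b0; rewrite /wc /upper !ltW // subrr if_same.
Qed.

Lemma wc_on (z : CC) : Re z < 0 -> exists2 V, nbhs z V &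
  forall a b, V a -> V b -> wc a b = upper a - upper b.
Proof.
move=> Rz; exists [set w | Re w < 0]; first exact: nbhs_Re_lt.
by move=> a b /= a0 b0; rewrite /wc a0 b0.
Qed.

Lemma wc_cocycle : local_cocycle Cstar wc.
Proof.
move=> z; rewrite /Cstar /= => z0; have [Rz|Rz] := ltP (Re z) 0.
  have [V nV VE] := wc_on Rz; exists V => // a b d Va Vb Vd _ _ _.
  by rewrite !VE // raddM; ring.
have [V nV VE] := wc_off z0 Rz; exists V => // a b d Va Vb Vd _ _ _.
by rewrite !VE // raddM addr0.
Qed.

Lemma winding_ex : exists W : (RR -> CC) -> radd, grpd_rep Cstar W /\
  forall x y g V, path Cstar x y g -> cocycle_on Cstar wc V ->
      (forall t, 0 <= t <= 1 -> V (g t)) -> W g = wc x y.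
Proof. by have [W WP WE] := monodromy wc_cocycle; exists W. Qed.

Definition W : (RR -> CC) -> radd := projT1 (cid winding_ex).
Lemma W_rep : grpd_rep Cstar W. Proof. exact: (projT2 (cid winding_ex)).1. Qed.
Lemma W_local x y g V : path Cstar x y g -> cocycle_on Cstar wc V ->
  (forall t, 0 <= t <= 1 -> V (g t)) -> W g = wc x y.
Proof. exact: (projT2 (cid winding_ex)).2. Qed.

Definition cseg (x y : CC) : RR -> CC := fun t => (1 - clamp t)%:C%C * x + (clamp t)%:C%C * y.

Lemma cseg_cont x y : continuous (cseg x y).
Proof.
rewrite /cseg; apply: cont_addC; apply: cont_mulC; try exact: cont_cst.
  by apply: cont_realC; apply: cont_add; [exact: cont_cst|apply: cont_opp; exact: clamp_cont].
by apply: cont_realC; exact: clamp_cont.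
Qed.

Lemma cseg_Re x y t : Re (cseg x y t) = (1 - clamp t) * Re x + clamp t * Re y.
Proof. by case: x y => [a b] [c d]; rewrite /cseg /= !mul0r !subr0. Qed.
Lemma cseg_Im x y t : Im (cseg x y t) = (1 - clamp t) * Im x + clamp t * Im y.
Proof. by case: x y => [a b] [c d]; rewrite /cseg /= !mul0r !addr0. Qed.

Lemma cseg0 x y : cseg x y 0 = x.
Proof. by rewrite /cseg clamp0 subr0 mul1r mul0r addr0. Qed.
Lemma cseg1 x y : cseg x y 1 = y.
Proof. by rewrite /cseg clamp1 subrr mul1r mul0r add0r. Qed.

Lemma path_cseg (S : set CC) x y : (forall t, S (cseg x y t)) -> path S x y (cseg x y).
Proof. by split; rewrite ?cseg0 ?cseg1 //; exact: cseg_cont. Qed.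

Definition corner (k : nat) : CC :=
  match k with 0 => (1 +i* 1)%C | 1 => (-1 +i* 1)%C | 2 => (-1 -i* 1)%C
  | _ => (1 -i* 1)%C end.
(** A polygonal unit circle, run counterclockwise. Each side stays in a half plane on which [wc] is
    a cocycle, so its winding number is a finite computation. *)
Definition square : RR -> CC :=
  loop_concat (loop_concat (cseg (corner 0) (corner 1)) (cseg (corner 1) (corner 2)))
              (loop_concat (cseg (corner 2) (corner 3)) (cseg (corner 3) (corner 0))).

Lemma Cstar_Re (z : CC) : Re z != 0 -> z != 0.
Proof. by rewrite [z == 0]eq_complex negb_and => ->. Qed.
Lemma Cstar_Im (z : CC) : Im z != 0 -> z != 0.
Proof. by rewrite [z == 0]eq_complex negb_and => ->; rewrite orbT. Qed.

Lemma path_corner k : (k < 4)%N ->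
  path Cstar (corner k) (corner (k.+1 %% 4)) (cseg (corner k) (corner (k.+1 %% 4))).
Proof.
have c01 := clamp_itv; have one : (1 : RR) != 0 by rewrite oner_eq0.
case: k => [|[|[|[|//]]]] _; apply: path_cseg => t; move: (c01 t) => /andP[t0 t1];
  rewrite /Cstar /=.
- by apply: Cstar_Im; rewrite cseg_Im /= !mulr1 subrK.
- by apply: Cstar_Re; rewrite cseg_Re /= !mulrN1 -opprD subrK oppr_eq0.
- by apply: Cstar_Im; rewrite cseg_Im /= !mulrN1 -opprD subrK oppr_eq0.
- by apply: Cstar_Re; rewrite cseg_Re /= !mulr1 subrK.
Qed.

Lemma path_square : path Cstar (corner 0) (corner 0) square.
Proof.
apply: path_cat (path_cat (@path_corner 0 isT) (@path_corner 1 isT)) _.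
exact: path_cat (@path_corner 2 isT) (@path_corner 3 isT).
Qed.

Lemma square_neq0 t : square t != 0.
Proof. by have [_ _ _] := path_square; apply. Qed.

Lemma square_cont : continuous square.
Proof. by have [] := path_square. Qed.

Lemma square01 : square 0 = corner 0 /\ square 1 = corner 0.
Proof. by have [_ -> -> _] := path_square. Qed.

Lemma W_square : W square = (1 : rat).
Proof.
have [_ WM] := W_rep.
have p0 := @path_corner 0 isT; have p1 := @path_corner 1 isT.
have p2 := @path_corner 2 isT; have p3 := @path_corner 3 isT.
rewrite /square (WM _ _ _ _ _ (path_cat p0 p1) (path_cat p2 p3)).
rewrite (WM _ _ _ _ _ p0 p1) (WM _ _ _ _ _ p2 p3) !raddM.
have one : (0 : RR) <= 1 by rewrite ler01.
rewrite (W_local (V := [set z | 0 <= Im z]) p0); first last.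
- by move=> t _; rewrite /mkset cseg_Im /= !mulr1 subrK.
- by move=> a b d /= a0 b0 d0 _ _ _; rewrite /wc /upper a0 b0 d0 !subrr !if_same raddM addr0.
rewrite (W_local (V := [set z | Re z < 0]) p1); first last.
- by move=> t _; rewrite /mkset cseg_Re /= !mulrN1 -opprD subrK oppr_lt0 ltr01.
- by move=> a b d /= a0 b0 d0 _ _ _; rewrite /wc a0 b0 d0 /= raddM; ring.
rewrite (W_local (V := [set z | Im z < 0]) p2); first last.
- by move=> t _; rewrite /mkset cseg_Im /= !mulrN1 -opprD subrK oppr_lt0 ltr01.
- move=> a b d /= a0 b0 d0 _ _ _.
  by rewrite /wc /upper !leNgt a0 b0 d0 !subrr !if_same raddM addr0.
rewrite (W_local (V := [set z | 0 < Re z]) p3); first last.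
- by move=> t _; rewrite /mkset cseg_Re /= !mulr1 subrK.
- move=> a b d /= a0 b0 d0 _ _ _.
  by rewrite /wc !(ltNge (Re a)) !(ltNge (Re b)) !ltW //= raddM addr0.
by rewrite /wc /upper /= !oppr_lt0 !ltr01 !(ltNge 1) !ler01 /= !oppr_ge0 !ler10 /=; lra.
Qed.

Lemma free_htpy (T : topologicalType) (S : set T) (R : (RR -> T) -> radd)
    (F : RR * RR -> T) : grpd_rep S R -> continuous F -> (forall p, S (F p)) ->
  (forall s, F (s, 0) = F (s, 1)) ->
  R (fun t => F (0, t)) = R (fun t => F (1, t)).
Proof.
move=> rP Fc FS F01; have := grpd_square rP Fc FS.
have -> : (fun s => F (s, 1)) = fun s => F (s, 0) by apply/funext => s; rewrite F01.
by rewrite !raddM addrC => /addrI.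
Qed.

(** The segment from 1 to [k] can meet 0 only for real [k]; then a detour through the imaginary unit
    avoids it. *)
Lemma Cstar_path (k : CC) : k != 0 -> exists g, path Cstar 1 k g.
Proof.
move=> k0; have [Ik|Ik] := eqVneq (Im k) 0; last first.
  exists (cseg 1 k); apply: path_cseg => t; rewrite /Cstar /=.
  have [c0|c0] := eqVneq (clamp t) 0.
    by apply: Cstar_Re; rewrite cseg_Re c0 subr0 /= mul1r mul0r addr0 oner_eq0.
  by apply: Cstar_Im; rewrite cseg_Im /= mulr0 add0r mulf_neq0.
have Rk : Re k != 0 by move: k0; rewrite [k == 0]eq_complex Ik eqxx andbT.
exists (loop_concat (cseg 1 'i%C) (cseg 'i%C k)).
apply: (@path_cat _ Cstar (1 : CC) ('i%C : CC) k); apply: path_cseg => t; rewrite /Cstar /=.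
  have [c0|c0] := eqVneq (clamp t) 0.
    by apply: Cstar_Re; rewrite cseg_Re c0 subr0 /= mul1r mul0r addr0 oner_eq0.
  by apply: Cstar_Im; rewrite cseg_Im /= mulr0 add0r mulr1.
have [c0|c0] := eqVneq (clamp t) 0.
  by apply: Cstar_Im; rewrite cseg_Im c0 subr0 /= mul1r mul0r addr0 oner_eq0.
by apply: Cstar_Re; rewrite cseg_Re /= mulr0 add0r mulf_neq0.
Qed.

Lemma W_scale x g (k : CC) : path Cstar x x g -> k != 0 -> W (fun t => k * g t) = W g.
Proof.
move=> [gc g0 g1 gS] k0; have [h [hc h0 h1 hS]] := Cstar_path k0.
have := @free_htpy _ Cstar W (fun p => h p.1 * g p.2) W_rep.
rewrite /= h0 h1 => H; rewrite -H //.
- by congr W; apply/funext => t; rewrite mul1r.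
- apply: cont_mulC; [apply: cont_comp hc|apply: cont_comp gc]; cont.
- by move=> p; apply: mulf_neq0; [exact: hS|exact: gS].
- by move=> s; rewrite g0 g1.
Qed.

(** Under the map [(s, t) |-> f s * g t] the diagonal is homotopic to two consecutive sides of the
    square, which carry constant multiples of [f] and of [g]. *)
Lemma W_mul x y f g : path Cstar x x f -> path Cstar y y g ->
  W (fun t => f t * g t) = (W f + W g : rat).
Proof.
move=> pf pg; have [fc f0 f1 fS] := pf; have [gc g0 g1 gS] := pg.
pose F (p : RR * RR) : CC := f p.1 * g p.2.
have Fc : continuous F.
  by apply: cont_mulC; [apply: cont_comp fc|apply: cont_comp gc]; cont.
have FS p : Cstar (F p) by apply: mulf_neq0; [exact: fS|exact: gS].
pose v (t : RR) : RR * RR := (Num.min (2 * t) 1, Num.max 0 (2 * t - 1)).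
have vc : continuous v by rewrite /v; cont.
have v0 : v 0 = (0, 0) by rewrite /v; congr (_, _); case: lerP => ?; lra.
have v1 : v 1 = (1, 1) by rewrite /v; congr (_, _); case: lerP => ?; lra.
have dc : continuous (fun t : RR => (t, t)) by cont.
have H := htpy_map2 Fc FS dc vc (esym v0) (esym v1).
have [WH WM] := W_rep.
have pp (u : RR -> RR * RR) : continuous u ->
    path Cstar (F (u 0)) (F (u 1)) (fun t => F (u t)).
  by move=> uc; split; [exact: cont_comp uc Fc|by []|by []|move=> t; exact: FS].
have px : x != 0 := (path_in pf).1; have py : y != 0 := (path_in pg).1.
have := WH _ _ _ _ (pp _ dc) _ H; rewrite {1}/F /= => ->; last first.
  by have := pp _ vc; rewrite v0 v1.
have -> : (fun t => F (v t)) = loop_concat (fun t => y * f t : CC) (fun t => x * g t : CC).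
  apply/funext => t; rewrite /loop_concat /F /v /=; case: (lerP 0) => ?;
    case: (lerP (2 * t)) => ?; case: ifP => ? //=; try (by exfalso; clear v0 v1; clear_eq; lra).
  - have -> : 2 * t = 1 by clear v0 v1; clear_eq; lra.
    by rewrite subrr g0 f1 mulrC.
  - by rewrite f1.
  - by rewrite g0 mulrC.
have sc z h (k : CC) : k != 0 -> path Cstar z z h ->
    path Cstar (k * z) (k * z) (fun t => k * h t).
  move=> k0 [hc h0 h1 hS]; split; [|by rewrite h0|by rewrite h1|].
    by apply: cont_mulC; [exact: cont_cst|exact: hc].
  by move=> t; apply: mulf_neq0 => //; exact: hS.
have pf' := sc _ _ _ py pf; have pg' := sc _ _ _ px pg.
rewrite mulrC in pf'.
by rewrite (WM _ _ _ _ _ pf' pg') (W_scale pf) // (W_scale pg).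
Qed.

Lemma W_cst (k : CC) : k != 0 -> W (cst k) = (0 : rat).
Proof. by move=> k0; rewrite (grpd_cst W_rep). Qed.

Definition C01 : set CC := [set z | z != 0 /\ 1 - z != 0].

Lemma cont_sub1 : continuous (fun z : CC => 1 - z : CC).
Proof.
have -> : (fun z : CC => 1 - z : CC) = fun z => 1 + (-1) * z.
  by apply/funext => z; rewrite mulN1r.
by apply: cont_addC; [exact: cont_cst|apply: cont_mulC; [exact: cont_cst|exact: cont_id]].
Qed.

(* The two cuts z < 0 and z > 1 are disjoint, so that the cocycles of z and
   1 - z assemble into a cocycle with values in the Heisenberg group. *)
Lemma heis_winding : exists2 H : (RR -> CC) -> heis, grpd_rep C01 H &
  forall x y g, path C01 x y g -> ha (H g) = W g /\ hb (H g) = W (fun t => 1 - g t).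
Proof.
pose c (z w : CC) : heis := (wc z w : rat, wc (1 - z) (1 - w) : rat, 0).
have nb1 (z : CC) V : nbhs (1 - z : CC) V -> nbhs z [set w : CC | V (1 - w)].
  by move=> nV; apply: cont_sub1.
have loc z : C01 z -> exists2 V, nbhs z V & cocycle_on C01 c V /\
    cocycle_on Cstar wc V /\ cocycle_on Cstar wc [set 1 - w | w in V].
  move=> [z0 z1]; have [V1 nV1 cV1] := wc_cocycle z0.
  have [V2 nV2 cV2] := wc_cocycle z1.
  (* Near every point one of the two cocycles vanishes, so the product term in the Heisenberg law
     disappears and a zero corner entry works. *)
  have [V3 nV3 cV3] : exists2 V, nbhs z V & forall a b d e, V a -> V b -> V d -> V e ->
      wc a b * wc (1 - d) (1 - e) = 0 :> rat.
    have [Rz|Rz] := ltP (Re z) 0; last first.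
      have [V nV VE] := wc_off z0 Rz; exists V => // a b d e Va Vb _ _.
      by rewrite VE // mul0r.
    have [|V nV VE] := wc_off z1.
      by move: Rz; case: (z) => [x y] /=; lra.
    exists [set w : CC | V (1 - w)]; first exact: nb1.
    by move=> a b d e _ _ Vd Ve; rewrite (VE (1 - d)) // mulr0.
  exists (V1 `&` [set w : CC | V2 (1 - w)] `&` V3).
    by apply: filterI => //; apply: filterI => //; exact: nb1.
  split; last split.
  - move=> a b d [[a1 a2] a3] [[b1 b2] b3] [[d1 d2] d3] [Sa Sa'] [Sb Sb'] [Sd Sd'].
    congr (_, _, _); rewrite /= ?addr0 ?add0r.
    + exact: cV1.
    + exact: cV2.
    + exact: cV3.
  - by move=> a b d [[a1 a2] a3] [[b1 b2] b3] [[d1 d2] d3]; apply: cV1.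
  - by move=> _ _ _ [a [[a1 a2] a3] <-] [b [[b1 b2] b3] <-] [d [[d1 d2] d3] <-]; apply: cV2.
have [|H HP HE] := @monodromy _ _ C01 c.
  by move=> z /loc[V nV [cV _]]; exists V.
exists H => //.
have W1 : grpd_rep C01 W.
  apply: (@grpd_pullback _ _ _ C01 Cstar id W) W_rep => // z [z0 _] //.
have W2 : grpd_rep C01 (fun g => W (fun t => 1 - g t)).
  apply: (@grpd_pullback _ _ _ C01 Cstar (fun z => 1 - z) W) W_rep => // [X f fc fS|z [_ z1] //].
  exact: cont_comp fc cont_sub1.
have loc2 (h : heis -> radd) (R : (RR -> CC) -> radd) :
    (forall x y, h (x * y)%g = (h x * h y)%g) -> grpd_rep C01 R ->
    (forall z, C01 z -> exists2 V, nbhs z V & cocycle_on C01 c V /\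
      forall x y g, path C01 x y g -> (forall t, 0 <= t <= 1 -> V (g t)) ->
      R g = h (c x y)) ->
    forall x y g, path C01 x y g -> h (H g) = R g.
  move=> hM rP rE x y g pg.
  have := @grpd_local _ _ C01 (fun g => h (H g)) R (fun=> 1%g) (grpd_morph hM HP) rP.
  move=> /(_ _ x y g pg); rewrite ?invg1 mul1g mulg1; apply.
  move=> z Sz; have [V nV [cV VE]] := rE z Sz; exists V => // a b k pk kV.
  by rewrite ?invg1 mul1g mulg1 (HE _ _ _ _ pk cV kV) (VE _ _ _ pk kV).
move=> x y g pg; split.
- apply: (loc2 ha W) pg => // z /loc[V nV [cV [c1 c2]]]; exists V => //; split=> //.
  move=> a b k [kc k0 k1 kS] kV; apply: (W_local (V := V)) => //.
  by split=> // t; have [] := kS t.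
- apply: (loc2 hb (fun g => W (fun t => 1 - g t))) pg => // z /loc[V nV [cV [c1 c2]]].
  exists V => //; split=> //.
  move=> a b k [kc k0 k1 kS] kV; apply: (W_local _ c2).
    split; rewrite ?k0 ?k1 //; last by move=> t; have [] := kS t.
    exact: cont_comp kc cont_sub1.
  by move=> t t01; exists (k t) => //; apply: kV.
Qed.

(** * Hyperplane arrangements *)

Lemma avoid_values (s : seq RR) (u v : RR) : u < v -> exists t, u < t < v /\ t \notin s.
Proof.
elim: s u v => [|x s IH] u v uv.
  by exists ((u + v) / 2); split=> //; apply/andP; split; lra.
have [ux|xu] := ltP u x; last first.
  have [t [ut ts]] := IH u v uv; exists t; split=> //.
  rewrite inE negb_or ts andbT; move/andP: ut => [ut _].
  by rewrite gt_eqF // (le_lt_trans xu).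
have [|t [/andP[ut tm] ts]] := IH u (Num.min x v); first by rewrite lt_min ux uv.
move: tm; rewrite lt_min => /andP[tx tv]; exists t; split; first by rewrite ut tv.
by rewrite inE negb_or ts andbT lt_eqF.
Qed.

Lemma avoid_preds (J : finType) (P : J -> RR -> Prop) (u v : RR) : u < v ->
  (forall j x y, P j x -> P j y -> x = y) ->
  exists t, u < t < v /\ forall j, ~ P j t.
Proof.
move=> uv Pu.
have /choice[b bP] j : exists b, forall x, P j x -> x = b.
  have [[b Pb]|nb] := pselect (exists b, P j b); last by exists 0 => x Px; case: nb; exists x.
  by exists b => x Px; apply: Pu Px Pb.
have [t [tuv ts]] := avoid_values [seq b j | j : J] uv.
exists t; split=> // j /bP e; move: ts; rewrite e => /negP; apply.
by apply/mapP; exists j => //; rewrite mem_enum.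
Qed.

(** A positive lower bound of finitely many thresholds is the inverse of one plus the sum of their
    inverses; this also covers an empty family. *)
Lemma common_scale (J : finType) (P : J -> RR -> Prop) :
  (forall j, exists2 e, 0 < e & forall e', 0 < e' -> e' <= e -> P j e') ->
  exists2 e, 0 < e & forall j e', 0 < e' -> e' <= e -> P j e'.
Proof.
move=> h; have /choice[e eP] j : exists e, 0 < e /\ forall e', 0 < e' -> e' <= e -> P j e'.
  by have [e e0 eP] := h j; exists e.
have s0 : 0 < 1 + \sum_j (e j)^-1.
  apply: ltr_pwDl => //; apply: sumr_ge0 => j _.
  by rewrite invr_ge0 ltW // (eP j).1.
exists (1 + \sum_j (e j)^-1)^-1; first by rewrite invr_gt0.
move=> j e' e'0 le; apply: (eP j).2 => //; apply: le_trans le _.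
have ej := (eP j).1.
rewrite -[leRHS]invrK lef_pV2 ?posrE ?invr_gt0 //.
rewrite (bigD1 j) //= addrCA lerDl addr_ge0 //; apply: sumr_ge0 => k _.
by rewrite invr_ge0 ltW // (eP k).1.
Qed.

Definition nrm (z : RR[i]) : RR := `|Re z| + `|Im z|.

Lemma nrm_ge0 z : 0 <= nrm z. Proof. by rewrite addr_ge0. Qed.
Lemma nrm0 : nrm 0 = 0.
Proof. by rewrite /nrm /= normr0 addr0. Qed.
Lemma nrm_gt0 z : z != 0 -> 0 < nrm z.
Proof.
move=> z0; rewrite lt0r nrm_ge0 andbT /nrm paddr_eq0 // !normr_eq0.
by move: z0; rewrite eq_complex /=.
Qed.
Lemma nrmN z : nrm (- z) = nrm z.
Proof. by case: z => [a b]; rewrite /nrm /= !normrN. Qed.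
Lemma nrmD x y : nrm (x + y) <= nrm x + nrm y.
Proof.
case: x y => [a b] [c d]; rewrite /nrm /=.
have := ler_normD a c; have := ler_normD b d; lra.
Qed.
Lemma nrmM x y : nrm (x * y) <= nrm x * nrm y.
Proof.
case: x y => [a b] [c d]; rewrite /nrm /=.
apply: le_trans (lerD (ler_normB _ _) (ler_normD _ _)) _.
by rewrite !normrM mulrDl !mulrDr; lra.
Qed.
Lemma nrm_real (e : RR) z : nrm (e%:C%C * z) = `|e| * nrm z.
Proof.
by case: z => [a b]; rewrite /nrm /= !mul0r subr0 addr0 !normrM mulrDr.
Qed.

Lemma cont_nrm (X : topologicalType) (f : X -> CC) : continuous f ->
  continuous (fun x => nrm (f x)).
Proof.
move=> fc.
have -> : (fun x => nrm (f x)) = fun x =>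
    Num.max (Re (f x)) (- Re (f x)) + Num.max (Im (f x)) (- Im (f x)).
  by apply/funext => x; rewrite /nrm -!real_maxrN ?num_real.
have fR := cont_Ref fc; have fI := cont_Imf fc.
by apply: cont_add; apply: cont_max => //; apply: cont_opp.
Qed.

(** The bound is uniform in [k] and [w], so that one radius can serve all points of a compact
    path. *)
Lemma small_perturbation (m : RR[i]) (k0 B : RR) : 0 < k0 ->
  exists2 e, 0 < e & forall e', 0 < e' -> e' <= e ->
    forall k w, k0 <= nrm k -> nrm w <= B -> k + e'%:C%C * w * m != 0.
Proof.
move=> k00; pose D := `|B| * nrm m + 1.
have D0 : 0 < D by rewrite ltr_wpDl // mulr_ge0 // nrm_ge0.
exists (k0 / D / 2); first by rewrite !divr_gt0.
move=> e' e'0 e'e k w kk wB; apply/eqP => /eqP; rewrite addr_eq0 => /eqP ke.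
have : k0 <= e' * (D - 1).
  apply: le_trans kk _.
  rewrite ke nrmN -mulrA nrm_real gtr0_norm // ler_pM2l // /D addrK.
  apply: le_trans (nrmM _ _) _; apply: (ler_wpM2r (nrm_ge0 m)).
  exact: le_trans wB (ler_norm _).
have : e' * D <= k0 / 2 by rewrite -ler_pdivlMr // mulrAC.
by nra.
Qed.

Lemma cseg_bound k j t : nrm (cseg (corner k) (corner j) t) <= 2.
Proof.
have c m : `|Re (corner m)| = 1 /\ `|Im (corner m)| = 1.
  by case: m => [|[|[|m]]] /=; rewrite ?normrN normr1.
have [x1 x2] := c k; have [y1 y2] := c j.
rewrite /nrm cseg_Re cseg_Im; have /andP[c0 c1] := clamp_itv t.
have aux a d : `|a| = 1 -> `|d| = 1 -> `|(1 - clamp t) * a + clamp t * d| <= 1 :> RR.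
  move=> a1 b1; apply: le_trans (ler_normD _ _) _.
  by rewrite !normrM a1 b1 !ger0_norm ?subr_ge0 //; lra.
have := aux _ _ x1 y1; have := aux _ _ x2 y2; lra.
Qed.

Lemma square_bound t : nrm (square t) <= 2.
Proof.
by rewrite /square /loop_concat; case: ifP => _; case: ifP => _; apply: cseg_bound.
Qed.

Lemma half_inj (u v : RR) : u / 2 = v / 2 -> u = v.
Proof. lra. Qed.
Lemma half_inj1 (u v : RR) : u * (1 - 2^-1) = v * (1 - 2^-1) -> u = v.
Proof. lra. Qed.

Section Arrangement.
Context {r n : nat}.
Variable l : 'I_n -> 'I_r -> CC.
Implicit Types (x y z p q : Cspace r) (c d : RR[i]).

Definition ev (a : 'I_r -> CC) z : RR[i] := \sum_(m < r) a m * z m.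
Definition lin c d x y : Cspace r := fun m => c * x m + d * y m.

Lemma ev_lin a c d x y : ev a (lin c d x y) = c * ev a x + d * ev a y.
Proof.
rewrite /ev !mulr_sumr -big_split; apply: eq_bigr => i _ /=.
by rewrite /lin; ring.
Qed.

Lemma cont_lin (X : topologicalType) (c d : X -> CC) (f g : X -> Cspace r) :
  continuous c -> continuous d -> continuous f -> continuous g ->
  continuous (fun s => lin (c s) (d s) (f s) (g s)).
Proof.
move=> cc dc fc gc; apply: cont_ptws => i; apply: cont_addC; apply: cont_mulC.
- exact: cc.
- exact: cont_comp fc (@cont_eval _ _ i).
- exact: dc.
- exact: cont_comp gc (@cont_eval _ _ i).
Qed.

Lemma cont_ev (X : topologicalType) a (f : X -> Cspace r) : continuous f ->
  continuous (fun s => ev a (f s) : CC).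
Proof.
move=> fc; apply: cont_sumC => i; apply: cont_mulC; first exact: cont_cst.
exact: cont_comp fc (@cont_eval _ _ i).
Qed.

Definition linear_form (phi : Cspace r -> RR[i]) : Prop :=
  forall c d x y, phi (lin c d x y) = c * phi x + d * phi y.

(** Induction over the forms: a point good for the previous ones is moved by a real multiple of a
    point good for the next. Forms vanishing on the direction keep their values, each other form
    excludes one multiple. *)
Lemma generic_point (J : finType) (phi : J -> Cspace r -> RR[i]) (V : set (Cspace r)) :
  (forall j, linear_form (phi j)) -> (exists z, V z) ->
  (forall c d x y, V x -> V y -> V (lin c d x y)) ->
  (forall j, exists2 z, V z & phi j z != 0) ->
  exists2 z, V z & forall j, phi j z != 0.
Proof.
move=> phiL [z0 Vz0] Vl ex.
suff [z Vz zP] : exists2 z, V z & forall j, j \in enum J -> phi j z != 0.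
  by exists z => // j; apply: zP; rewrite mem_enum.
elim: (enum J) => [|j s [z Vz zP]]; first by exists z0.
have [y Vy yj] := ex j.
have [|t [_ tP]] := @avoid_preds J (fun k t => (phi k y != 0) /\
  phi k (lin t%:C%C 1 y z) = 0) 0 1 ltr01.
  move=> k t t' [y0]; rewrite !phiL !mul1r => e [_ e'].
  have : (t%:C%C - t'%:C%C) * phi k y = 0.
    by rewrite mulrBl -(addrK (phi k z) (_ * _)) e -(addrK (phi k z) (t'%:C%C * _)) e' subrr.
  by move/eqP; rewrite mulf_eq0 (negbTE y0) orbF subr_eq0 => /eqP[].
have [t0|t0] := eqVneq (phi j z) 0; last first.
  by exists z => // k; rewrite inE => /orP[/eqP ->|/zP].
exists (lin t%:C%C 1 y z); first exact: Vl.
move=> k; rewrite inE => ks; have [yk|yk] := eqVneq (phi k y) 0; last first.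
  by apply/eqP => e; apply: (tP k).
case/orP: ks => [/eqP kj|/zP]; first by rewrite kj in yk; rewrite yk eqxx in yj.
by rewrite phiL yk mulr0 add0r mul1r.
Qed.

Definition Mset : set (Cspace r) := [set z | forall j, ev (l j) z != 0].

Hypothesis l_indep : forall i j, i != j -> exists2 z, ev (l i) z = 0 & ev (l j) z != 0.
Hypothesis l_neq0 : forall i, exists z, ev (l i) z != 0.

Lemma ev_linear a : linear_form (ev a). Proof. exact: ev_lin. Qed.

Lemma generic_on i : exists2 q, ev (l i) q = 0 & forall j, j != i -> ev (l j) q != 0.
Proof.
have [||||q qi qP] := @generic_point {j | j != i} (fun j => ev (l (sval j)))
    [set z | ev (l i) z = 0].
- by move=> j; apply: ev_linear.
- by exists (fun=> 0); rewrite /= /ev big1 // => k _; rewrite mulr0.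
- by move=> c d x y /= ex ey; rewrite ev_lin ex ey !mulr0 addr0.
- move=> [j ji] /=; have [|z z0 zj] := @l_indep i j; first by rewrite eq_sym.
  by exists z.
by exists q => // j ji; exact: (qP (exist _ j ji)).
Qed.

Lemma unit_normal i : exists v, ev (l i) v = 1.
Proof.
have [z z0] := l_neq0 i; exists (lin (ev (l i) z)^-1 0 z z).
by rewrite ev_lin mul0r addr0 mulVf.
Qed.

(** A real segment may hit a hyperplane, but on the complex line through [x] and [y] a form nonzero
    at both ends has at most one zero. Bending the path at the parameter [1/2 + i t] therefore fails
    for finitely many [t] only. Forms vanishing at both ends vanish along the path, which lets a
    point move inside a hyperplane. *)
Lemma bent_path x y : exists g, path [set z | forall j,
    (ev (l j) x != 0 -> ev (l j) y != 0 -> ev (l j) z != 0) /\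
    (ev (l j) x = 0 -> ev (l j) y = 0 -> ev (l j) z = 0)] x y g.
Proof.
pose la (t : RR) : RR[i] := (2^-1 +i* t)%C.
(* The boolean tells whether the half of the path starting at [x] or the one starting at [y] is
   hit. *)
pose P (jb : 'I_n * bool) (t : RR) :=
  [/\ ev (l jb.1) x != 0, ev (l jb.1) y != 0 & exists u : RR,
  let X := ev (l jb.1) (if jb.2 then x else y) in
  let Y := ev (l jb.1) (if jb.2 then y else x) in
  let m := if jb.2 then la t else 1 - la t in
  (1 - u%:C%C * m) * X + u%:C%C * m * Y = 0].
have [|t [_ tP]] := @avoid_preds _ P 0 1 ltr01.
  move=> [j b] t t' [/= x0 y0 [u /= e]] [_ _ [u' /= e']].
  set X := ev (l j) (if b then x else y) in e e'.
  set Y := ev (l j) (if b then y else x) in e e'.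
  have X0 : X != 0 by rewrite /X; case: (b).
  set m := if b then la t else _ in e; set m' := if b then la t' else _ in e'.
  have e2 : u%:C%C * m * (X - Y) = X.
    by rewrite -[RHS]subr0 -e; ring.
  have e2' : u'%:C%C * m' * (X - Y) = X.
    by rewrite -[RHS]subr0 -e'; ring.
  have XY : X - Y != 0.
    by apply: contraNneq X0 => XY; rewrite -e2 XY mulr0.
  have um : u%:C%C * m = u'%:C%C * m' by apply: (mulIf XY); rewrite e2 e2'.
  have u0 : u != 0.
    by apply: contraNneq X0 => u0; rewrite -e2 u0 !mul0r.
  move: um; rewrite /m /m' /la; case: (b) => -[].
    rewrite !mul0r !subr0 !addr0 => h1 h2; apply: (mulfI u0).
    have uu : u = u' := half_inj h1.
    by rewrite h2 -uu.
  rewrite !mul0r !subr0 !addr0 !sub0r => h1 h2; apply: (mulfI u0).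
  have uu : u = u' := half_inj1 h1.
  by move: h2; rewrite -uu !mulrN => /oppr_inj.
pose m : Cspace r := lin (1 - la t) (la t) x y.
have seg_c (a b : Cspace r) : continuous (fun s : RR =>
    lin (1 - clamp s)%:C%C (clamp s)%:C%C a b).
  apply: cont_lin; [| |exact: cont_cst|exact: cont_cst].
    by apply: cont_realC; apply: cont_add; [exact: cont_cst|apply: cont_opp; exact: clamp_cont].
  by apply: cont_realC; exact: clamp_cont.
have lin0 (a b : Cspace r) : lin (1 - clamp 0)%:C%C (clamp 0)%:C%C a b = a.
  by apply/funext => k; rewrite /lin clamp0 subr0 mul1r mul0r addr0.
have lin1 (a b : Cspace r) : lin (1 - clamp 1)%:C%C (clamp 1)%:C%C a b = b.
  by apply/funext => k; rewrite /lin clamp1 subrr mul0r mul1r add0r.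
set S := [set z | _].
have p1 : path S x m (fun s => lin (1 - clamp s)%:C%C (clamp s)%:C%C x m).
  split; rewrite ?lin0 ?lin1 // => s j; split=> [x0 y0|x0 y0]; last first.
    by rewrite !ev_lin x0 y0; ring.
  apply/eqP => e; apply: (tP (j, true)); split=> //.
  exists (clamp s) => /=; rewrite -[RHS]e !ev_lin rmorphB rmorph1; ring.
have p2 : path S y m (fun s => lin (1 - clamp s)%:C%C (clamp s)%:C%C y m).
  split; rewrite ?lin0 ?lin1 // => s j; split=> [x0 y0|x0 y0]; last first.
    by rewrite !ev_lin x0 y0; ring.
  apply/eqP => e; apply: (tP (j, false)); split=> //.
  exists (clamp s) => /=; rewrite -[RHS]e !ev_lin rmorphB rmorph1; ring.
by eexists; apply: path_cat p1 (path_rev p2).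
Qed.

Lemma Mset_connected : path_connected Mset.
Proof.
move=> x y Mx My; have [g [gc g0 g1 gS]] := bent_path x y.
by exists g; split=> // t j; have [+ _] := gS t j; apply.
Qed.

Definition alphaA i (g : RR -> Cspace r) : radd := W (fun t => ev (l i) (g t)).

Lemma alphaA_rep_on (S : set (Cspace r)) i : (forall z, S z -> ev (l i) z != 0) ->
  grpd_rep S (alphaA i).
Proof.
move=> Si; apply: (@grpd_pullback _ _ _ S Cstar (fun z => ev (l i) z : CC) W) W_rep => //.
by move=> X f fc _; apply: cont_ev.
Qed.

Lemma alphaA_rep i : grpd_rep Mset (alphaA i).
Proof. by apply: alphaA_rep_on => z; apply. Qed.

Lemma W_near_const (k m : RR[i]) (f : RR -> CC) : continuous f -> f 0 = f 1 ->
  (forall s t : RR, k + (clamp s)%:C%C * (f t * m) != 0) ->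
  W (fun t => k + f t * m) = (0 : rat).
Proof.
move=> fc f01 nz.
have := @free_htpy _ Cstar W (fun p : RR * RR => k + (clamp p.1)%:C%C * (f p.2 * m)) W_rep.
rewrite /= clamp0 clamp1.
have -> : (fun t : RR => k + 0%:C%C * (f t * m) : CC) = cst (k : CC).
  by apply/funext => t; rewrite mul0r addr0.
have -> : (fun t : RR => k + 1%:C%C * (f t * m) : CC) = fun t => k + f t * m.
  by apply/funext => t; rewrite mul1r.
move=> <-.
- by rewrite W_cst //; have := nz 0 0; rewrite clamp0 mul0r addr0.
- apply: cont_addC; first exact: cont_cst.
  apply: cont_mulC; first by apply: cont_realC; apply: cont_comp clamp_cont; cont.
  apply: cont_mulC; last exact: cont_cst.
  by apply: cont_comp fc; cont.
- by move=> p; apply: nz.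
- by move=> s; rewrite f01.
Qed.

Lemma W_square_scale (c : RR[i]) : c != 0 -> W (fun t => c * square t) = (1 : rat).
Proof. by move=> c0; rewrite (W_scale path_square) // W_square. Qed.

Definition meridian q v (e : RR) : RR -> Cspace r :=
  fun t => lin 1 (e%:C%C * square t) q v.

Definition safe i q v (e : RR) : Prop := forall j (w : RR[i]), j != i -> nrm w <= 2 ->
  forall e', 0 <= e' -> e' <= e -> ev (l j) q + e'%:C%C * w * ev (l j) v != 0.

Lemma safe_ex i q v : (forall j, j != i -> ev (l j) q != 0) ->
  exists2 e, 0 < e & safe i q v e.
Proof.
move=> qi.
have [j|e e0 eP] := @common_scale 'I_n (fun j e => j != i ->
    forall w, nrm w <= 2 -> ev (l j) q + e%:C%C * w * ev (l j) v != 0).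
  have [->|ji] := eqVneq j i; first by exists 1 => //; rewrite eqxx.
  have [e e0 eP] := small_perturbation (ev (l j) v) 2 (nrm_gt0 (qi j ji)).
  by exists e => // e' h1 h2 _ w; apply: eP.
exists e => // j w ji w2 e'; rewrite le0r => /orP[/eqP -> _|e'0 e'e].
  by rewrite !mul0r addr0 qi.
exact: eP.
Qed.

Lemma meridian_path i q v e : ev (l i) q = 0 -> ev (l i) v = 1 -> 0 < e ->
  safe i q v e -> path Mset (meridian q v e 0) (meridian q v e 0) (meridian q v e).
Proof.
move=> qi vi e0 sf; have [s0 s1] := square01.
split; [|by []|by rewrite /meridian s0 s1|].
  apply: cont_lin; [exact: cont_cst| |exact: cont_cst|exact: cont_cst].
  by apply: cont_mulC; [exact: cont_cst|exact: square_cont].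
move=> t j; rewrite /meridian ev_lin mul1r.
have [->|ji] := eqVneq j i.
  rewrite qi vi add0r mulr1 mulf_neq0 //; last exact: square_neq0.
  by rewrite eq_complex /= negb_and gt_eqF.
by apply: sf; [|exact: square_bound|exact: ltW|].
Qed.

Lemma alpha_meridian i j q v e : ev (l i) q = 0 -> ev (l i) v = 1 -> 0 < e ->
  safe i q v e -> (alphaA j (meridian q v e) : rat) = (j == i)%:R.
Proof.
move=> qi vi e0 sf; rewrite /alphaA.
have -> : (fun t => ev (l j) (meridian q v e t) : CC) =
    fun t => ev (l j) q + e%:C%C * square t * ev (l j) v.
  by apply/funext => t; rewrite /meridian ev_lin mul1r.
have e0' : e%:C%C != 0 by rewrite eq_complex /= negb_and gt_eqF.
have [->|ji] := eqVneq j i.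
  have -> : (fun t => ev (l i) q + e%:C%C * square t * ev (l i) v : CC) =
      fun t => e%:C%C * square t.
    by apply/funext => t; rewrite qi vi add0r mulr1.
  exact: W_square_scale.
apply: (@W_near_const _ _ (fun t => e%:C%C * square t)).
- by apply: cont_mulC; [exact: cont_cst|exact: square_cont].
- by have [-> ->] := square01.
- move=> s t; have /andP[c0 c1] := clamp_itv s.
  have h0 : 0 <= clamp s * e by rewrite mulr_ge0 // ltW.
  have h1 : clamp s * e <= e by rewrite ler_piMl // ltW.
  have := @sf j (square t) ji (square_bound t) _ h0 h1.
  by rewrite rmorphM !mulrA.
Qed.

(** All flats, of any rank, appear as the set of hyperplanes through some point. *)
Definition flatA (X : {set 'I_n}) : Prop :=
  exists p, forall j, (ev (l j) p == 0) = (j \in X).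

Definition lineA i j k : Prop := exists a b c,
  [/\ a != 0, b != 0, c != 0 & forall z, a * ev (l i) z + b * ev (l j) z + c * ev (l k) z = 0].

Lemma comb_deltaA i k g :
  comb alphaA (delta i k) g = (alphaA i g : rat) - alphaA k g.
Proof. exact: comb_delta. Qed.

Lemma W_inv (x : CC) (g : RR -> CC) : path Cstar x x g -> W (fun t => (g t)^-1) = (- W g : rat).
Proof.
move=> pg; have [gc g0 g1 gS] := pg.
have pi : path Cstar (x^-1 : CC) (x^-1 : CC) (fun t => (g t)^-1).
  split; rewrite ?g0 ?g1 //; first exact: cont_invC.
  by move=> t; rewrite /Cstar /= invr_eq0; apply: gS.
have := W_mul pg pi.
have -> : (fun t => g t * (g t)^-1 : CC) = cst (1 : CC).
  by apply/funext => t; rewrite mulfV //; apply: gS.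
by rewrite W_cst ?oner_eq0 // => e; lra.
Qed.

(** By the linear relation, [phi] and [1 - phi] are constant multiples of [l_i / l_k] and
    [l_j / l_k]. So [phi] maps the complement to the plane without 0 and 1, and [heis_winding] is
    pulled back along it. *)
Lemma lineA_lifts i j k : lineA i j k ->
  grpd_lifts Mset alphaA (delta i k) (delta j k).
Proof.
move=> [a [b [c [a0 b0 c0 rel]]]].
have [H HP HE] := heis_winding.
pose phi z : CC := - a / c * (ev (l i) z * (ev (l k) z)^-1).
have phi1 z : Mset z -> 1 - phi z = - b / c * (ev (l j) z * (ev (l k) z)^-1).
  move=> Mz; rewrite /phi; have := rel z; have := Mz k.
  move: (ev (l i) z) (ev (l j) z) (ev (l k) z) => X Y Z Z0 e.
  have -> : Y = - b^-1 * (a * X + c * Z).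
    have -> : a * X + c * Z = - (b * Y) by rewrite -[RHS]addr0 -e; ring.
    by field.
  by field; rewrite b0 c0 Z0.
have mc (u : RR[i]) : u != 0 -> - u / c != 0.
  by move=> u0; rewrite mulf_neq0 ?invr_eq0 ?oppr_eq0.
exists (fun g => H (fun t => phi (g t))).
  apply: (@grpd_pullback _ _ _ Mset C01 phi H) HP => [X f fc fM|z Mz].
    apply: cont_mulC; first exact: cont_cst.
    apply: cont_mulC; first exact: cont_ev.
    by apply: cont_invC => [|x]; [exact: cont_ev | exact: fM].
  split; first by rewrite mulf_neq0 ?mc // mulf_neq0 ?invr_eq0 //; exact: Mz.
  by rewrite phi1 // mulf_neq0 ?mc // mulf_neq0 ?invr_eq0 //; exact: Mz.
move=> x L pL; have [Lc L0 L1 LM] := pL.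
have pk m : path Cstar (ev (l m) x : CC) (ev (l m) x : CC) (fun t => ev (l m) (L t)).
  split; rewrite ?L0 ?L1 //; first exact: cont_ev.
  by move=> t; apply: LM.
have pp : path C01 (phi x) (phi x) (fun t => phi (L t)).
  split; rewrite ?L0 ?L1 //.
    apply: cont_mulC; first exact: cont_cst.
    apply: cont_mulC; first exact: cont_ev.
    by apply: cont_invC => [|s]; [exact: cont_ev | exact: LM].
  move=> t; split; first by rewrite mulf_neq0 ?mc // mulf_neq0 ?invr_eq0 //; exact: LM.
  by rewrite phi1 // mulf_neq0 ?mc // mulf_neq0 ?invr_eq0 //; exact: LM.
have quot m : W (fun t => ev (l m) (L t) * (ev (l k) (L t))^-1) =
    ((alphaA m L : rat) - alphaA k L : rat).
  rewrite (W_mul (pk m) (y := (ev (l k) x)^-1) (g := fun t => (ev (l k) (L t))^-1)).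
    by rewrite (W_inv (pk k)).
  split; rewrite ?L0 ?L1 //.
    by apply: cont_invC => [|s]; [exact: cont_ev | exact: LM].
  by move=> t; rewrite /Cstar /= invr_eq0; apply: LM.
have pq m : path Cstar (ev (l m) x * (ev (l k) x)^-1 : CC)
    (ev (l m) x * (ev (l k) x)^-1 : CC) (fun t => ev (l m) (L t) * (ev (l k) (L t))^-1).
  split; rewrite ?L0 ?L1 //.
    apply: cont_mulC; first exact: cont_ev.
    by apply: cont_invC => [|s]; [exact: cont_ev | exact: LM].
  by move=> t; rewrite /Cstar /= mulf_neq0 ?invr_eq0 //; apply: LM.
have [-> ->] := HE _ _ _ pp; rewrite !comb_deltaA -!quot; split.
  exact: (W_scale (pq i)) (mc a a0).
have -> : (fun t => 1 - phi (L t)) =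
    fun t => - b / c * (ev (l j) (L t) * (ev (l k) (L t))^-1).
  by apply/funext => t; rewrite phi1.
exact: (W_scale (pq j)) (mc b b0).
Qed.

(** [p] lies on the hyperplanes of [X] and no others. The torus [F] turns around [p] in the first
    variable, where every form of [X] winds once, and follows a meridian of [i] scaled down towards
    [p] in the second. For small [d] the other forms stay near their nonzero values. *)
Lemma flatA_condition a b : grpd_lifts Mset alphaA a b -> flat_condition flatA a b.
Proof.
move=> [R rP RE] X i [p pX] iX.
have [q qi qP] := generic_on i; have [v vi] := unit_normal i.
have [e e0 sf] := safe_ex v qP.
have pmer := meridian_path qi vi e0 sf.
have [mc m0 m1 mM] := pmer.
have e0' : e%:C%C != 0 by rewrite eq_complex /= negb_and gt_eqF.
have mE j t : ev (l j) (meridian q v e t) = ev (l j) q + e%:C%C * square t * ev (l j) v.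
  by rewrite /meridian ev_lin mul1r.
pose B j := nrm (ev (l j) q) + `|e| * (2 * nrm (ev (l j) v)).
have mB j t : nrm (ev (l j) (meridian q v e t)) <= B j.
  rewrite mE; apply: le_trans (nrmD _ _) _; rewrite lerD2l -mulrA nrm_real.
  apply: ler_wpM2l => //; apply: le_trans (nrmM _ _) _.
  exact: (ler_wpM2r (nrm_ge0 _) (square_bound t)).
have [j|d d0 dP] := @common_scale 'I_n (fun j (d : RR) => j \notin X ->
    forall w, nrm w <= 2 * B j -> ev (l j) p + d%:C%C * w * 1 != 0).
  have [jX|jX] := boolP (j \in X); first by exists 1.
  have pj : ev (l j) p != 0 by rewrite pX.
  have [d d0 dP] := small_perturbation 1 (2 * B j) (nrm_gt0 pj).
  by exists d => // d' h1 h2 _ w; apply: dP.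
have d0' : d%:C%C != 0 by rewrite eq_complex /= negb_and gt_eqF.
pose F (s : RR * RR) : Cspace r := lin 1 (d%:C%C * square s.1) p (meridian q v e s.2).
have FE j s : ev (l j) (F s) =
    ev (l j) p + d%:C%C * square s.1 * ev (l j) (meridian q v e s.2).
  by rewrite /F ev_lin mul1r.
have sqB j (s t : RR) : nrm (square s * ev (l j) (meridian q v e t)) <= 2 * B j.
  apply: le_trans (nrmM _ _) _; apply: ler_pM; rewrite ?nrm_ge0 //.
  exact: square_bound.
have Fnz j (u : RR) (s t : RR) : 0 < u -> u <= 1 -> j \notin X ->
    ev (l j) p + (u * d)%:C%C * (square s * ev (l j) (meridian q v e t)) != 0.
  move=> u0 u1 jX.
  have := @dP j (u * d) (mulr_gt0 u0 d0) _ jX _ (sqB j s t).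
  by rewrite mulr1; apply; rewrite ler_piMl // ltW.
have FM s : Mset (F s).
  move=> j; rewrite FE; have [jX|jX] := boolP (j \in X).
    have /eqP -> : ev (l j) p == 0 by rewrite pX.
    rewrite add0r !mulf_neq0 //; first exact: square_neq0.
    exact: mM.
  by rewrite -mulrA; have := @Fnz j 1 s.1 s.2 ltr01 (lexx _) jX; rewrite mul1r.
have sqc1 : continuous (fun s : RR * RR => square s.1).
  by apply: cont_comp square_cont; cont.
have Fc : continuous F.
  apply: cont_lin; [exact: cont_cst| |exact: cont_cst|].
    by apply: cont_mulC; [exact: cont_cst|exact: sqc1].
  by apply: cont_comp mc; cont.
have [s0 s1] := square01.
have F1t : (fun t => F (1, t)) = fun t => F (0, t).
  by apply/funext => t; rewrite /F /= s1 s0.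
have Fs1 : (fun s => F (s, 1)) = fun s => F (s, 0).
  by apply/funext => s; rewrite /F /= m1.
have := grpd_square rP Fc FM; rewrite F1t Fs1 => /heis_commute.
have pt : path Mset (F (0, 0)) (F (0, 0)) (fun t => F (0, t)).
  split; [|by []|by rewrite /F /= m1|by move=> t; exact: FM].
  by apply: cont_comp Fc; cont.
have ps : path Mset (F (0, 0)) (F (0, 0)) (fun s => F (s, 0)).
  split; [|by []|by rewrite /F /= s0 s1|by move=> t; exact: FM].
  by apply: cont_comp Fc; cont.
have [-> ->] := RE _ _ pt; have [-> ->] := RE _ _ ps.
have near0 j (f : RR -> CC) : j \notin X -> continuous f -> f 0 = f 1 ->
    (forall t, exists s' t', f t = square s' * ev (l j) (meridian q v e t')) ->
    W (fun t => ev (l j) p + d%:C%C * f t) = (0 : rat).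
  move=> jX fc f01 fE.
  have -> : (fun t => ev (l j) p + d%:C%C * f t : CC) = fun t => ev (l j) p + f t * d%:C%C.
    by apply/funext => t; rewrite [_ * f t]mulrC.
  apply: W_near_const => // s t; have [s' [t' ->]] := fE t.
  have /andP[c0 c1] := clamp_itv s.
  have [z|nz] := eqVneq (clamp s) 0; first by rewrite z mul0r addr0 pX.
  have c2 : 0 < clamp s by rewrite lt0r nz.
  have := @Fnz j (clamp s) s' t' c2 c1 jX; apply: contraNN => /eqP e1.
  by rewrite -e1 rmorphM; apply/eqP; ring.
have at_ j : (alphaA j (fun t => F (0, t)) : rat) = (j == i)%:R.
  have [jX|jX] := boolP (j \in X); last first.
    have ji : j != i by apply: contraNneq jX => ->.
    rewrite (negbTE ji) /alphaA.
    have -> : (fun t => ev (l j) (F (0, t)) : CC) =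
        fun t => ev (l j) p + d%:C%C * (square 0 * ev (l j) (meridian q v e t)).
      by apply/funext => t; rewrite FE -mulrA.
    apply: (near0 _ _ jX); [|by rewrite m1|by move=> t; exists 0, t].
    by apply: cont_mulC; [exact: cont_cst|exact: cont_ev].
  rewrite -(alpha_meridian j qi vi e0 sf) /alphaA.
  have [mmc mm0 mm1 mmM] := pmer.
  have -> : (fun t => ev (l j) (F (0, t)) : CC) =
      fun t => d%:C%C * square 0 * ev (l j) (meridian q v e t).
    apply/funext => t; rewrite FE; have /eqP -> : ev (l j) p == 0 by rewrite pX.
    by rewrite add0r.
  apply: (W_scale (x := ev (l j) (meridian q v e 0))).
    by split; [exact: cont_ev|by []|by rewrite mm1|move=> t; exact: mmM].
  by rewrite mulf_neq0 ?square_neq0.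
have as_ j : (alphaA j (fun s => F (s, 0)) : rat) = (j \in X)%:R.
  have [jX|jX] := boolP (j \in X); last first.
    rewrite /alphaA.
    have -> : (fun t => ev (l j) (F (t, 0)) : CC) =
        fun t => ev (l j) p + d%:C%C * (square t * ev (l j) (meridian q v e 0)).
      by apply/funext => t; rewrite FE -mulrA.
    apply: (near0 _ _ jX); [|by rewrite s0 s1|by move=> t; exists t, 0].
    by apply: cont_mulC; [exact: square_cont|exact: cont_cst].
  rewrite /alphaA.
  have -> : (fun t => ev (l j) (F (t, 0)) : CC) =
      fun t => (d%:C%C * ev (l j) (meridian q v e 0)) * square t.
    apply/funext => t; rewrite FE; have /eqP -> : ev (l j) p == 0 by rewrite pX.
    by rewrite add0r mulrAC.
  by apply: W_square_scale; rewrite mulf_neq0 //; apply: mM.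
have c1 (u : 'I_n -> rat) : comb alphaA u (fun t => F (0, t)) = u i.
  rewrite /comb; under eq_bigr => j _ do rewrite at_.
  by rewrite (bigD1 i) //= eqxx mulr1 big1 ?addr0 // => j /negbTE ->; rewrite mulr0.
have c2 (u : 'I_n -> rat) : comb alphaA u (fun s => F (s, 0)) = \sum_(j in X) u j.
  rewrite /comb; under eq_bigr => j _ do rewrite as_.
  rewrite [RHS]big_mkcond /=; apply: eq_bigr => j _.
  by case: ifP => _; rewrite ?mulr1 ?mulr0.
by rewrite !c1 !c2 => h; rewrite mulrC [RHS]mulrC; lra.
Qed.

(** The meridians are dual to the classes [alphaA l i]. *)
Lemma alphaA_indep a : (forall x L, path Mset x x L -> comb alphaA a L = 0) ->
  forall i, a i = 0.
Proof.
move=> a0 i.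
have [q qi qP] := generic_on i; have [v vi] := unit_normal i.
have [e e0 sf] := safe_ex v qP.
have := a0 _ _ (meridian_path qi vi e0 sf); rewrite /comb (bigD1 i) //= big1.
  by rewrite (alpha_meridian _ qi vi e0 sf) eqxx mulr1 addr0.
by move=> j ji; rewrite (alpha_meridian _ qi vi e0 sf) (negbTE ji) mulr0.
Qed.

End Arrangement.

(** * Potentials on convex sets and extension over a hyperplane *)

Lemma nbhs_lt (X : topologicalType) (f g : X -> RR) x :
  continuous f -> continuous g -> f x < g x -> nbhs x [set y | f y < g y].
Proof.
move=> fc gc fg.
have hc : continuous (fun y => f y - g y) by cont.
have h0 : f x - g x < 0 by rewrite subr_lt0.
have h : nbhs x [set y | f y - g y < 0] := hc x [set u : RR | u < 0] (lt_nbhsl h0).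
by apply: (filterS _ h) => y /=; rewrite subr_lt0.
Qed.

Lemma nbhs_all (X : topologicalType) (J : eqType) (s : seq J) (V : J -> set X) (x : X) :
  (forall j, j \in s -> nbhs x (V j)) ->
  nbhs x [set y | forall j, j \in s -> V j y].
Proof.
elim: s => [_|j s IH h]; first by apply: filterE => y j; rewrite in_nil.
have h1 : nbhs x (V j) by apply: h; rewrite mem_head.
have h2 := IH (fun k ks => h k (mem_behead (s := j :: s) ks)).
apply: (filterS2 _ _ h1 h2) => y Vj Vs k; rewrite inE => /orP[/eqP ->//|]; exact: Vs.
Qed.

Section Convex.
Context {r : nat}.
Implicit Types (x y z : Cspace r) (V S : set (Cspace r)) (R : (RR -> Cspace r) -> radd).
Implicit Type a : 'I_r -> CC.

Definition aseg x y : RR -> Cspace r :=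
  fun t => lin (1 - clamp t)%:C%C (clamp t)%:C%C x y.

Lemma cont_aseg (X : topologicalType) (u : X -> RR) (f g : X -> Cspace r) :
  continuous u -> continuous f -> continuous g ->
  continuous (fun p => aseg (f p) (g p) (u p)).
Proof.
move=> uc fc gc; apply: cont_lin => //; apply: cont_realC.
  by apply: cont_add; [exact: cont_cst|apply: cont_opp; exact: cont_comp uc clamp_cont].
exact: cont_comp uc clamp_cont.
Qed.

Lemma aseg0 x y : aseg x y 0 = x.
Proof. by apply/funext => k; rewrite /aseg /lin clamp0 subr0 mul1r mul0r addr0. Qed.
Lemma aseg1 x y : aseg x y 1 = y.
Proof. by apply/funext => k; rewrite /aseg /lin clamp1 subrr mul0r mul1r add0r. Qed.
Lemma asegxx x t : aseg x x t = x.
Proof. by apply/funext => k; rewrite /aseg /lin -mulrDl -rmorphD subrK mul1r. Qed.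

Lemma ev_aseg a x y t :
  ev a (aseg x y t) = (1 - clamp t)%:C%C * ev a x + (clamp t)%:C%C * ev a y.
Proof. exact: ev_lin. Qed.

Definition convex V := forall x y t, V x -> V y -> V (aseg x y t).

Definition potential V R (F : Cspace r -> rat) :=
  forall x y g, path V x y g -> (R g : rat) = F y - F x.

Lemma path_aseg V x y : (forall t, V (aseg x y t)) -> path V x y (aseg x y).
Proof.
by split; rewrite ?aseg0 ?aseg1 //; apply: cont_aseg; [exact: cont_id|exact: cont_cst|exact: cont_cst].
Qed.

Lemma path_subset S S' x y (g : RR -> Cspace r) : S `<=` S' -> path S x y g -> path S' x y g.
Proof. by move=> SS [gc g0 g1 gS]; split=> // t; apply: SS. Qed.

Lemma grpd_restrict S S' R : S `<=` S' -> grpd_rep S' R -> grpd_rep S R.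
Proof. by move=> SS; apply: (@grpd_pullback _ _ _ S S' id R). Qed.

Lemma convex_seg S R V x y g : grpd_rep S R -> convex V -> V `<=` S ->
  path V x y g -> R g = R (aseg x y).
Proof.
move=> rP Vc VS [gc g0 g1 gV].
have Vx : V x by rewrite -g0. have Vy : V y by rewrite -g1.
have ac : continuous (aseg x y) by have [] := path_aseg (fun t => Vc x y t Vx Vy).
pose F (p : RR * RR) : Cspace r := aseg (g p.2) (aseg x y p.2) p.1.
have Fc : continuous F.
  by apply: cont_aseg; [cont | apply: cont_comp gc; cont | apply: cont_comp ac; cont].
have FS p : S (F p).
  by apply: VS; apply: (Vc _ _ _ (gV _)); apply: (Vc _ _ _ Vx Vy).
have := grpd_square rP Fc FS.
have -> : (fun t => F (0, t)) = g by apply/funext => t; rewrite /F /= aseg0.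
have -> : (fun t => F (1, t)) = aseg x y by apply/funext => t; rewrite /F /= aseg1.
have -> : (fun s => F (s, 1)) = cst y.
  by apply/funext => t; rewrite /F /= aseg1 g1 asegxx.
have -> : (fun s => F (s, 0)) = cst x.
  by apply/funext => t; rewrite /F /= aseg0 g0 asegxx.
by rewrite !(grpd_cst rP) ?mul1g ?mulg1 //; exact: VS.
Qed.

Lemma convex_tri S R V x y z : grpd_rep S R -> convex V -> V `<=` S ->
  V x -> V y -> V z -> (R (aseg x y) + R (aseg y z) : rat) = R (aseg x z).
Proof.
move=> rP Vc VS Vx Vy Vz.
have p1 := path_aseg (fun t => Vc x y t Vx Vy).
have p2 := path_aseg (fun t => Vc y z t Vy Vz).
rewrite -(convex_seg rP Vc VS (path_cat p1 p2)).
by rewrite (rP.2 _ _ _ _ _ (path_subset VS p1) (path_subset VS p2)).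
Qed.

Lemma convex_potential S R V b : grpd_rep S R -> convex V -> V `<=` S -> V b ->
  potential V R (fun y => R (aseg b y)).
Proof.
move=> rP Vc VS Vb x y g pg; have [Vx Vy] := path_in pg.
by rewrite (convex_seg rP Vc VS pg) -(convex_tri rP Vc VS Vb Vx Vy) addrC addKr.
Qed.

Definition half (k : nat) (z : RR[i]) : bool :=
  match k with 0 => 0 < Im z | 1 => Re z < 0 | 2 => Im z < 0 | _ => 0 < Re z end.

Lemma half_convex k (z w : RR[i]) t : half k z -> half k w ->
  half k ((1 - clamp t)%:C%C * z + (clamp t)%:C%C * w).
Proof.
have /andP[c0 c1] := clamp_itv t; move: (clamp t) c0 c1 => u u0 u1.
case: z w => [a b] [c d].
have aux (x y : RR) : 0 < x -> 0 < y -> 0 < (1 - u) * x + u * y.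
  move=> x0 y0; have [->|u0'] := eqVneq u 0; first by rewrite subr0 mul1r mul0r addr0.
  have up : 0 < u by rewrite lt0r u0'.
  by apply: ltr_wpDl (mulr_gt0 up y0); apply: mulr_ge0 (ltW x0); rewrite subr_ge0.
case: k => [|[|[|k]]] /=; rewrite !mul0r ?subr0 ?addr0 => h1 h2.
- exact: aux.
- have := aux (- a) (- c); rewrite !oppr_gt0 => /(_ h1 h2); lra.
- have := aux (- b) (- d); rewrite !oppr_gt0 => /(_ h1 h2); lra.
- exact: aux.
Qed.

Lemma half_nbhs a k x : half k (ev a x) -> nbhs x [set y | half k (ev a y)].
Proof.
have c : continuous (fun y => ev a y : CC) by apply: cont_ev; exact: cont_id.
by case: k => [|[|[|k]]] /= h; apply: nbhs_lt => //;
  by [exact: cont_cst|exact: cont_Ref|exact: cont_Imf].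
Qed.

Lemma half_neq0 k (z : RR[i]) : half k z -> z != 0.
Proof.
by case: z => [a b]; rewrite eq_complex negb_and /=; case: k => [|[|[|k]]] /= h;
  rewrite ?(gt_eqF h) ?(lt_eqF h) ?orbT.
Qed.

Lemma half_ex (z : RR[i]) : z != 0 -> exists k, half k z.
Proof.
case: z => [a b]; rewrite eq_complex negb_and /=.
by case: (ltgtP a 0) => ha; case: (ltgtP b 0) => hb //= _;
  solve [by exists 0|by exists 1|by exists 2|by exists 3].
Qed.

(* The four half planes Im > 0, Re < 0, Im < 0, Re > 0 cover the punctured
   plane, cyclically neighbouring ones meet in a convex set, opposite ones do
   not meet. *)
Lemma punctured_potential S R V a (zeta : nat -> Cspace r) (e : RR) :
  grpd_rep S R -> convex V -> V `&` [set z | ev a z != 0] `<=` S -> 0 < e ->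
  (forall k, V (zeta k) /\ ev a (zeta k) = e%:C%C * corner k) ->
  (R (aseg (zeta 0) (zeta 1)) + R (aseg (zeta 1) (zeta 2)) +
   R (aseg (zeta 2) (zeta 3)) + R (aseg (zeta 3) (zeta 0)) : rat) = 0 ->
  exists F, potential (V `&` [set z | ev a z != 0]) R F.
Proof.
move=> rP Vc VS e0 zP per.
pose H k : set (Cspace r) := V `&` [set z | half k (ev a z)].
have Hc k : convex (H k).
  by move=> x y t [Vx hx] [Vy hy]; split; [exact: Vc|rewrite /= ev_aseg; exact: half_convex].
have HS k : H k `<=` S by move=> x [Vx /half_neq0 hx]; apply: VS.
have tri k x y z : H k x -> H k y -> H k z ->
    (R (aseg x y) + R (aseg y z) : rat) = R (aseg x z).
  exact: convex_tri rP (Hc k) (HS k).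
have zH k j : half k (e%:C%C * corner j) -> H k (zeta j).
  by move=> h; have [Vz ez] := zP j; split=> //; rewrite /= ez.
have [z00 z01] : H 0 (zeta 0) /\ H 0 (zeta 1).
  by split; apply: zH => /=; rewrite mul0r addr0 mulr1.
have [z11 z12] : H 1 (zeta 1) /\ H 1 (zeta 2).
  by split; apply: zH => /=; rewrite mul0r subr0 mulrN1 oppr_lt0.
have [z22 z23] : H 2 (zeta 2) /\ H 2 (zeta 3).
  by split; apply: zH => /=; rewrite mul0r addr0 mulrN1 oppr_lt0.
have [z33 z30] : H 3 (zeta 3) /\ H 3 (zeta 0).
  by split; apply: zH => /=; rewrite mul0r subr0 mulr1.
set r01 : rat := R (aseg (zeta 0) (zeta 1)) in per.
set r12 : rat := R (aseg (zeta 1) (zeta 2)) in per.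
set r23 : rat := R (aseg (zeta 2) (zeta 3)) in per.
set r30 : rat := R (aseg (zeta 3) (zeta 0)) in per.
(* The integral from [zeta 0] through the successive corners to [zeta k], then straight to [w].
   Indices above 3 are treated as 3, as in [half]. *)
pose Fk k w : rat := match k with 0 => 0 | 1 => r01 | 2 => r01 + r12
  | _ => r01 + r12 + r23 end + R (aseg (zeta (minn k 3)) w).
pose F w : rat := if half 0 (ev a w) then Fk 0 w else if half 1 (ev a w) then Fk 1 w
  else if half 2 (ev a w) then Fk 2 w else Fk 3 w.
have e01 w : H 0 w -> Fk 0 w = Fk 1 w.
  by move=> hw; rewrite /Fk /= -(tri 0 _ _ w z00 z01 hw) add0r.
have e12 w : H 1 w -> Fk 1 w = Fk 2 w.
  by move=> hw; rewrite /Fk /= -(tri 1 _ _ w z11 z12 hw) addrA.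
have e23 w : H 2 w -> Fk 2 w = Fk 3 w.
  by move=> hw; rewrite /Fk /= -(tri 2 _ _ w z22 z23 hw) !addrA.
have e30 w : H 3 w -> Fk 0 w = Fk 3 w.
  by move=> hw; rewrite /Fk /= -(tri 3 _ _ w z33 z30 hw) -/r30 addrA per.
have FE k w : H k w -> F w = Fk k w.
  have F3 j : Fk j.+3 w = Fk 3 w by rewrite /Fk /minn.
  move=> hw; have [Vw hk] := hw.
  have H0 : half 0 (ev a w) -> H 0 w by [].
  have H1 : half 1 (ev a w) -> H 1 w by [].
  have H2 : half 2 (ev a w) -> H 2 w by [].
  rewrite /F; case: k hw hk => [|[|[|k]]] hw hk; rewrite ?F3.
  - by rewrite hk.
  - by case: ifP => h0; [rewrite e01 // H0|rewrite hk].
  - case: ifP => h0; first by move: h0 hk => /= h0 /(lt_trans h0); rewrite ltxx.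
    by case: ifP => h1; [rewrite e12 // H1|rewrite hk].
  - case: ifP => h0; first by rewrite e30.
    case: ifP => h1; first by move: h1 hk => /= h1 /(lt_trans h1); rewrite ltxx.
    by case: ifP => h2 //; rewrite e23 // H2.
exists F; pose S' := V `&` [set z | ev a z != 0].
have rP' : grpd_rep S' R by exact: grpd_restrict rP.
have tP : grpd_rep S' (fun=> 1%g : radd) by split=> //; rewrite mul1g.
have := @grpd_local _ _ S' R (fun=> 1%g) (fun w => F w : radd) rP' tP.
move=> H' x y g pg; rewrite (H' _ x y g pg) ?mulg1; first by rewrite raddM raddV addrC.
move=> {pg} z [Vz /half_ex[k hk]]; exists [set y | half k (ev a y)]; first exact: half_nbhs.
move=> {}x {}y {}g pg gH.
have pk : path (H k) x y (fun t => g (clamp t)).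
  have [gc g0 g1 gV] := path_clamp2 pg; split=> // t; split; first by have [] := gV t.
  exact: gH (clamp_itv t).
rewrite -(clamp_radd rP' pg) (convex_seg rP (Hc k) (HS k) pk).
have [hx hy] := path_in pk; rewrite mulg1 raddM raddV (FE k) // (FE k) //.
have h j (zj : H k (zeta j)) := tri k _ _ _ zj hx hy.
case: k {hk gH pk hx hy} h => [|[|[|k]]] h; rewrite /Fk /minn /=.
- by rewrite -(h 0 z00); ring.
- by rewrite -(h 1 z11); ring.
- by rewrite -(h 2 z22); ring.
- by rewrite -(h 3 z33); ring.
Qed.

End Convex.

Section Span.
Context {r n : nat}.
Variable l : 'I_n -> 'I_r -> CC.
Implicit Types (x y z p q v : Cspace r) (s : seq 'I_n).
Implicit Types (R : (RR -> Cspace r) -> radd).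

Definition MS s : set (Cspace r) := [set z | forall j, j \in s -> ev (l j) z != 0].

Definition safe_on s q v (e : RR) : Prop := forall j (w : RR[i]), j \in s -> nrm w <= 2 ->
  forall e', 0 <= e' -> e' <= e -> ev (l j) q + e'%:C%C * w * ev (l j) v != 0.

(** The size of each form has a positive minimum on the path, and the admissible radius depends on
    the form only through this minimum. *)
Lemma uniform_safe s (q : RR -> Cspace r) v : continuous q -> (forall t, MS s (q t)) ->
  exists2 e, 0 < e & forall t, safe_on s (q (clamp t)) v e.
Proof.
move=> qc qS.
have [j|e e0 eP] := @common_scale 'I_n (fun j e => j \in s -> forall t w,
    nrm w <= 2 -> ev (l j) (q (clamp t)) + e%:C%C * w * ev (l j) v != 0).
  have [js|js] := boolP (j \in s); last by exists 1.
  pose f (t : RR) := nrm (ev (l j) (q t)).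
  have fc : continuous f by apply: cont_nrm; apply: cont_ev.
  have [c _ cP] := EVT_min ler01 (continuous_subspaceT fc).
  have [e e0 eP] := small_perturbation (ev (l j) v) 2 (nrm_gt0 (qS c j js)).
  exists e => // e' h1 h2 _ t w; apply: (eP _ h1 h2).
  by apply: cP; rewrite in_itv /=; exact: clamp_itv.
exists e => // t j w js w2 e'; rewrite le0r => /orP[/eqP -> _|e'0 e'e].
  by rewrite !mul0r addr0; exact: qS.
exact: eP.
Qed.

Lemma safe_on_ex s q v : MS s q -> exists2 e, 0 < e & safe_on s q v e.
Proof.
move=> qS; have [e e0 eP] := @uniform_safe s (fun=> q) v (@cont_cst _ _ q) (fun=> qS).
by exists e => //; exact: (eP 0).
Qed.

Lemma safe_on_le s q v e e' : safe_on s q v e -> e' <= e -> safe_on s q v e'.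
Proof. by move=> sf le j w js w2 d d0 de; apply: sf => //; exact: le_trans de le. Qed.

Lemma circle_on s i q v e (w : RR[i]) : ev (l i) q = 0 -> ev (l i) v = 1 -> 0 < e ->
  safe_on s q v e -> w != 0 -> nrm w <= 2 -> MS (i :: s) (lin 1 (e%:C%C * w) q v).
Proof.
move=> qi vi e0 sf w0 w2 j; rewrite inE => /orP[/eqP ->|js]; rewrite ev_lin mul1r.
  by rewrite qi vi add0r mulr1 mulf_neq0 // eq_complex /= negb_and gt_eqF.
by apply: sf => //; exact: ltW.
Qed.

Lemma meridian_path_on s i q v e t : ev (l i) q = 0 -> ev (l i) v = 1 -> 0 < e ->
  safe_on s q v e -> MS (i :: s) (meridian q v e t).
Proof.
by move=> qi vi e0 sf; apply: circle_on => //; [exact: square_neq0|exact: square_bound].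
Qed.

Lemma meridian01 q v e : meridian q v e 0 = meridian q v e 1.
Proof. by rewrite /meridian; have [-> ->] := square01. Qed.

Lemma cont_meridian (X : topologicalType) (q : X -> Cspace r) v (e t : X -> RR) :
  continuous q -> continuous e -> continuous t ->
  continuous (fun u => meridian (q u) v (e u) (t u)).
Proof.
move=> qc ec tc; apply: cont_lin; [exact: cont_cst| |exact: qc|exact: cont_cst].
by apply: cont_mulC; [exact: cont_realC|exact: cont_comp tc square_cont].
Qed.

(** Both meridians are brought to a radius safe along a whole path from [q] to [q'] inside the
    hyperplane of [i]; then the centre is moved along this path. *)
Lemma meridian_inv s i R q q' v e e' : grpd_rep (MS (i :: s)) R -> ev (l i) v = 1 ->
  ev (l i) q = 0 -> MS s q -> 0 < e -> safe_on s q v e ->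
  ev (l i) q' = 0 -> MS s q' -> 0 < e' -> safe_on s q' v e' ->
  R (meridian q v e) = R (meridian q' v e').
Proof.
move=> rP vi qi qS e0 sf q'i q'S e'0 sf'.
have scale p d d' : ev (l i) p = 0 -> 0 < d -> 0 < d' -> d <= d' -> safe_on s p v d' ->
    R (meridian p v d) = R (meridian p v d').
  move=> pp d0 d'0 dd' sd.
  pose D (u : RR) := d + clamp u * (d' - d).
  have Dc : continuous (fun p : RR * RR => D p.1).
    have c1 : continuous (fun p : RR * RR => clamp p.1) by apply: cont_comp clamp_cont; cont.
    by rewrite /D; cont.
  pose F (u : RR * RR) := meridian p v (D u.1) u.2.
  have Fc : continuous F by apply: cont_meridian => //; [exact: cont_cst|cont].
  have FS u : MS (i :: s) (F u).
    have /andP[c0 c1] := clamp_itv u.1.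
    have dd0 : 0 <= d' - d by rewrite subr_ge0.
    have b0 : 0 <= clamp u.1 * (d' - d) by rewrite mulr_ge0.
    have b1 : clamp u.1 * (d' - d) <= d' - d by rewrite ler_piMl.
    apply: meridian_path_on => //; first by rewrite /D; lra.
    by apply: safe_on_le sd _; rewrite /D; lra.
  have F01 u : F (u, 0) = F (u, 1) by exact: meridian01.
  have := free_htpy rP Fc FS F01; rewrite /F /D /= clamp0 clamp1 mul0r mul1r addr0.
  by rewrite addrC subrK.
have [g [gc g0 g1 gS]] := bent_path l q q'.
have gS' t : MS s (g t) by move=> j js; apply: (gS t j).1; [exact: qS|exact: q'S].
have gi t : ev (l i) (g t) = 0 by exact: (gS t i).2.
have [d d0 dP] := uniform_safe v gc gS'.
have move_ : R (meridian q v d) = R (meridian q' v d).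
  pose F (u : RR * RR) := meridian (g (clamp u.1)) v d u.2.
  have Fc : continuous F.
    apply: cont_meridian; [|exact: cont_cst|cont].
    by apply: (@cont_comp _ _ _ g (fun u : RR * RR => clamp u.1)) gc; apply: cont_comp clamp_cont; cont.
  have FS u : MS (i :: s) (F u) by apply: meridian_path_on.
  have F01 u : F (u, 0) = F (u, 1) by exact: meridian01.
  by have := free_htpy rP Fc FS F01; rewrite /F /= clamp0 clamp1 g0 g1.
have sq := dP 0; have sq' := dP 1; rewrite clamp0 g0 in sq; rewrite clamp1 g1 in sq'.
have [de|ed] := lerP d e.
  rewrite -(scale q d e) // move_; have [de'|ed'] := lerP d e'; first by rewrite (scale q' d e').
  by rewrite (scale q' e' d) // ltW.
rewrite (scale q e d) ?(ltW ed) // move_; have [de'|ed'] := lerP d e'.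
  by rewrite (scale q' d e').
by rewrite (scale q' e' d) // ltW.
Qed.

Lemma meridian_square s i R q v e : grpd_rep (MS (i :: s)) R -> ev (l i) v = 1 ->
  ev (l i) q = 0 -> 0 < e -> safe_on s q v e ->
  let zeta k := lin 1 (e%:C%C * corner k) q v in
  (R (meridian q v e) : rat) =
  R (aseg (zeta 0) (zeta 1)) + R (aseg (zeta 1) (zeta 2)) +
  R (aseg (zeta 2) (zeta 3)) + R (aseg (zeta 3) (zeta 0)).
Proof.
move=> rP vi qi e0 sf zeta.
have seg a b t : aseg (zeta a) (zeta b) t = lin 1 (e%:C%C * cseg (corner a) (corner b) t) q v.
  apply/funext => k; rewrite /aseg /zeta /lin /cseg.
  have -> : (1 - clamp t)%:C%C = 1 - (clamp t)%:C%C :> RR[i] by rewrite rmorphB rmorph1.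
  by move: ((clamp t)%:C%C) => u; ring.
have mE : meridian q v e = loop_concat
    (loop_concat (aseg (zeta 0) (zeta 1)) (aseg (zeta 1) (zeta 2)))
    (loop_concat (aseg (zeta 2) (zeta 3)) (aseg (zeta 3) (zeta 0))).
  apply/funext => t; rewrite /meridian /square /loop_concat.
  by case: ifP => _; case: ifP => _; rewrite seg.
have pc k : (k < 4)%N -> path (MS (i :: s)) (zeta k) (zeta (k.+1 %% 4)%N)
    (aseg (zeta k) (zeta (k.+1 %% 4)%N)).
  move=> k4; apply: path_aseg => t; rewrite seg; apply: circle_on => //.
    by have [_ _ _] := path_corner k4; apply.
  exact: cseg_bound.
rewrite mE (rP.2 _ _ _ _ _ (path_cat (pc 0 isT) (pc 1 isT)) (path_cat (pc 2 isT) (pc 3 isT))).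
rewrite (rP.2 _ _ _ _ _ (pc 0 isT) (pc 1 isT)) (rP.2 _ _ _ _ _ (pc 2 isT) (pc 3 isT)).
by rewrite !raddM addrA.
Qed.

Hypothesis l_indep : forall i j, i != j -> exists2 z, ev (l i) z = 0 & ev (l j) z != 0.
Hypothesis l_neq0 : forall i, exists z, ev (l i) z != 0.

(** A ball measured by the forms of [s] instead of a norm on C^r: convexity, openness and
    disjointness from the hyperplanes are checked one form at a time. *)
Definition Bset s x : set (Cspace r) :=
  [set a | forall j, j \in s -> nrm (ev (l j) a - ev (l j) x) < nrm (ev (l j) x)].

Lemma Bset_refl s x : MS s x -> Bset s x x.
Proof.
move=> xS j js; rewrite subrr nrm0; exact: nrm_gt0 (xS j js).
Qed.

Lemma Bset_sub s x : Bset s x `<=` MS s.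
Proof.
move=> a aB j js; apply/eqP => e; have := aB j js.
by rewrite e sub0r nrmN ltxx.
Qed.

Lemma Bset_convex s x : convex (Bset s x).
Proof.
move=> a b t aB bB j js; rewrite ev_aseg; have /andP[c0 c1] := clamp_itv t.
have -> : (1 - clamp t)%:C%C * ev (l j) a + (clamp t)%:C%C * ev (l j) b - ev (l j) x =
    (1 - clamp t)%:C%C * (ev (l j) a - ev (l j) x) +
    (clamp t)%:C%C * (ev (l j) b - ev (l j) x).
  have -> : (1 - clamp t)%:C%C = 1 - (clamp t)%:C%C :> RR[i] by rewrite rmorphB rmorph1.
  by move: ((clamp t)%:C%C) => u; ring.
apply: le_lt_trans (nrmD _ _) _; rewrite !nrm_real !ger0_norm ?subr_ge0 //.
have := aB j js; have := bB j js.
move: (nrm _) (nrm _) (nrm _) => u v w; move: (clamp t) c0 c1 => d d0 d1 h1 h2.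
have [->|nd] := eqVneq d 0; first by rewrite subr0 mul1r mul0r addr0.
have dp : 0 < d by rewrite lt0r nd.
have -> : v = (1 - d) * v + d * v by ring.
by apply: ler_ltD; [apply: ler_wpM2l; rewrite ?subr_ge0 // ltW | rewrite ltr_pM2l].
Qed.

Lemma Bset_push s x v a : Bset s x a -> exists2 e, 0 < e &
  forall e' (w : RR[i]), 0 <= e' -> e' <= e -> nrm w <= 2 -> Bset s x (lin 1 (e'%:C%C * w) a v).
Proof.
move=> aB; have [j|e e0 eP] := @common_scale 'I_n (fun j e => j \in s ->
    e * (2 * nrm (ev (l j) v)) < nrm (ev (l j) x) - nrm (ev (l j) a - ev (l j) x)).
  have [js|js] := boolP (j \in s); last by exists 1.
  set gap := _ - _; have gap0 : 0 < gap by rewrite subr_gt0 aB.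
  have d0 : 0 < 2 * nrm (ev (l j) v) + 1 by have := nrm_ge0 (ev (l j) v); lra.
  exists (gap / (2 * nrm (ev (l j) v) + 1)) => [|e e0]; first exact: divr_gt0.
  by rewrite ler_pdivlMr // => h _; lra.
exists e => // e' w e'0 e'e w2 j js; rewrite ev_lin mul1r.
have := eP j e e0 (lexx _) js; rewrite ltrBrDr; apply: le_lt_trans.
rewrite addrAC addrC; apply: le_trans (nrmD _ _) _; rewrite lerD2r.
rewrite -mulrA nrm_real ger0_norm //.
apply: ler_pM => //; first exact: nrm_ge0.
by apply: le_trans (nrmM _ _) _; apply: ler_wpM2r => //; exact: nrm_ge0.
Qed.

Section Extend.
Variables (s : seq 'I_n) (i : 'I_n) (R : (RR -> Cspace r) -> radd) (v : Cspace r).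
Hypothesis rP : grpd_rep (MS (i :: s)) R.
Hypothesis vi : ev (l i) v = 1.
Hypothesis R0 : forall q e, ev (l i) q = 0 -> MS s q -> 0 < e -> safe_on s q v e ->
  (R (meridian q v e) : rat) = 0.

Definition off (V : set (Cspace r)) : set (Cspace r) := V `&` [set z | ev (l i) z != 0].

Lemma off_sub x : off (Bset s x) `<=` MS (i :: s).
Proof. by move=> a [aB ai] j; rewrite inE => /orP[/eqP -> //|]; exact: (Bset_sub aB). Qed.

(** If the ball meets the hyperplane of [i] at [h], the four corners around [h] have period zero by
    [R0] and [punctured_potential] applies; otherwise the ball is convex inside the complement. *)
Lemma Bset_potential x : MS s x -> exists F, potential (off (Bset s x)) R F.
Proof.
move=> xS; have [[h [hB hi]]|no] := pselect (exists h, Bset s x h /\ ev (l i) h = 0).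
  have [e e0 eP] := Bset_push v hB.
  have sf : safe_on s h v e.
    move=> j w js w2 d d0 de; have := Bset_sub (eP d w d0 de w2) js.
    by rewrite ev_lin mul1r.
  apply: (@punctured_potential _ _ R (Bset s x) (l i)
    (fun k => lin 1 (e%:C%C * corner k) h v) e rP) => //.
  - exact: Bset_convex.
  - exact: off_sub.
  - move=> k; split; last by rewrite ev_lin hi vi mulr1 mulr0 add0r.
    by apply: eP => //; [exact: ltW|rewrite -(cseg0 (corner k) (corner k)) cseg_bound].
  - by rewrite -(meridian_square rP) // R0 //; exact: Bset_sub hB.
have BS : Bset s x `<=` MS (i :: s).
  move=> a aB; apply: (@off_sub x); split=> //=; apply/eqP => ai; apply: no.
  by exists a.
exists (fun y => R (aseg x y)) => y z g pg.
apply: (convex_potential rP (@Bset_convex s x) BS (Bset_refl xS)).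
by apply: (path_subset _ pg) => ? [].
Qed.

(** If the segment meets the hyperplane, [l_i u] is a real multiple of [b = l_i w]. The crossing
    point is pushed along [v] until [l_i] equals [i d b] with [d > 0]; neither of the two new
    segments then passes through 0. *)
Lemma connect_off x y u w : off (Bset s x `&` Bset s y) u -> off (Bset s x `&` Bset s y) w ->
  exists m, [/\ forall t, off (Bset s x `&` Bset s y) (aseg u m t) &
                forall t, off (Bset s x `&` Bset s y) (aseg m w t)].
Proof.
move=> [[ux uy] ui] [[wx wy] wi].
have Vc a b t : (Bset s x `&` Bset s y) a -> (Bset s x `&` Bset s y) b ->
    (Bset s x `&` Bset s y) (aseg a b t).
  by move=> [a1 a2] [b1 b2]; split; apply: Bset_convex.
have [[t0 t0E]|no] := pselect (exists t, ev (l i) (aseg u w t) = 0); last first.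
  exists u; split=> t; first by rewrite asegxx.
  by split=> /=; [exact: Vc|apply/eqP => e; apply: no; exists t].
have [hx hy] : (Bset s x `&` Bset s y) (aseg u w t0) by exact: Vc.
have [e1 e10 e1P] := Bset_push v hx; have [e2 e20 e2P] := Bset_push v hy.
pose b := ev (l i) w.
have b0 : 0 < nrm b by exact: nrm_gt0.
pose e := Num.min e1 e2.
have e0 : 0 < e by rewrite lt_min e10.
have ee1 : e <= e1 by rewrite ge_min lexx.
have ee2 : e <= e2 by rewrite ge_min lexx orbT.
clearbody e.
pose m := lin 1 (e%:C%C * ((nrm b)^-1%:C%C * ('i%C * b))) (aseg u w t0) v.
have mV : (Bset s x `&` Bset s y) m.
  have w2 : nrm ((nrm b)^-1%:C%C * ('i%C * b)) <= 2.
    rewrite nrm_real gtr0_norm ?invr_gt0 //.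
    have -> : nrm ('i%C * b) = nrm b.
      by case: (b) => [c d]; rewrite /nrm /= !mul0r !mul1r sub0r add0r normrN addrC.
    by rewrite mulVf ?gt_eqF // ler1n.
  by split; [apply: e1P|apply: e2P] => //; exact: ltW.
pose d := e / nrm b; have d0 : 0 < d by exact: divr_gt0.
have mi : ev (l i) m = (0 +i* d)%C * b.
  rewrite ev_lin t0E vi mulr0 add0r mulr1 !mulrA; congr (_ * _).
  by apply/eqP; rewrite eq_complex /= !(mul0r, mulr0, mulr1, subr0, addr0, add0r) oppr0 !eqxx.
have nz (c t : RR) : c != 0 -> (1 - t)%:C%C * (c%:C%C * b) + t%:C%C * ((0 +i* d)%C * b) != 0.
  move=> c0; rewrite !mulrA -mulrDl mulf_neq0 // eq_complex negb_and /=.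
  rewrite !mul0r !mulr0 !subr0 !addr0 !add0r.
  have [->|t1] := eqVneq t 0; first by rewrite subr0 mul1r c0.
  by rewrite [X in _ || X]mulf_neq0 ?orbT // gt_eqF.
have [c c0 uE] : exists2 c : RR, c != 0 & ev (l i) u = c%:C%C * b.
  move: t0E; rewrite ev_aseg -/b.
  have [t1|t1] := eqVneq (clamp t0) 1.
    by rewrite t1 subrr mul0r add0r mul1r => e3; move: b0; rewrite e3 nrm0 ltxx.
  have t2 : 1 - clamp t0 != 0 by rewrite subr_eq0 eq_sym.
  have t2' : (1 - clamp t0)%:C%C != 0 :> RR[i] by rewrite eq_complex /= negb_and t2.
  move=> e3; exists (- (clamp t0 / (1 - clamp t0))).
    rewrite oppr_eq0 mulf_neq0 ?invr_eq0 //; apply: contra_neq ui => t3.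
    move: e3; rewrite t3 subr0 mul0r addr0 mul1r; exact.
  apply: (mulfI t2'); move/eqP: e3; rewrite addr_eq0 => /eqP ->.
  by rewrite mulrA -rmorphM -mulNr -rmorphN; congr (_%:C%C * _); field.
exists m; split=> t; split=> /=; try exact: Vc.
  by rewrite /= ev_aseg uE mi nz.
have -> : ev (l i) (aseg m w t) =
    (1 - (1 - clamp t))%:C%C * (1%:C%C * b) + (1 - clamp t)%:C%C * ((0 +i* d)%C * b).
  by rewrite ev_aseg mi mul1r addrC; congr (_%:C%C * _ + _); rewrite opprB addrC subrK.
by rewrite nz // oner_eq0.
Qed.

Lemma potential_diff x y F F' u w : MS s x -> MS s y ->
  potential (off (Bset s x)) R F -> potential (off (Bset s y)) R F' ->
  off (Bset s x `&` Bset s y) u -> off (Bset s x `&` Bset s y) w ->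
  F u - F' u = F w - F' w.
Proof.
move=> xS yS FP F'P uV wV; have [m [pm mw]] := connect_off uV wV.
have subx : off (Bset s x `&` Bset s y) `<=` off (Bset s x) by move=> ? [[]].
have suby : off (Bset s x `&` Bset s y) `<=` off (Bset s y) by move=> ? [[]].
have p1 := path_aseg pm; have p2 := path_aseg mw.
have a1 := FP _ _ _ (path_subset subx p1); have a2 := FP _ _ _ (path_subset subx p2).
have b1 := F'P _ _ _ (path_subset suby p1); have b2 := F'P _ _ _ (path_subset suby p2).
by rewrite a1 in b1; rewrite a2 in b2; lra.
Qed.

(* R extends over H_i once its period around H_i vanishes: it then has a
   potential F x on each ball Bset s x, and the differences F x - F y, which
   are constant on overlaps, form a local cocycle on the larger complement. *)
Lemma extend_over : exists2 R', grpd_rep (MS s) R' &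
  forall x L, path (MS (i :: s)) x x L -> R' L = R L.
Proof.
have /choice[F FP] x : exists F, MS s x -> potential (off (Bset s x)) R F.
  have [xS|nx] := pselect (MS s x); last by exists (fun=> 0).
  by have [F FP] := Bset_potential xS; exists F.
have /choice[c cP] (p : Cspace r * Cspace r) : exists d : rat, MS s p.1 -> MS s p.2 ->
    forall w, off (Bset s p.1 `&` Bset s p.2) w -> d = F p.1 w - F p.2 w.
  have [[u uP]|no] := pselect (exists u, off (Bset s p.1 `&` Bset s p.2) u); last first.
    by exists 0 => _ _ w wP; case: no; exists w.
  exists (F p.1 u - F p.2 u) => S1 S2 w wP.
  by apply: (potential_diff S1 S2) => //; exact: FP.
(* The factor 3 makes any two points [a], [b] of [V z] satisfy [Bset s a b]: differences are below,
   and values above, two thirds of [nrm (ev (l j) z)]. *)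
pose V z : set (Cspace r) :=
  [set a | forall j, j \in s -> 3 * nrm (ev (l j) a - ev (l j) z) < nrm (ev (l j) z)].
have VB z a b : V z a -> V z b -> Bset s a b.
  move=> aV bV j js; have := aV j js; have := bV j js.
  have -> : ev (l j) b - ev (l j) a = (ev (l j) b - ev (l j) z) - (ev (l j) a - ev (l j) z).
    by ring.
  have := nrmD (ev (l j) b - ev (l j) z) (- (ev (l j) a - ev (l j) z)).
  have := nrmD (ev (l j) a) (- (ev (l j) a - ev (l j) z)).
  by rewrite nrmN opprB addrCA subrr addr0; lra.
have cev j : continuous (fun a : Cspace r => ev (l j) a : CC).
  by apply: cont_ev; exact: cont_id.
have csub j (z : RR[i]) : continuous (fun a : Cspace r => nrm (ev (l j) a - z)).
  by apply: cont_nrm; apply: cont_addC; [exact: cev|exact: cont_cst].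
have Vn z : MS s z -> nbhs z (V z).
  move=> zS; apply: nbhs_all => j js; apply: nbhs_lt.
  - by apply: cont_mul; [exact: cont_cst|exact: csub].
  - exact: cont_cst.
  - by rewrite subrr nrm0 mulr0; exact: nrm_gt0 (zS j js).
have Bn w z : Bset s z w -> nbhs z [set a | Bset s a w].
  move=> wB; apply: nbhs_all => j js; apply: nbhs_lt; last exact: wB.
    have -> : (fun a => nrm (ev (l j) w - ev (l j) a)) =
        fun a => nrm (ev (l j) a - ev (l j) w).
      by apply/funext => a; rewrite -nrmN opprB.
    exact: csub.
  by apply: cont_nrm; exact: cev.
have wex z : MS s z -> exists2 w, Bset s z w & ev (l i) w != 0.
  move=> zS; have zB := Bset_refl zS; have [zi|zi] := eqVneq (ev (l i) z) 0; last by exists z.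
  have [e e0 eP] := Bset_push v zB; exists (lin 1 (e%:C%C * 1) z v).
    by apply: eP => //; [exact: ltW|rewrite /nrm /= normr1 normr0 addr0 ler1n].
  by rewrite ev_lin zi vi mulr0 add0r !mulr1 eq_complex /= negb_and gt_eqF.
(* One point [w] off the hyperplane lies in the balls of all nearby centres, so the three
   differences in the cocycle rule can be evaluated at the same point. *)
have loc z : MS s z -> exists2 U, nbhs z U & U `<=` V z /\
    cocycle_on (MS s) (fun x y => c (x, y) : radd) U.
  move=> zS; have [w wB wi] := wex z zS.
  exists (V z `&` [set a | Bset s a w]); first by apply: filterI; [exact: Vn|exact: Bn].
  split=> [a []//|a b d [_ aw] [_ bw] [_ dw] aS bS dS].
  by rewrite raddM (cP (a, b) _ _ w) // (cP (b, d) _ _ w) // (cP (a, d) _ _ w) //=; ring.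
have [|R' R'P R'E] := @monodromy _ _ (MS s) (fun x y => c (x, y) : radd).
  by move=> z /loc[U nU [_ cU]]; exists U.
exists R' => // x L pL.
have sub : MS (i :: s) `<=` MS s by move=> z zS j js; apply: zS; rewrite inE js orbT.
have R'P1 := grpd_restrict sub R'P.
(* The frame is given by the value at each point of the potential of its own ball. *)
have := @grpd_local _ _ _ R' R (fun z => - F z z : radd) R'P1 rP.
move=> /(_ _ _ _ _ pL) ->; first by rewrite !raddM raddV; ring.
move=> z zS; have [U nU [UV cU]] := loc z (sub _ zS); exists U => // y y' g pg gU.
rewrite !raddM raddV (R'E _ _ _ _ (path_subset sub pg) cU gU).
have [yS y'S] := path_in pg; have [_ g0 g1 _] := pg.
have yU : U y by rewrite -g0; apply: gU; rewrite lexx ler01.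
have y'U : U y' by rewrite -g1; apply: gU; rewrite lexx ler01.
have yi : ev (l i) y' != 0 by apply: y'S; rewrite mem_head.
rewrite (cP (y, y') _ _ y') /=; [|exact: sub|exact: sub|]; last first.
  split=> //; split; first by apply: VB; exact: UV.
  exact: Bset_refl (sub _ y'S).
rewrite -(clamp_radd rP pg) (FP y _ y y') ?opprK; [by ring|exact: sub|].
have [gc gc0 gc1 gcS] := path_clamp2 pg; split=> // t; split.
  by apply: VB; [exact: UV yU|apply: UV; apply: gU; exact: clamp_itv].
by apply: gcS; rewrite mem_head.
Qed.

End Extend.

(** Subtracting the right multiple of [alphaA l i] kills the period around the first hyperplane of
    the list; the rest extends over it, and the list gets shorter. *)
Lemma span_on s R : uniq s -> grpd_rep (MS s) R -> exists a : 'I_n -> rat,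
  forall x L, path (MS s) x x L -> (R L : rat) = \sum_(j <- s) a j * (alphaA l j L : rat).
Proof.
elim: s R => [|i s IH] R.
  move=> _ rP; exists (fun=> 0) => x L pL; rewrite big_nil.
  have Tc : convex (MS [::]) by [].
  rewrite (convex_seg rP Tc _ pL) //.
  have -> : aseg x x = cst x by apply/funext => t; rewrite asegxx.
  by rewrite (grpd_cst rP).
move=> /andP[iS us] rP.
have [q qi qP] := generic_on l_indep i; have [v vi] := unit_normal l_neq0 i.
have qS : MS s q by move=> j js; apply: qP; apply: contraNneq iS => <-.
have [e e0 sf] := safe_on_ex v qS.
pose m : rat := R (meridian q v e).
have aP : grpd_rep (MS (i :: s)) (alphaA l i).
  by apply: alphaA_rep_on => z zS; apply: zS; rewrite mem_head.
have [aH aM] := aP; have [rH rM] := rP.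
pose R1 g : radd := (R g : rat) - m * (alphaA l i g : rat).
have r1P : grpd_rep (MS (i :: s)) R1.
  split=> [x y g h pg ph gh|x y z g h pg ph].
    by rewrite /R1 (rH x y g h) // (aH x y g h).
  by rewrite /R1 (rM _ _ _ _ _ pg ph) (aM _ _ _ _ _ pg ph) !raddM; ring.
have am : (alphaA l i (meridian q v e) : rat) = 1.
  rewrite /alphaA.
  have -> : (fun t => ev (l i) (meridian q v e t) : CC) = fun t => e%:C%C * square t.
    by apply/funext => t; rewrite /meridian ev_lin qi vi mulr0 add0r mulr1.
  by apply: W_square_scale; rewrite eq_complex /= negb_and gt_eqF.
have [|R' R'P R'E] := extend_over r1P vi.
  move=> q' e' q'i q'S e'0 sf'.
  by rewrite -(meridian_inv r1P vi qi qS e0 sf q'i q'S e'0 sf') /R1 am mulr1 subrr.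
have [a aE] := IH R' us R'P.
exists (fun j => if j == i then m else a j) => x L pL.
have sub : MS (i :: s) `<=` MS s by move=> z zS j js; apply: zS; rewrite inE js orbT.
have := R'E _ _ pL; rewrite (aE _ _ (path_subset sub pL)) /R1 big_cons eqxx => h.
rewrite -[LHS](subrK (m * (alphaA l i L : rat))) -h addrC; congr (_ + _).
by apply: eq_big_seq => j js; case: eqP => // ji; rewrite -ji js in iS.
Qed.

Lemma alphaA_span R : grpd_rep (Mset l) R -> exists a,
  forall x L, path (Mset l) x x L -> (R L : rat) = comb (alphaA l) a L.
Proof.
have -> : Mset l = MS (enum 'I_n).
  apply/seteqP; split=> z zS j; first by move=> _; exact: zS.
  by apply: zS; rewrite mem_enum.
move=> /(span_on (enum_uniq _))[a aE]; exists a => x L pL.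
by rewrite (aE _ _ pL) /comb big_enum.
Qed.

Lemma A_spec : grpd_spec (Mset l) (alphaA l) (flatA l) (lineA l).
Proof.
split.
- exact: alphaA_rep.
- exact: alphaA_span.
- exact: alphaA_indep.
- exact: lineA_lifts.
- exact: flatA_condition.
Qed.

End Span.

(** * Discarding proportional forms *)

Section Reduction.
Context {r : nat}.
Implicit Types (f g : 'I_r -> CC) (z : Cspace r).

Lemma ker_sub f g : (exists z, ev f z != 0) -> (exists z, ev g z != 0) ->
  (forall z, ev f z = 0 -> ev g z = 0) -> exists2 c, c != 0 & forall z, ev g z = c * ev f z.
Proof.
move=> [u u0] [w w0] fg.
have gE z : ev g z = ev g u / ev f u * ev f z.
  have := fg (lin 1 (- (ev f z / ev f u)) z u); rewrite !ev_lin mul1r.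
  rewrite mulNr divfK // subrr => /(_ erefl)/eqP; rewrite mul1r mulNr subr_eq0 => /eqP ->.
  by rewrite mulrAC [_ * ev g u]mulrC mulrAC.
exists (ev g u / ev f u) => //; apply: contraNneq w0 => c0.
by rewrite gE c0 mul0r.
Qed.

Lemma nonzero_ev f : nonzero_form f -> exists z, ev f z != 0.
Proof.
move=> [i fi]; exists (fun k => (k == i)%:R); rewrite /ev (bigD1 i) //= eqxx mulr1 big1 ?addr0 //.
by move=> j /negbTE ->; rewrite mulr0.
Qed.

Lemma reduced_family (A : seq ('I_r -> CC)) : (forall a, a \in A -> nonzero_form a) ->
  exists (n : nat) (l : 'I_n -> 'I_r -> CC),
  [/\ forall i j, i != j -> exists2 z, ev (l i) z = 0 & ev (l j) z != 0,
      forall i, exists z, ev (l i) z != 0 & Mset l = arrangement_complement A].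
Proof.
elim: A => [_|a A IH nzA].
  exists 0%N, (fun=> fun=> 0); split; try by case.
  by apply/seteqP; split=> z // _ [].
have [|n [l [l1 l2 lM]]] := IH; first by move=> b bA; apply: nzA; rewrite inE bA orbT.
have a0 : exists z, ev a z != 0 by apply: nonzero_ev; apply: nzA; rewrite mem_head.
have AE z : arrangement_complement (a :: A) z <-> ev a z != 0 /\ Mset l z.
  rewrite lM; split=> [zA|[za zA] b]; last by rewrite inE => /orP[/eqP -> //|]; exact: zA.
  by split=> [|b bA]; apply: zA; rewrite ?mem_head // inE bA orbT.
have [[i iP]|no] := pselect (exists i, forall z, ev (l i) z = 0 -> ev a z = 0).
  exists n, l; split=> //; apply/seteqP; split=> z.
    move=> zM; apply/AE; split=> //; have [c c0 ->] := ker_sub (l2 i) a0 iP.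
    by rewrite mulf_neq0 ?c0 //; exact: zM.
  by move=> /AE[].
have no1 i : exists2 z, ev (l i) z = 0 & ev a z != 0.
  apply: contrapT => no1; apply: no; exists i => z zi; apply/eqP/negPn/negP => za.
  by apply: no1; exists z.
have no2 i : exists2 z, ev a z = 0 & ev (l i) z != 0.
  apply: contrapT => no2; have [|c c0 cE] := ker_sub a0 (l2 i).
    by move=> z za; apply/eqP/negPn/negP => zi; apply: no2; exists z.
  have [z zi za] := no1 i; move: zi; rewrite cE => /eqP.
  by rewrite mulf_eq0 (negbTE c0) (negbTE za).
exists n.+1, (fun k => if unlift ord0 k is Some j then l j else a); split.
- move=> i j; case: unliftP => [i' ->|->]; case: unliftP => [j' ->|->] // ij.
  + by apply: l1; apply: contraNneq ij => ->.
- by move=> i; case: unliftP => [i' _|_].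
- apply/seteqP; split=> z; last first.
    by move=> /AE[za zM] j; case: unliftP => [j' _|_] //; exact: zM.
  move=> zM; apply/AE; split; first by have := zM ord0; rewrite unlift_none.
  by move=> j; have := zM (lift ord0 j); rewrite liftK.
Qed.

End Reduction.

(** * Resonance of the non-Pappus matroid *)

(** At most one line carries a nonzero Pluecker coordinate. Each relation is taken on four elements
    for which one or two products of line coordinates survive; where two survive, the other one
    vanishes by an earlier step, which dictates the order. *)
Lemma plucker_lines (w : nat -> nat -> rat) (c : nat -> rat) :
  (forall i j, w j i = - w i j) ->
  (forall i j k m, w i j * w k m - w i k * w j m + w i m * w j k = 0) ->
  (forall t, t \in pair_table -> w t.1 t.2 = 0) ->
  (forall k, (k < 8)%N -> let t := nth (0, 0, 0)%N line_table k in
    [/\ w t.1.1 t.1.2 = c k, w t.1.2 t.2 = c k & w t.2 t.1.1 = c k]) ->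
  forall x y, (x < y < 8)%N -> c x * c y = 0.
Proof.
move=> wN plk HP HL.
have ln k : (k < 8)%N -> let t := nth (0, 0, 0)%N line_table k in
    [/\ w t.1.1 t.1.2 = c k, w t.1.2 t.2 = c k, w t.2 t.1.1 = c k &
    [/\ w t.1.2 t.1.1 = - c k, w t.2 t.1.2 = - c k & w t.1.1 t.2 = - c k]].
  move=> k8 t; have [h1 h2 h3] := HL k k8.
  by do 2!split=> //; rewrite wN; [rewrite h1|rewrite h2|rewrite h3].
have [/= f01 f02 f03 [f04 f05 f06]] := ln 0 isT.
have [/= f11 f12 f13 [f14 f15 f16]] := ln 1 isT.
have [/= f21 f22 f23 [f24 f25 f26]] := ln 2 isT.
have [/= f31 f32 f33 [f34 f35 f36]] := ln 3 isT.
have [/= f41 f42 f43 [f44 f45 f46]] := ln 4 isT.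
have [/= f51 f52 f53 [f54 f55 f56]] := ln 5 isT.
have [/= f61 f62 f63 [f64 f65 f66]] := ln 6 isT.
have [/= f71 f72 f73 [f74 f75 f76]] := ln 7 isT.
have e03 : w 0 3 = 0 := HP (0, 3)%N isT.
have e08 : w 0 8 = 0 := HP (0, 8)%N isT.
have e14 : w 1 4 = 0 := HP (1, 4)%N isT.
have e17 : w 1 7 = 0 := HP (1, 7)%N isT.
have e25 : w 2 5 = 0 := HP (2, 5)%N isT.
have e26 : w 2 6 = 0 := HP (2, 6)%N isT.
have e38 : w 3 8 = 0 := HP (3, 8)%N isT.
have e47 : w 4 7 = 0 := HP (4, 7)%N isT.
have e56 : w 5 6 = 0 := HP (5, 6)%N isT.
have e67 : w 6 7 = 0 := HP (6, 7)%N isT.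
have e68 : w 6 8 = 0 := HP (6, 8)%N isT.
have e78 : w 7 8 = 0 := HP (7, 8)%N isT.
have z23 : c 2 * c 3 = 0.
  by move: (plk 0 1 6 7); rewrite f01 e67 f11 e17 f21 f31; clear; lra.
have z14 : c 1 * c 4 = 0.
  by move: (plk 0 1 6 8); rewrite f01 e68 f11 f41 e08 f31; clear; lra.
have z24 : c 2 * c 4 = 0.
  by move: (plk 0 1 7 8); rewrite f01 e78 f21 f41 e08 e17; clear; lra.
have z15 : c 1 * c 5 = 0.
  by move: (plk 0 2 6 7); rewrite f06 e67 f11 f51 f21 e26; clear; lra.
have z16 : c 1 * c 6 = 0.
  by move: (plk 0 2 6 8); rewrite f06 e68 f11 f61 e08 e26; clear; lra.
have z26 : c 2 * c 6 = 0.
  by move: (plk 0 2 7 8); rewrite f06 e78 f21 f61 e08 f51; clear; lra.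
have z27 : c 2 * c 7 = 0.
  by move: (plk 0 3 4 7) z15; rewrite e03 e47 f16 f55 f21 f71; clear; lra.
have z17 : c 1 * c 7 = 0.
  by move: (plk 0 3 5 6) z23; rewrite e03 e56 f26 f35 f11 f76; clear; lra.
have z25 : c 2 * c 5 = 0.
  by move: (plk 0 3 5 7) z27; rewrite e03 f25 f26 f55 f21 f76; clear; lra.
have z12 : c 1 * c 2 = 0.
  by move: (plk 0 4 5 6) z17; rewrite f16 e56 f26 f15 f11 f72; clear; lra.
have z35 : c 3 * c 5 = 0.
  by move: (plk 1 2 6 7); rewrite f02 e67 f31 f51 e17 e26; clear; lra.
have z36 : c 3 * c 6 = 0.
  by move: (plk 1 2 6 8); rewrite f02 e68 f31 f61 f41 e26; clear; lra.
have z45 : c 4 * c 5 = 0.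
  by move: (plk 1 2 7 8); rewrite f02 e78 e17 f61 f41 f51; clear; lra.
have z47 : c 4 * c 7 = 0.
  by move: (plk 1 3 4 8) z36; rewrite f36 f65 e14 e38 f41 f71; clear; lra.
have z34 : c 3 * c 4 = 0.
  by move: (plk 1 3 5 8) z47; rewrite f36 f45 f46 e38 f41 f76; clear; lra.
have z37 : c 3 * c 7 = 0.
  by move: (plk 1 4 5 6) z14; rewrite e14 e56 f46 f15 f31 f72; clear; lra.
have z46 : c 4 * c 6 = 0.
  by move: (plk 1 4 5 8) z47; rewrite e14 f45 f46 f65 f41 f72; clear; lra.
have z57 : c 5 * c 7 = 0.
  by move: (plk 2 3 5 7) z25; rewrite f56 f25 e25 f55 f51 f76; clear; lra.
have z67 : c 6 * c 7 = 0.
  by move: (plk 2 3 5 8) z45; rewrite f56 f45 e25 e38 f61 f76; clear; lra.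
have z56 : c 5 * c 6 = 0.
  by move: (plk 2 3 7 8); rewrite f56 e78 f51 e38 f61 f55; clear; lra.
have z07 : c 0 * c 7 = 0.
  by move: (plk 0 1 3 5) z23; rewrite f01 f76 e03 f46 f26 f36; clear; lra.
have z05 : c 0 * c 5 = 0.
  by move: (plk 0 1 3 7) z23; rewrite f01 f55 e03 e17 f21 f36; clear; lra.
have z06 : c 0 * c 6 = 0.
  by move: (plk 0 1 4 8) z14; rewrite f01 f65 f16 f41 e08 e14; clear; lra.
have z02 : c 0 * c 2 = 0.
  by move: (plk 0 1 5 7) z24; rewrite f01 f25 f26 e17 f21 f46; clear; lra.
have z04 : c 0 * c 4 = 0.
  by move: (plk 0 1 5 8) z24; rewrite f01 f45 f26 f41 e08 f46; clear; lra.
have z03 : c 0 * c 3 = 0.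
  by move: (plk 0 2 3 6) z15; rewrite f06 f35 e03 e26 f11 f56; clear; lra.
have z01 : c 0 * c 1 = 0.
  by move: (plk 0 2 4 6) z16; rewrite f06 f15 f16 e26 f11 f66; clear; lra.
have z13 : c 1 * c 3 = 0.
  by move: (plk 0 3 4 6) z17; rewrite e03 f15 f16 f35 f11 f71; clear; lra.
move=> x y /andP[xy y8]; have x8 := ltn_trans xy y8; move: x y x8 y8 xy.
move=> [|[|[|[|[|[|[|[|x]]]]]]]] [|[|[|[|[|[|[|[|y]]]]]]]] x8 y8 xy; try discriminate.
- exact: z01.
- exact: z02.
- exact: z03.
- exact: z04.
- exact: z05.
- exact: z06.
- exact: z07.
- exact: z12.
- exact: z13.
- exact: z14.
- exact: z15.
- exact: z16.
- exact: z17.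
- exact: z23.
- exact: z24.
- exact: z25.
- exact: z26.
- exact: z27.
- exact: z34.
- exact: z35.
- exact: z36.
- exact: z37.
- exact: z45.
- exact: z46.
- exact: z47.
- exact: z56.
- exact: z57.
- exact: z67.
Qed.

(** * Planes of sum-zero vectors *)

Definition balanced {I : finType} (X : {set I}) (v : I -> rat) : Prop :=
  (forall i, i \notin X -> v i = 0) /\ \sum_i v i = 0.

Section Balanced.
Local Open Scope set_scope.
Context {I : finType}.
Implicit Types (X Y Z : {set I}) (u v w x y z : I -> rat).

Lemma balanced_lin X u v (c d : rat) : balanced X u -> balanced X v ->
  balanced X (fun i => c * u i + d * v i).
Proof.
move=> [u0 us] [v0 vs]; split=> [i iX|]; first by rewrite u0 // v0 // !mulr0 addr0.
by rewrite big_split /= -!mulr_sumr us vs !mulr0 addr0.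
Qed.

Lemma delta_sum (i k : I) : \sum_j delta i k j = 0.
Proof.
have one (m : I) : \sum_j (j == m)%:R = 1 :> rat.
  by rewrite (bigD1 m) //= eqxx big1 ?addr0 // => j /negbTE ->.
by rewrite sumrB !one subrr.
Qed.

Lemma delta_balanced X (i k : I) : i \in X -> k \in X -> balanced X (delta i k).
Proof.
move=> iX kX; split=> [j jX|]; last exact: delta_sum.
by rewrite /delta; case: eqP jX => [->|_]; rewrite ?iX //; case: eqP => [->|_ _]; rewrite ?kX ?subrr.
Qed.

Lemma balanced_eq0 X v i : balanced X v -> (forall j, j \in X -> j != i -> v j = 0) ->
  forall j, v j = 0.
Proof.
move=> [v0 vs] vi; have vi' j : j != i -> v j = 0.
  by move=> ji; have [jX|/v0 //] := boolP (j \in X); exact: vi.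
move=> j; have [->|/vi' //] := eqVneq j i.
by move: vs; rewrite (bigD1 i) //= big1 ?addr0.
Qed.

Lemma balancedI X Y v : (forall a b, a \in X -> a \in Y -> b \in X -> b \in Y -> a = b) ->
  balanced X v -> balanced Y v -> forall i, v i = 0.
Proof.
move=> XY vX vY i; apply/eqP; apply: contraT => vi.
have iX : i \in X by apply: contraNT vi => /vX.1 ->.
have iY : i \in Y by apply: contraNT vi => /vY.1 ->.
move: vi; rewrite (balanced_eq0 (i := i) vX) ?eqxx // => j jX ji; apply: vY.1.
by apply: contraNN ji => jY; apply/eqP; apply: XY.
Qed.

(** The coefficients come from Cramer's rule at [i] and [j]. The difference then vanishes at two of
    at most three elements, and its sum is zero. *)
Lemma balanced_span X u v w i j : (#|X| <= 3)%N -> balanced X u -> balanced X v ->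
  balanced X w -> u i * v j - u j * v i != 0 ->
  exists c d, forall k, w k = c * u k + d * v k.
Proof.
move=> X3 uX vX wX D.
have nz k : k \notin X -> u k = 0 /\ v k = 0 by move=> kX; rewrite uX.1 // vX.1.
have iX : i \in X.
  by apply: contraNT D => /nz[-> ->]; rewrite mul0r mulr0 subrr.
have jX : j \in X.
  by apply: contraNT D => /nz[-> ->]; rewrite mul0r mulr0 subrr.
have ij : i != j by apply: contraNneq D => ->; rewrite subrr.
set om := _ - _ in D.
pose c := (w i * v j - w j * v i) / om; pose d := (u i * w j - u j * w i) / om.
exists c, d => k; apply/eqP; rewrite -subr_eq0; apply/eqP.
have b1 := balanced_lin 1 (-1) wX (balanced_lin c d uX vX).
have -> : w k - (c * u k + d * v k) = 1 * w k + -1 * (c * u k + d * v k) by ring.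
have ei : 1 * w i + -1 * (c * u i + d * v i) = 0 by rewrite /c /d /om; field.
have ej : 1 * w j + -1 * (c * u j + d * v j) = 0 by rewrite /c /d /om; field.
have [->//|ki] := eqVneq k i; have [->//|kj] := eqVneq k j.
have [kX|/b1.1 //] := boolP (k \in X).
apply: (balanced_eq0 (i := k) b1) => m mX mk.
have [->//|mi] := eqVneq m i; have [->//|mj] := eqVneq m j.
have us : uniq [:: i; j; k; m].
  by rewrite /= !inE !negb_or ij !(eq_sym i) ki mi !(eq_sym j) kj mj (eq_sym k) mk.
have : (#|[:: i; j; k; m]| <= #|X|)%N.
  by apply: subset_leq_card; apply/fintype.subsetP => a; rewrite !inE => /or4P[] /eqP ->.
by rewrite (card_uniqP us) => /leq_trans/(_ X3).
Qed.

(** A nonzero sum-zero [x] has two elements in its support. Each is in [Y] or [Z], and neither set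
    can take both, so one is in [Y] and the other in [Z]. *)
Lemma triangle_support X Y Z x y z :
  (forall a b, a \in X -> a \in Y -> b \in X -> b \in Y -> a = b) ->
  (forall a b, a \in X -> a \in Z -> b \in X -> b \in Z -> a = b) ->
  balanced X x -> balanced Y y -> balanced Z z -> (forall i, x i + y i + z i = 0) ->
  (exists i, x i != 0) ->
  (exists2 a, a \in X & a \in Y) /\ forall d, d \in X -> d \in Y -> d \in Z -> False.
Proof.
move=> XY XZ xX yY zZ s [a xa].
have [b xb ba] : exists2 b, x b != 0 & b != a.
  apply: contrapT => no; move: xa; rewrite (balanced_eq0 (i := a) xX) ?eqxx // => b _ ba.
  by apply/eqP/negPn/negP => xb; apply: no; exists b.
have inX c : x c != 0 -> c \in X by apply: contraNT => /xX.1 ->.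
have inYZ c : x c != 0 -> (c \in Y) || (c \in Z).
  apply: contraNT; rewrite negb_or => /andP[/yY.1 e1 /zZ.1 e2].
  by have := s c; rewrite e1 e2 !addr0 => ->.
have aX := inX _ xa; have bX := inX _ xb.
suff [c [d [cX cY dX dZ cd]]] : exists c d, [/\ c \in X, c \in Y, d \in X, d \in Z & c != d].
  split=> [|m mX mY mZ]; first by exists c.
  by move/eqP: cd; apply; rewrite -(XY m c mX mY cX cY) (XZ m d mX mZ dX dZ).
case/orP: (inYZ _ xa) => ha; case/orP: (inYZ _ xb) => hb.
- by move: ba; rewrite (XY a b aX ha bX hb) eqxx.
- by exists a, b; split=> //; rewrite eq_sym.
- by exists b, a.
- by move: ba; rewrite (XZ a b aX ha bX hb) eqxx.
Qed.

End Balanced.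

Section QSide.
Local Open Scope set_scope.

Definition lineset (k : nat) : {set 'I_9} := [set e : 'I_9 | (e : nat) \in nth [::] flat_table k].

Lemma flat_table_wf : all (fun t => uniq t && all (fun m => m < 9)%N t) flat_table.
Proof. by vm_compute. Qed.

Lemma line_tableE k : (k < 8)%N -> let t := nth (0, 0, 0)%N line_table k in
  nth [::] flat_table k = [:: t.1.1; t.1.2; t.2].
Proof. by case: k => [|[|[|[|[|[|[|[|k]]]]]]]]. Qed.

Lemma pair_line : all (fun i => all (fun j => [|| i == j, (i, j) \in pair_table,
  (j, i) \in pair_table | has (fun k => (i \in nth [::] flat_table k) &&
    (j \in nth [::] flat_table k)) (iota 0 8)]) (iota 0 9)) (iota 0 9).
Proof. by vm_compute. Qed.

Lemma lineset_flat k : (k < 8)%N -> lineset k \in flats.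
Proof.
move=> k8; apply/mapP; exists (nth [::] flat_table k) => //.
by apply: mem_nth; rewrite size_cat size_map; apply: leq_trans k8 (leq_addr _ _).
Qed.

(** The minors [w] vanish except on one line. The identity
    [f m * w i j = f i * w m j - f j * w m i], valid for [a] and [b], kills the entries off this
    line, and the flat condition at [i] and [j] kills the sums. *)
Lemma Q_local (a b : 'I_9 -> rat) : flat_condition (fun X => X \in flats) a b ->
  (exists i j, a i * b j - a j * b i != 0) ->
  exists2 k, (k < 8)%N & balanced (lineset k) a /\ balanced (lineset k) b.
Proof.
move=> fc nz.
pose A i := a (inord i); pose B i := b (inord i).
pose w i j := A i * B j - A j * B i.
have wN i j : w j i = - w i j by rewrite /w; ring.
have plk i j k m : w i j * w k m - w i k * w j m + w i m * w j k = 0 by rewrite /w; ring.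
have FC t i : t \in flat_table -> i \in t -> \sum_(m <- t) w m i = 0.
  move=> tF it; have /andP[ut /allP t9] := allP flat_table_wf t tF.
  have it' : inord i \in [set e : 'I_9 | (e : nat) \in t] by rewrite inE inordK ?t9.
  have tF' : [set e : 'I_9 | (e : nat) \in t] \in flats by apply: map_f.
  have sE (f : 'I_9 -> rat) : \sum_(j in [set e : 'I_9 | (e : nat) \in t]) f j =
      \sum_(m <- t) f (inord m).
    rewrite -(big_map (fun m => inord m : 'I_9) xpredT) big_uniq.
      apply: eq_bigl => e; rewrite inE; apply/idP/mapP => [et|[m mt ->]].
        by exists (e : nat) => //; rewrite inord_val.
      by rewrite inordK ?t9.
    rewrite map_inj_in_uniq // => x y xt yt e.
    by rewrite -(@inordK 8 x) ?t9 // -(@inordK 8 y) ?t9 // e.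
  have := fc _ _ tF' it'; rewrite !sE !mulr_suml => h.
  rewrite /w sumrB h -sumrB big1 // => m _; rewrite /A /B; ring.
have HP t : t \in pair_table -> w t.1 t.2 = 0.
  move=> tP; have tF : [:: t.1; t.2] \in flat_table.
    by rewrite mem_cat; apply/orP; right; apply: (map_f (fun t => [:: t.1; t.2])).
  have := FC _ t.2 tF; rewrite !inE eqxx orbT => /(_ isT).
  by rewrite !big_cons big_nil /w => <-; ring.
pose c k := let t := nth (0, 0, 0)%N line_table k in w t.1.1 t.1.2.
have HL k : (k < 8)%N -> let t := nth (0, 0, 0)%N line_table k in
    [/\ w t.1.1 t.1.2 = c k, w t.1.2 t.2 = c k & w t.2 t.1.1 = c k].
  move=> k8 t; have tF : [:: t.1.1; t.1.2; t.2] \in flat_table.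
    rewrite mem_cat; apply/orP; left; apply: (map_f (fun t => [:: t.1.1; t.1.2; t.2])).
    exact: mem_nth.
  have := FC _ t.1.1 tF; have := FC _ t.1.2 tF.
  rewrite !big_cons !big_nil !addr0 !inE !eqxx !orbT => /(_ isT) + /(_ isT); rewrite /c -/t.
  have w0 i : w i i = 0 by rewrite /w subrr.
  rewrite !w0 (wN t.1.1 t.1.2) (wN t.1.2 t.2).
  by move: (w _ _) (w _ _) (w _ _) => x y z h1 h2; split; lra.
have cc x y : (x < 8)%N -> (y < 8)%N -> c x != 0 -> c y != 0 -> x = y.
  move=> x8 y8 cx cy; apply/eqP; apply: contraT; rewrite neq_ltn.
  have P u v : (u < v < 8)%N -> c u * c v = 0 := plucker_lines wN plk HP HL (x := u) (y := v).
  case/orP => h.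
    by move: (mulf_neq0 cx cy); rewrite P ?h ?y8 ?eqxx.
  by move: (mulf_neq0 cy cx); rewrite P ?h ?x8 ?eqxx.
have find (i j : 'I_9) : w i j != 0 -> exists k, [/\ (k < 8)%N, i \in lineset k,
    j \in lineset k & c k != 0].
  have o9 (e : 'I_9) : (e : nat) \in iota 0 9 by rewrite mem_iota ltn_ord.
  move=> wij; have := allP (allP pair_line _ (o9 i)) _ (o9 j).
  case/or4P=> [/eqP ij|/HP /= h|/HP /= h|].
  - by rewrite ij /w subrr eqxx in wij.
  - by rewrite h eqxx in wij.
  - by rewrite wN h oppr0 eqxx in wij.
  move=> /hasP[k]; rewrite mem_iota => k8 /andP[ik jk].
  exists k; rewrite !inE ik jk; split=> //.
  apply: contraNneq wij => ck; have [] := HL k k8; rewrite ck => h1 h2 h3.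
  move: ik jk; rewrite (line_tableE k8); set t := nth _ _ _ in h1 h2 h3 *.
  rewrite !inE => /or3P[]/eqP -> /or3P[]/eqP ->; rewrite ?h1 ?h2 ?h3 //;
    by [rewrite /w subrr|rewrite wN ?h1 ?h2 ?h3 oppr0].
have wE (i j : 'I_9) : a i * b j - a j * b i = w i j by rewrite /w /A /B !inord_val.
have [i [j]] := nz; rewrite wE => wij; have [k [k8 ik jk ck]] := find i j wij.
have off m : m \notin lineset k -> w m i = 0 /\ w m j = 0.
  move=> mk; split; apply/eqP; apply: contraNT mk => /find[k' [k'8 mk' _ ck']];
    by rewrite (cc k k').
have zero (f : 'I_9 -> rat) : (forall m, f m * w i j = f i * w m j - f j * w m i) ->
    forall m, m \notin lineset k -> f m = 0.
  move=> fE m /off[w1 w2]; have := fE m; rewrite w1 w2 !mulr0 subrr => /eqP.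
  by rewrite mulf_eq0 (negbTE wij) orbF => /eqP.
have za := zero a; have zb := zero b.
have {}za m : m \notin lineset k -> a m = 0.
  by apply: za => m'; rewrite -!wE; ring.
have {}zb m : m \notin lineset k -> b m = 0.
  by apply: zb => m'; rewrite -!wE; ring.
have sumE (f : 'I_9 -> rat) : (forall m, m \notin lineset k -> f m = 0) ->
    \sum_(m in lineset k) f m = \sum_m f m.
  move=> f0; rewrite [RHS](bigID (fun m => m \in lineset k)) /= [X in _ + X]big1 ?addr0 //.
have fi := fc _ _ (lineset_flat k8) ik; have fj := fc _ _ (lineset_flat k8) jk.
rewrite !sumE // in fi fj.
exists k => //; split; split=> //.
  apply/eqP; have : (\sum_m a m) * w i j == 0.
    by rewrite -wE mulrBr !mulrA mulrAC fj [X in _ - X]mulrAC fi; apply/eqP; ring.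
  by rewrite mulf_eq0 (negbTE wij) orbF.
apply/eqP; have : (\sum_m b m) * w i j == 0.
  rewrite -wE mulrBr mulrA -fi mulrA -fj; apply/eqP; ring.
by rewrite mulf_eq0 (negbTE wij) orbF.
Qed.

End QSide.

(** * Recovering a non-Pappus configuration inside the arrangement *)

Section Matroid.
Local Open Scope set_scope.

Definition line_nth k := nth [::] flat_table k.

Lemma line_nth_flat k : (k < 8)%N -> line_nth k \in flat_table.
Proof.
by move=> k8; apply: mem_nth; rewrite size_cat size_map; apply: leq_trans k8 (leq_addr _ _).
Qed.

Definition triangle (k1 k2 k3 i j m : nat) : bool :=
  [&& [&& i \in line_nth k1, i \in line_nth k2, j \in line_nth k2, j \in line_nth k3,
          m \in line_nth k1 & m \in line_nth k3], uniq [:: i; j; m] & uniq [:: k1; k2; k3]].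

Lemma line_meet : all (fun k => all (fun k' => (k == k') || all (fun i => all (fun j =>
  [|| i == j, i \notin line_nth k' | j \notin line_nth k']) (line_nth k)) (line_nth k))
  (iota 0 8)) (iota 0 8).
Proof. by vm_compute. Qed.

(** Makes incidence transportable: a meeting pair of lines is completed to a triangle, whose sides
    give a linear relation between the three planes. *)
Lemma meet_triangle : all (fun k => all (fun k' => [|| k == k',
  ~~ has (fun i => i \in line_nth k') (line_nth k) |
  has (fun k'' => has (fun i => has (fun j => has (fun m => triangle k k' k'' i j m)
    (line_nth k)) (line_nth k'')) (line_nth k)) (iota 0 8)]) (iota 0 8)) (iota 0 8).
Proof. by vm_compute. Qed.

Lemma edge_triangle : all (fun k => all (fun i => all (fun j => (i == j) ||
  has (fun k1 => has (fun k2 => has (fun m => triangle k k1 k2 i m j)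
    (line_nth k1)) (iota 0 8)) (iota 0 8)) (line_nth k)) (line_nth k)) (iota 0 8).
Proof. by vm_compute. Qed.

(** Serves to separate the images of [i] and [j]: when no line joins them, [j] is compared with a
    point [f] where a line through [j] crosses a line through [i]. *)
Lemma apart : all (fun i => all (fun j => [|| i == j,
  has (fun k => (i \in line_nth k) && (j \in line_nth k)) (iota 0 8) |
  has (fun k => has (fun k' => has (fun f => [&& k != k', i \in line_nth k, j \in line_nth k',
    f \in line_nth k' & f != j]) (line_nth k)) (iota 0 8)) (iota 0 8)])
  (iota 0 9)) (iota 0 9).
Proof. by vm_compute. Qed.

(** Every line misses 6 or 7, expressed by incidences that survive transport: the missed element [e]
    is joined to a point [f] of line [k] by another line. *)
Lemma not_on_both : all (fun k => has (fun e => has (fun k' => has (fun f =>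
  [&& k != k', e \in line_nth k', f \in line_nth k' & f != e]) (line_nth k)) (iota 0 8))
  [:: 6; 7]%N) (iota 0 8).
Proof. by vm_compute. Qed.

Definition lines_at (e : nat) := [seq k <- iota 0 8 | e \in line_nth k].

Lemma size_lines_at : all (fun e => size (lines_at e) \in [:: 2; 3]%N) (iota 0 9).
Proof. by vm_compute. Qed.

Lemma lineset_meet k k' : (k < 8)%N -> (k' < 8)%N -> k != k' -> forall a b,
  a \in lineset k -> a \in lineset k' -> b \in lineset k -> b \in lineset k' -> a = b.
Proof.
move=> k8 k'8 kk' a b; rewrite !inE => ak ak' bk bk'.
have h8 m : (m < 8)%N -> m \in iota 0 8 by rewrite mem_iota.
have := allP (allP line_meet _ (h8 _ k8)) _ (h8 _ k'8).
rewrite (negbTE kk') => /allP/(_ _ ak)/allP/(_ _ bk); rewrite ak' bk' !orbF => /eqP.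
exact: val_inj.
Qed.

Lemma lineset_card k : (k < 8)%N -> (#|lineset k| <= 3)%N.
Proof.
move=> k8; set t := nth (0, 0, 0)%N line_table k.
apply: leq_trans (_ : #|[:: inord t.1.1; inord t.1.2; inord t.2 : 'I_9]| <= 3)%N; last first.
  exact: card_size.
apply: subset_leq_card; apply/fintype.subsetP => e; rewrite inE (line_tableE k8) -/t !inE.
by case/or3P => /eqP <-; rewrite inord_val eqxx ?orbT.
Qed.

Context {J : finType} (flat : {set J} -> Prop) (col : J -> J -> J -> Prop).
Variables (M : J -> 'I_9 -> rat) (N : 'I_9 -> J -> rat).
Hypothesis MN : forall j j', \sum_i M j i * N i j' = (j == j')%:R.
Hypothesis NM : forall i i', \sum_j N i j * M j i' = (i == i')%:R.
Definition mapM (v : J -> rat) i := \sum_j v j * M j i.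
Definition mapN (u : 'I_9 -> rat) j := \sum_i u i * N i j.
Hypothesis Mline : forall a b c, col a b c ->
  flat_condition (fun X => X \in flats) (mapM (delta a c)) (mapM (delta b c)).
Hypothesis Nline : forall a b c, (a, b, c) \in lines ->
  flat_condition flat (mapN (delta a c)) (mapN (delta b c)).
Hypothesis col_flat : forall u v, u != v -> exists2 F, flat F &
  forall w, w \in F <-> [\/ w = u, w = v | col u v w].
Hypothesis col_rot : forall a b c, col a b c -> col b c a.
Hypothesis col_swap : forall a b c, col a b c -> col b a c.
Hypothesis col_neq : forall a b c, a != b -> col a b c -> c != a.
Hypothesis pappus : forall p : nat -> J,
  (forall i j, (i < 9)%N -> (j < 9)%N -> i != j -> p i != p j) ->
  (forall t, t \in line_table -> col (p t.1.1) (p t.1.2) (p t.2)) ->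
  col (p 6) (p 7) (p 8).

Lemma mapNM v j : mapN (mapM v) j = v j.
Proof.
rewrite /mapN /mapM; under eq_bigr => i _ do rewrite mulr_suml.
rewrite exchange_big /=; under eq_bigr => k _ do under eq_bigr => i _ do rewrite -mulrA.
under eq_bigr => k _ do rewrite -mulr_sumr MN.
by rewrite (bigD1 j) //= eqxx mulr1 big1 ?addr0 // => k /negbTE ->; rewrite mulr0.
Qed.

Lemma mapMN u i : mapM (mapN u) i = u i.
Proof.
rewrite /mapN /mapM; under eq_bigr => j _ do rewrite mulr_suml.
rewrite exchange_big /=; under eq_bigr => k _ do under eq_bigr => j _ do rewrite -mulrA.
under eq_bigr => k _ do rewrite -mulr_sumr NM.
by rewrite (bigD1 i) //= eqxx mulr1 big1 ?addr0 // => k /negbTE ->; rewrite mulr0.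
Qed.

Lemma mapM_lin c d u v i :
  mapM (fun j => c * u j + d * v j) i = c * mapM u i + d * mapM v i.
Proof. by rewrite /mapM !mulr_sumr -big_split; apply: eq_bigr => j _ /=; ring. Qed.

Lemma mapN_lin c d u v j :
  mapN (fun i => c * u i + d * v i) j = c * mapN u j + d * mapN v j.
Proof. by rewrite /mapN !mulr_sumr -big_split; apply: eq_bigr => i _ /=; ring. Qed.

Lemma eq_mapM u v i : (forall j, u j = v j) -> mapM u i = mapM v i.
Proof. by move=> uv; apply: eq_bigr => j _; rewrite uv. Qed.

Lemma eq_mapN u v j : (forall i, u i = v i) -> mapN u j = mapN v j.
Proof. by move=> uv; apply: eq_bigr => i _; rewrite uv. Qed.

Lemma mapM_eq0 v : (forall i, mapM v i = 0) -> forall j, v j = 0.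
Proof.
by move=> h j; rewrite -mapNM /mapN big1 // => i _; rewrite h mul0r.
Qed.

Lemma mapN_eq0 u : (forall j, mapN u j = 0) -> forall i, u i = 0.
Proof.
by move=> h i; rewrite -mapMN /mapM big1 // => j _; rewrite h mul0r.
Qed.

Lemma delta_ne (I : finType) (a b : I) : a != b -> ~ (forall i, delta a b i = 0).
Proof.
by move=> ab /(_ a)/eqP; rewrite /delta eqxx (negbTE ab) subr0 oner_eq0.
Qed.

Lemma minor a b c : a != b -> a != c -> b != c -> exists i j,
  mapM (delta a c) i * mapM (delta b c) j - mapM (delta a c) j * mapM (delta b c) i != 0.
Proof.
move=> ab ac bc; apply: contrapT => no.
have z i j : mapM (delta a c) i * mapM (delta b c) j - mapM (delta a c) j * mapM (delta b c) i = 0.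
  by apply/eqP/negPn/negP => h; apply: no; exists i, j.
have [[j bj]|nb] := pselect (exists j, mapM (delta b c) j != 0); last first.
  apply: (delta_ne bc); apply: mapM_eq0 => i; apply/eqP/negPn/negP => h.
  by apply: nb; exists i.
have h k : mapM (delta b c) j * delta a c k + (- mapM (delta a c) j) * delta b c k = 0.
  move: k; apply: mapM_eq0 => i.
  by rewrite (mapM_lin (mapM (delta b c) j)) mulNr mulrC; exact: z.
have := h a; rewrite {2 4}/delta eqxx (negbTE ab) (negbTE ac) !subr0 mulr1 mulr0 addr0 => e.
by rewrite e eqxx in bj.
Qed.

Lemma balanced3 (a b c : J) (v : J -> rat) : a != b -> a != c -> b != c -> balanced [set a; b; c] v ->
  forall j, v j = v a * delta a c j + v b * delta b c j.
Proof.
move=> ab ac bc vT j; apply/eqP; rewrite -subr_eq0; apply/eqP.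
have aT : a \in [set a; b; c] by rewrite !inE eqxx.
have bT : b \in [set a; b; c] by rewrite !inE eqxx orbT.
have cT : c \in [set a; b; c] by rewrite !inE eqxx !orbT.
have h := balanced_lin 1 (-1) vT
  (balanced_lin (v a) (v b) (delta_balanced aT cT) (delta_balanced bT cT)).
have := balanced_eq0 (i := c) h; rewrite -[X in X = 0]addr0 => /(_ _ j).
rewrite mul1r mulN1r addr0 => -> // k; rewrite !inE => /orP[/orP[]|] /eqP -> //.
- by move=> _; rewrite /delta !eqxx (negbTE ac) (negbTE ab) /=; ring.
- by move=> _; rewrite /delta !eqxx (eq_sym b a) (negbTE ab) (negbTE bc) /=; ring.
- by rewrite eqxx.
Qed.

Definition image k (T : {set J}) := forall v, balanced T v -> balanced (lineset k) (mapM v).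

Lemma eq_balanced (I : finType) (X : {set I}) u v : (forall i, u i = v i) ->
  balanced X v -> balanced X u.
Proof.
move=> uv [v0 vs]; split=> [i iX|]; first by rewrite uv v0.
by rewrite -[RHS]vs; apply: eq_bigr => i _; rewrite uv.
Qed.

Lemma col_distinct a b c : a != b -> col a b c -> a != c /\ b != c.
Proof.
move=> ab h; rewrite eq_sym (col_neq ab h); split=> //.
by rewrite eq_sym (@col_neq b a c) // 1?eq_sym //; exact: col_swap.
Qed.

Lemma col_image a b c : a != b -> col a b c -> exists2 k, (k < 8)%N & image k [set a; b; c].
Proof.
move=> ab abc; have [ac bc] := col_distinct ab abc.
have [k k8 [h1 h2]] := Q_local (Mline abc) (minor ab ac bc).
exists k => // v vT; apply: eq_balanced (balanced_lin (v a) (v b) h1 h2) => i.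
by rewrite -mapM_lin; apply: eq_mapM; exact: balanced3.
Qed.

Lemma image_inj k k' T T' v : (k < 8)%N -> (k' < 8)%N -> image k T -> image k' T' ->
  balanced T v -> balanced T' v -> (exists j, v j != 0) -> k = k'.
Proof.
move=> k8 k'8 kT k'T' vT vT' [j vj]; apply/eqP/negPn/negP => kk'.
move: vj; rewrite (mapM_eq0 (v := v)) ?eqxx //.
exact: balancedI (lineset_meet k8 k'8 kk') (kT _ vT) (k'T' _ vT').
Qed.

(** Two collinear triples through [u] and [v] have planes sharing [delta u v], so both are mapped
    into the plane of one line of the matroid. That plane has dimension two, hence the planes of the
    triples coincide. *)
Lemma col_uniq u v w w' : u != v -> col u v w -> col u v w' -> w = w'.
Proof.
move=> uv h h'; apply/eqP/negPn/negP => ww'.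
have [uw vw] := col_distinct uv h; have [uw' vw'] := col_distinct uv h'.
have [k k8 kT] := col_image uv h; have [k' k'8 k'T] := col_image uv h'.
have iu x : u \in [set u; v; x] by rewrite !inE eqxx.
have iv x : v \in [set u; v; x] by rewrite !inE eqxx orbT.
have ix x : x \in [set u; v; x] by rewrite !inE eqxx !orbT.
have kk' : k = k'.
  apply: (image_inj k8 k'8 kT k'T (delta_balanced (iu _) (iv _)) (delta_balanced (iu _) (iv _))).
  by exists u; rewrite /delta eqxx (negbTE uv) subr0 oner_eq0.
rewrite -kk' in k'T; have [i [j D]] := minor uv uw vw.
have [c [d cd]] := balanced_span (lineset_card k8) (kT _ (delta_balanced (iu _) (ix _)))
  (kT _ (delta_balanced (iv _) (ix _))) (k'T _ (delta_balanced (iu _) (ix _))) D.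
have : delta u w' w' = c * delta u w w' + d * delta v w w'.
  rewrite -[LHS]mapNM -[delta u w w']mapNM -[delta v w w']mapNM -mapN_lin.
  exact: eq_mapN.
rewrite /delta !eqxx !(eq_sym w') (negbTE uw') (negbTE vw') (negbTE ww').
by rewrite !subr0 !mulr0 addr0 sub0r => /eqP; rewrite oppr_eq0 oner_eq0.
Qed.

Lemma image_inv k a b c : (k < 8)%N -> a != b -> a != c -> b != c ->
  image k [set a; b; c] -> forall u, balanced (lineset k) u -> balanced [set a; b; c] (mapN u).
Proof.
move=> k8 ab ac bc kT u uk; have [i [j D]] := minor ab ac bc.
have aT : a \in [set a; b; c] by rewrite !inE eqxx.
have bT : b \in [set a; b; c] by rewrite !inE eqxx orbT.
have cT : c \in [set a; b; c] by rewrite !inE eqxx !orbT.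
have h1 := delta_balanced aT cT; have h2 := delta_balanced bT cT.
have [x [y xy]] := balanced_span (lineset_card k8) (kT _ h1) (kT _ h2) uk D.
apply: eq_balanced (balanced_lin x y h1 h2) => m.
by rewrite (eq_mapN _ xy) mapN_lin !mapNM.
Qed.

Lemma sum_rot (G : J -> J -> J -> rat) :
  \sum_u \sum_v \sum_w G v w u = \sum_u \sum_v \sum_w G u v w.
Proof.
rewrite exchange_big /=; apply: eq_bigr => v _; rewrite exchange_big /=.
by apply: eq_bigr.
Qed.

(* If X_k were not the image of any collinear triple, then the 2-form dual to
   the pair (p, q) of points of X_k would vanish on the image of the 2-form of
   every collinear triple, but these span the 2-forms satisfying the flat
   conditions. *)
Lemma line_preimage k : (k < 8)%N -> exists a b c,
  [/\ a != b, col a b c & image k [set a; b; c]].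
Proof.
move=> k8; apply: contrapT => no.
pose t := nth (0, 0, 0)%N line_table k.
pose p : 'I_9 := inord t.1.1; pose q : 'I_9 := inord t.1.2; pose s : 'I_9 := inord t.2.
have pqs : (p, q, s) \in lines.
  by apply/mapP; exists t => //; exact: mem_nth.
have [pk qk pq ps qs] : [/\ p \in lineset k, q \in lineset k, p != q, p != s & q != s].
  have := allP flat_table_wf (line_nth k); rewrite /line_nth (line_tableE k8) -/t.
  have tF : [:: t.1.1; t.1.2; t.2] \in flat_table.
    rewrite mem_cat; apply/orP; left; apply: (map_f (fun t => [:: t.1.1; t.1.2; t.2])).
    exact: mem_nth.
  move=> /(_ tF) /=; rewrite !inE !negb_or !andbT => /andP[/andP[/andP[h1 h2] h3]].
  move=> /and3P[l1 l2 l3]; rewrite (line_tableE k8) -/t.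
  by rewrite !inE /p /q /s -!(inj_eq val_inj) /= !inordK // !eqxx orbT.
pose a := mapN (delta p s); pose b := mapN (delta q s).
(* [Om] is the 2-form of the plane of line [k] carried to the arrangement, and [D] the minor of [M]
   in the columns [p] and [q]. *)
pose Om u v := a u * b v - a v * b u.
pose D u v := M u p * M v q - M v p * M u q.
have OmN u v : Om v u = - Om u v by rewrite /Om; ring.
have Om_flat F i : flat F -> i \in F -> \sum_(j in F) Om j i = 0.
  move=> Ff iF; have e := Nline pqs Ff iF; rewrite -/a -/b in e.
  by rewrite /Om sumrB -mulr_suml -mulr_sumr e mulrC subrr.
pose C u v w := `[< col u v w >] && (u != v).
have CP u v w : C u v w -> [/\ col u v w, u != v, u != w & v != w].
  by move=> /andP[/asboolP h uv]; have [] := col_distinct uv h.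
have Crot u v w : C u v w = C v w u.
  apply/idP/idP => /CP[h h1 h2 h3]; apply/andP; split=> //; try exact/asboolP/col_rot.
    by apply/asboolP/col_rot/col_rot.
  by rewrite eq_sym.
have OmC u v w : C u v w -> Om u v = Om v w.
  move=> /CP[h uv uw vw]; have [F Ff FE] := col_flat uv.
  have FS : F = [set u; v; w].
    apply/setP => x; rewrite !inE; apply/idP/idP => [/FE[->|->|h']|].
    - by rewrite eqxx.
    - by rewrite eqxx orbT.
    - by rewrite (col_uniq uv h' h) eqxx !orbT.
    - by move=> /orP[/orP[]|] /eqP ->; apply/FE; [exact: Or31|exact: Or32|exact: Or33].
  have := Om_flat F v Ff; rewrite FS !inE eqxx orbT => /(_ isT).
  rewrite -finset.setUA big_setU1 ?inE ?negb_or ?uv //= big_setU1 ?inE //= big_set1.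
  have -> : Om v v = 0 by rewrite /Om subrr.
  by rewrite add0r (OmN v w) => /eqP; rewrite subr_eq0 => /eqP.
have third u v : Om u v != 0 -> exists w, C u v w.
  move=> h; have uv : u != v by apply: contraNneq h => ->; rewrite /Om subrr.
  have [F Ff FE] := col_flat uv.
  apply: contrapT => nw.
  have FS : F = [set u; v].
    apply/setP => x; rewrite !inE; apply/idP/idP => [/FE[->|->|h']|].
    - by rewrite eqxx.
    - by rewrite eqxx orbT.
    - by case: nw; exists x; apply/andP; split=> //; apply/asboolP.
    - by move=> /orP[] /eqP ->; apply/FE; [exact: Or31|exact: Or32].
  have := Om_flat F v Ff; rewrite FS !inE eqxx orbT => /(_ isT).
  rewrite big_setU1 ?inE //= big_set1.
  have -> : Om v v = 0 by rewrite /Om subrr.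
  by rewrite addr0 => h'; rewrite h' eqxx in h.
(* The triple is mapped to a line [k'] other than [k], which contains at most one of [p] and [q], so
   a column of the minor is zero. *)
have DC u v w : C u v w -> D u v + D v w + D w u = 0.
  move=> /CP[h uv uw vw]; have [k' k'8 k'T] := col_image uv h.
  have kk' : k != k' by apply/eqP => e; apply: no; exists u, v, w; rewrite e.
  have iu : u \in [set u; v; w] by rewrite !inE eqxx.
  have iv : v \in [set u; v; w] by rewrite !inE eqxx orbT.
  have iw : w \in [set u; v; w] by rewrite !inE eqxx !orbT.
  have [z1 _] := k'T _ (delta_balanced iu iw); have [z2 _] := k'T _ (delta_balanced iv iw).
  have mE x i : mapM (delta x w) i = M x i - M w i.
    have one (y : J) : \sum_j (j == y)%:R * M j i = M y i.
      by rewrite (bigD1 y) //= eqxx mul1r big1 ?addr0 // => j /negbTE ->; rewrite mul0r.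
    by rewrite /mapM /delta; under eq_bigr => j _ do rewrite mulrBl; rewrite sumrB !one.
  have -> : D u v + D v w + D w u =
      (M u p - M w p) * (M v q - M w q) - (M v p - M w p) * (M u q - M w q) by rewrite /D; ring.
  rewrite -!mE.
  have [pk'|pk'] := boolP (p \in lineset k'); last by rewrite (z1 p) // (z2 p) // !mul0r subrr.
  have qk' : q \notin lineset k'.
    by apply: contraNN pq => qk'; apply/eqP; exact: lineset_meet kk' _ _ pk pk' qk qk'.
  by rewrite (z1 q) // (z2 q) // !mulr0 subrr.
(* Since [Om] is constant along the rotations of a collinear triple, rotating indices spreads the
   pairing over its three sides, where the minors add up to zero. *)
pose S := \sum_u \sum_v Om u v * D u v.
have e1 : S = \sum_u \sum_v \sum_w (if C u v w then Om u v * D u v else 0).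
  apply: eq_bigr => u _; apply: eq_bigr => v _.
  have [z|/third[w Cw]] := eqVneq (Om u v) 0.
    by rewrite z mul0r big1 // => w _; case: ifP.
  rewrite (bigD1 w) //= Cw big1 ?addr0 // => w' w'w; case: ifP => // Cw'.
  have [h uv _ _] := CP _ _ _ Cw; have [h' _ _ _] := CP _ _ _ Cw'.
  by rewrite (col_uniq uv h' h) eqxx in w'w.
have e2 : S = \sum_u \sum_v \sum_w (if C u v w then Om u v * D v w else 0).
  rewrite e1 -sum_rot; apply: eq_bigr => u _; apply: eq_bigr => v _; apply: eq_bigr => w _.
  by rewrite -Crot; case: ifP => // /OmC ->.
have e3 : S = \sum_u \sum_v \sum_w (if C u v w then Om u v * D w u else 0).
  rewrite e2 -sum_rot; apply: eq_bigr => u _; apply: eq_bigr => v _; apply: eq_bigr => w _.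
  by rewrite -Crot; case: ifP => // /OmC ->.
have S0 : S + S + S = 0.
  rewrite {1}e1 {1}e2 {1}e3 -!big_split big1 // => u _ /=; rewrite -!big_split big1 // => v _ /=.
  rewrite -!big_split big1 // => w _ /=; case: ifP => [/DC h|_]; last by rewrite !addr0.
  by rewrite -!mulrDr h mulr0.
have prodE (x y : J -> rat) i j :
    \sum_u \sum_v (x u * y v) * (M u i * M v j) = mapM x i * mapM y j.
  rewrite /mapM mulr_suml; apply: eq_bigr => u _; rewrite mulr_sumr.
  by apply: eq_bigr => v _; ring.
(* As [mapM] undoes [mapN], the pairing is also twice the minor of [delta p s] and [delta q s] at
   [p], [q], which is 1. *)
have S2 : S = (mapM a p * mapM b q - mapM b p * mapM a q) *+ 2.
  rewrite mulr2n -!prodE /S.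
  have -> : \sum_u \sum_v (b u * a v) * (M u p * M v q) =
      \sum_u \sum_v (a u * b v) * (M v p * M u q).
    by rewrite exchange_big; apply: eq_bigr => u _; apply: eq_bigr => v _; ring.
  have e4 : \sum_u \sum_v (a u * b v) * (M u p * M v q) =
      \sum_u \sum_v (a v * b u) * (M v p * M u q).
    by rewrite exchange_big; apply: eq_bigr => u _; apply: eq_bigr => v _; ring.
  have e5 : \sum_u \sum_v (a u * b v) * (M v p * M u q) =
      \sum_u \sum_v (a v * b u) * (M u p * M v q).
    by rewrite exchange_big; apply: eq_bigr => u _; apply: eq_bigr => v _; ring.
  rewrite {2}e4 {2}e5 -!sumrB -big_split; apply: eq_bigr => u _ /=.
  by rewrite -!sumrB -big_split; apply: eq_bigr => v _ /=; rewrite /Om /D; ring.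
move: S0; rewrite S2 /a /b !mapMN /delta (eq_sym q p) !eqxx (negbTE pq) (negbTE ps) (negbTE qs).
by move=> /eqP; vm_compute.
Qed.

Lemma col_set a b c x y z : a != b -> col a b c -> x \in [set a; b; c] ->
  y \in [set a; b; c] -> z \in [set a; b; c] -> x != y -> x != z -> y != z -> col x y z.
Proof.
move=> ab abc; have bac := col_swap abc.
have bca := col_rot abc; have cab := col_rot bca; have acb := col_rot bac; have cba := col_rot acb.
rewrite !inE => /orP[/orP[]|] /eqP -> /orP[/orP[]|] /eqP -> /orP[/orP[]|] /eqP -> //;
  by rewrite ?eqxx.
Qed.

Lemma no_nonpappus : False.
Proof.
have T8 k : exists t : J * J * J, (k < 8)%N -> [/\ t.1.1 != t.1.2, col t.1.1 t.1.2 t.2 &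
    image k [set t.1.1; t.1.2; t.2]].
  case: (ltnP k 8) => [k8|k8].
    by have [a [b [c h]]] := line_preimage k8; exists (a, b, c).
  have [a [b [c _]]] := @line_preimage 0 isT.
  by exists (a, b, c).
have /choice[t tP] := T8.
pose TA k := [set (t k).1.1; (t k).1.2; (t k).2].
have TAinv k : (k < 8)%N -> forall u, balanced (lineset k) u -> balanced (TA k) (mapN u).
  move=> k8; have [ab abc kT] := tP k k8; have [ac bc] := col_distinct ab abc.
  exact: image_inv.
have TAim k : (k < 8)%N -> image k (TA k) by move=> k8; have [] := tP k k8.
have TAmeet k k' a b : (k < 8)%N -> (k' < 8)%N -> k != k' -> a \in TA k -> a \in TA k' ->
    b \in TA k -> b \in TA k' -> a = b.
  move=> k8 k'8 /eqP kk' ak ak' bk bk'; apply/eqP/negPn/negP => ab; apply: kk'.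
  apply: (image_inj k8 k'8 (TAim _ k8) (TAim _ k'8) (v := delta a b));
    [exact: delta_balanced|exact: delta_balanced|].
  by exists a; rewrite /delta eqxx (negbTE ab) subr0 oner_eq0.
have i8 k : (k < 8)%N -> k \in iota 0 8 by rewrite mem_iota.
have i8' k : k \in iota 0 8 -> (k < 8)%N by rewrite mem_iota.
have l9 k i : (k < 8)%N -> i \in line_nth k -> (i < 9)%N.
  move=> k8 ik; have /andP[_ /allP h] := allP flat_table_wf (line_nth k) (line_nth_flat k8).
  exact: h.
have tri k1 k2 k3 i j m : (k1 < 8)%N -> (k2 < 8)%N -> (k3 < 8)%N -> triangle k1 k2 k3 i j m ->
    (exists2 a, a \in TA k1 & a \in TA k2) /\
    forall d, d \in TA k1 -> d \in TA k2 -> d \in TA k3 -> False.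
  move=> k18 k28 k38 /and3P[/and5P[i1 i2 j2 j3 /andP[m1 m3]] uijm uk].
  have e9 := l9 _ _ k18 i1; have f9 := l9 _ _ k28 j2; have g9 := l9 _ _ k18 m1.
  have mem e k : (e < 9)%N -> e \in line_nth k -> (inord e : 'I_9) \in lineset k.
    by move=> h ek; rewrite inE inordK.
  have im : (inord i : 'I_9) != inord m.
    rewrite -(inj_eq val_inj) /= !inordK //.
    by move: uijm; rewrite /= !inE !negb_or => /andP[/andP[_ ->]].
  move: uk; rewrite /= !inE !negb_or => /andP[/andP[k12 k13] _].
  apply: (@triangle_support _ _ _ _ (mapN (delta (inord i) (inord m)))
    (mapN (delta (inord j) (inord i))) (mapN (delta (inord m) (inord j)))).
  - by move=> a b a1 a2 b1 b2; apply: (TAmeet k1 k2).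
  - by move=> a b a1 a2 b1 b2; apply: (TAmeet k1 k3).
  - by apply: TAinv => //; apply: delta_balanced; apply: mem.
  - by apply: TAinv => //; apply: delta_balanced; apply: mem.
  - by apply: TAinv => //; apply: delta_balanced; apply: mem.
  - move=> x; rewrite /mapN -!big_split big1 // => y _ /=.
    by rewrite -!mulrDl /delta; ring.
  - apply: contrapT => no; apply: (delta_ne im); apply: mapN_eq0 => x.
    by apply/eqP/negPn/negP => h; apply: no; exists x.
have meets k k' i : (k < 8)%N -> (k' < 8)%N -> k != k' -> i \in line_nth k ->
    i \in line_nth k' -> exists2 a, a \in TA k & a \in TA k'.
  move=> k8 k'8 kk' ik ik'.
  have := allP (allP meet_triangle _ (i8 _ k8)) _ (i8 _ k'8).
  rewrite (negbTE kk') orFb => /orP[/hasPn/(_ _ ik)|]; first by rewrite ik'.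
  case/hasP=> k'' /i8' k''8 /hasP[a _ /hasP[b _ /hasP[c _ h]]].
  by have [] := tri _ _ _ _ _ _ k8 k'8 k''8 h.
(* If the pairwise meeting points were different, their differences would be a relation between the
   planes of the three lines, and [triangle_support] would forbid the common point [i]. *)
have conc k1 k2 k3 i : (k1 < 8)%N -> (k2 < 8)%N -> (k3 < 8)%N -> k1 != k2 -> k1 != k3 -> k2 != k3 ->
    i \in line_nth k1 -> i \in line_nth k2 -> i \in line_nth k3 ->
    exists a, [/\ a \in TA k1, a \in TA k2 & a \in TA k3].
  move=> k18 k28 k38 k12 k13 k23 i1 i2 i3.
  have [a a1 a2] := meets _ _ _ k18 k28 k12 i1 i2.
  have [b b2 b3] := meets _ _ _ k28 k38 k23 i2 i3.
  have [c c1 c3] := meets _ _ _ k18 k38 k13 i1 i3.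
  have [ac|ac] := eqVneq a c; first by exists a; rewrite {3}ac.
  have i9 := l9 _ _ k18 i1.
  have mem k : i \in line_nth k -> (inord i : 'I_9) \in lineset k by rewrite inE inordK.
  have [] := @triangle_support _ (lineset k1) (lineset k2) (lineset k3) (mapM (delta a c))
    (mapM (delta b a)) (mapM (delta c b)).
  - exact: lineset_meet.
  - exact: lineset_meet.
  - by apply: (TAim _ k18); apply: delta_balanced.
  - by apply: (TAim _ k28); apply: delta_balanced.
  - by apply: (TAim _ k38); apply: delta_balanced.
  - move=> x; rewrite /mapM -!big_split big1 // => y _ /=.
    by rewrite -!mulrDl /delta; ring.
  - apply: contrapT => no; apply: (delta_ne ac); apply: mapM_eq0 => x.
    by apply/eqP/negPn/negP => h; apply: no; exists x.
  by move=> _ /(_ (inord i) (mem _ i1) (mem _ i2) (mem _ i3)).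
(* An element lies on two or three of the lines, so its image is a meeting point given by [meets] or
   a point of concurrence given by [conc]. *)
have pt e : exists a, (e < 9)%N -> forall k, (k < 8)%N -> e \in line_nth k -> a \in TA k.
  case: (ltnP e 9) => [e9|e9]; last first.
    by exists (t 0%N).2.
  have e9' : e \in iota 0 9 by rewrite mem_iota.
  have inl k : (k \in lines_at e) = (k < 8)%N && (e \in line_nth k).
    by rewrite mem_filter mem_iota andbC.
  have ul : uniq (lines_at e) by rewrite filter_uniq ?iota_uniq.
  have := allP size_lines_at _ e9'; move: inl ul.
  case: (lines_at e) => [|k1 [|k2 [|k3 [|k4 s]]]] //= inl.
    rewrite !inE => /andP[k12 _] _.
    have /andP[k18 e1] : (k1 < 8)%N && (e \in line_nth k1) by rewrite -inl !inE eqxx.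
    have /andP[k28 e2] : (k2 < 8)%N && (e \in line_nth k2) by rewrite -inl !inE eqxx orbT.
    have [a a1 a2] := meets _ _ _ k18 k28 k12 e1 e2; exists a => _ k k8 ek.
    have : k \in [:: k1; k2] by rewrite inl k8.
    by rewrite in_cons mem_seq1 => /orP[] /eqP ->.
  rewrite !inE !negb_or => /and3P[/andP[k12 k13] k23 _] _.
  have /andP[k18 e1] : (k1 < 8)%N && (e \in line_nth k1) by rewrite -inl !inE eqxx.
  have /andP[k28 e2] : (k2 < 8)%N && (e \in line_nth k2) by rewrite -inl !inE eqxx orbT.
  have /andP[k38 e3] : (k3 < 8)%N && (e \in line_nth k3) by rewrite -inl !inE eqxx !orbT.
  have [a [a1 a2 a3]] := conc _ _ _ _ k18 k28 k38 k12 k13 k23 e1 e2 e3; exists a => _ k k8 ek.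
  have : k \in [:: k1; k2; k3] by rewrite inl k8.
  by rewrite 2!in_cons mem_seq1 => /or3P[] /eqP ->.
have /choice[p pP] := pt.
have pT k e : (k < 8)%N -> e \in line_nth k -> p e \in TA k.
  by move=> k8 ek; apply: pP => //; exact: l9 ek.
have pd k i j : (k < 8)%N -> i \in line_nth k -> j \in line_nth k -> i != j -> p i != p j.
  move=> k8 ik jk ij; apply/eqP => pij.
  have := allP (allP (allP edge_triangle _ (i8 _ k8)) _ ik) _ jk; rewrite (negbTE ij) orFb.
  case/hasP=> k1 /i8' k18 /hasP[k2 /i8' k28 /hasP[m _ h]].
  have [_ no] := tri _ _ _ _ _ _ k8 k18 k28 h.
  have /and3P[/and5P[_ i1 _ _ /andP[_ j2]] _ _] := h.
  by apply: (no (p i)); [exact: pT|exact: pT|rewrite pij; exact: pT].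
have i9 k : (k < 9)%N -> k \in iota 0 9 by rewrite mem_iota.
have pdist i j : (i < 9)%N -> (j < 9)%N -> i != j -> p i != p j.
  move=> i9' j9 ij; have := allP (allP apart _ (i9 _ i9')) _ (i9 _ j9); rewrite (negbTE ij) orFb.
  case/orP=> [/hasP[k /i8' k8 /andP[ik jk]]|]; first exact: (pd k).
  case/hasP=> k /i8' k8 /hasP[k' /i8' k'8 /hasP[f fk /and5P[kk' ik jk' fk' fj]]].
  apply/eqP => pij; move/eqP: (pd _ _ _ k'8 fk' jk' fj); apply.
  by apply: (TAmeet k k') => //; [exact: pT|exact: pT|rewrite -pij; exact: pT|exact: pT].
have pcol s : s \in line_table -> col (p s.1.1) (p s.1.2) (p s.2).
  move=> /(nthP (0, 0, 0)%N)[k k8 <-]; set q := nth _ _ _.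
  have [ab abc _] := tP k k8.
  have lE : line_nth k = [:: q.1.1; q.1.2; q.2] by rewrite /line_nth (line_tableE k8).
  have /andP[uq _] := allP flat_table_wf (line_nth k) (line_nth_flat k8).
  move: uq; rewrite lE /= !inE !negb_or => /and3P[/andP[h1 h2] h3 _].
  by apply: (col_set ab abc); first [apply: (pT k)|apply: (pd k)]; rewrite // lE !inE eqxx ?orbT.
have c678 := pappus pdist pcol.
have p67 := pdist 6 7 isT isT isT.
(* The ninth triple is mapped to some line [k], which puts [p 6] and [p 7] in [TA k]. The one that
   [k] misses then gives a second common point of [TA k] and some [TA k']. *)
have [k k8 kT] := col_image p67 c678.
have b67 : balanced (TA k) (delta (p 6%N) (p 7%N)).
  apply: eq_balanced (TAinv _ k8 _ (kT _ (delta_balanced _ _))) => [j|  |].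
  - by rewrite mapNM.
  - by rewrite !inE eqxx.
  - by rewrite !inE eqxx orbT.
have in67 e : e \in [:: 6; 7]%N -> p e \in TA k.
  rewrite in_cons mem_seq1 => he; apply: contraT => nT; have := b67.1 _ nT; rewrite /delta.
  by case/orP: he => /eqP ->; rewrite eqxx ?(eq_sym (p 7%N)) (negbTE p67) ?subr0 ?sub0r => /eqP;
    rewrite ?oppr_eq0 oner_eq0.
have /hasP[e e67 /hasP[k' /i8' k'8 /hasP[f fk /and4P[kk' ek' fk' fe]]]] := allP not_on_both _ (i8 _ k8).
move/eqP: (pd _ _ _ k'8 fk' ek' fe); apply.
by apply: (TAmeet k k') => //; [exact: pT|exact: pT|exact: in67|exact: pT].
Qed.

End Matroid.

(** * Pappus's theorem *)

Lemma solve3 (K : fieldType) (a b c A B C s t : K) : b != 0 -> s != 0 -> t != 0 ->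
  a * A + b * B + c * C = 0 -> B = - (a / (b * s)) * (s * A) + - (c / (b * t)) * (t * C).
Proof.
move=> b0 s0 t0 h; apply: (mulfI b0).
have -> : b * B = - (a * A) - c * C by rewrite -[RHS]add0r -h; ring.
by field; rewrite b0 s0 t0.
Qed.

(* Writing 6 = xX0 + yX4 = zX1 + wX3, the remaining incidences force, up to
   scalars, 7 = z(X0 + X1) + (y + w)X3 and 8 = x(X0 + X1) + (y + w)X4. *)
Lemma pappus_generic (K : fieldType) (Z : Type) (X0 X1 X3 X4 L6 L7 L8 : Z -> K)
    (x y z w x1 y1 z1 w1 x2 y2 z2 w2 : K) :
  x != 0 -> y != 0 -> z != 0 -> w != 0 -> x1 != 0 -> y1 != 0 -> w1 != 0 -> z2 != 0 ->
  (forall a b c, (forall t, a * X0 t + b * X1 t + c * X3 t = 0) -> [/\ a = 0, b = 0 & c = 0]) ->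
  (forall t, L6 t = x * X0 t + y * X4 t) -> (forall t, L6 t = z * X1 t + w * X3 t) ->
  (forall t, L7 t = x1 * X0 t + y1 * (X3 t + X4 t)) ->
  (forall t, L7 t = z1 * (X0 t + X1 t) + w1 * X3 t) ->
  (forall t, L8 t = x2 * X1 t + y2 * (X3 t + X4 t)) ->
  (forall t, L8 t = z2 * (X0 t + X1 t) + w2 * X4 t) ->
  exists a b c, [/\ a != 0, b != 0, c != 0 & forall t, a * L6 t + b * L7 t + c * L8 t = 0].
Proof.
move=> x0 y0 z0 w0 x10 y10 w10 z20 ind e1 e2 e3 e4 e5 e6.
(* [T] and [S] are the scalars by which [L7] and [L8] differ from their normal forms. *)
pose T := y1 / y; pose S := (w2 - y2) / y.
have X4E t : X4 t = (z * X1 t + w * X3 t - x * X0 t) / y.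
  by apply: (mulfI y0); rewrite [RHS]mulrC divfK // -e2 e1; ring.
have [h1 h2 h3] : [/\ x1 - z1 - T * x = 0, T * z - z1 = 0 & y1 + T * w - w1 = 0].
  apply: ind => t; have := e3 t; rewrite e4 X4E => /eqP; rewrite eq_sym -subr_eq0 => /eqP <-.
  by rewrite /T; field.
have [k1 k2 k3] : [/\ S * x - z2 = 0, x2 - z2 - S * z = 0 & y2 - S * w = 0].
  apply: ind => t; have := e5 t; rewrite e6 X4E => /eqP; rewrite eq_sym -subr_eq0 => /eqP <-.
  by rewrite /S; field.
have yT : y1 = T * y by rewrite /T divfK.
have yS : w2 = y2 + S * y by rewrite /S divfK // addrC subrK.
have T0 : T != 0 by rewrite /T mulf_neq0 ?invr_eq0.
have zS : z2 = S * x by apply/esym/eqP; rewrite -subr_eq0 k1.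
have S0 : S != 0 by apply: contraNneq z20 => S0; rewrite zS S0 mul0r.
have zT : z1 = T * z by apply/esym/eqP; rewrite -subr_eq0 h2.
have xT : x1 = T * (x + z).
  by apply/eqP; rewrite -subr_eq0 -h1 zT; apply/eqP; ring.
have wT : w1 = T * (y + w).
  by apply/esym/eqP; rewrite -subr_eq0 -h3 yT; apply/eqP; ring.
have yS2 : y2 = S * w by apply/eqP; rewrite -subr_eq0 k3.
have xz : x + z != 0 by apply: contraNneq x10 => h; rewrite xT h mulr0.
have yw : y + w != 0 by apply: contraNneq w10 => h; rewrite wT h mulr0.
exists (- ((x + z) * (y + w))), (x * w / T), (z * y / S); split.
- by rewrite oppr_eq0 mulf_neq0.
- by rewrite !mulf_neq0 ?invr_eq0.
- by rewrite !mulf_neq0 ?invr_eq0.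
move=> t; rewrite e2 e4 e6 X4E yS yS2 zS zT wT; field.
by rewrite y0 S0 T0.
Qed.

Section Forms.
Context {r n : nat}.
Variable l : 'I_n -> 'I_r -> CC.
Hypothesis l_indep : forall i j, i != j -> exists2 z, ev (l i) z = 0 & ev (l j) z != 0.
Hypothesis l_neq0 : forall i, exists z, ev (l i) z != 0.

Lemma lineA_rot a b c : lineA l a b c -> lineA l b c a.
Proof.
move=> [x [y [z [x0 y0 z0 h]]]]; exists y, z, x; split=> // t.
by rewrite -[RHS](h t); ring.
Qed.

Lemma lineA_swap a b c : lineA l a b c -> lineA l b a c.
Proof.
move=> [x [y [z [x0 y0 z0 h]]]]; exists y, x, z; split=> // t.
by rewrite -[RHS](h t); ring.
Qed.

Lemma lineA_neq a b c : a != b -> lineA l a b c -> c != a.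
Proof.
move=> ab [x [y [z [x0 y0 z0 h]]]]; apply/eqP => ca; have [t ta tb] := l_indep ab.
have := h t; rewrite ca ta !mulr0 add0r addr0 => /eqP.
by rewrite mulf_eq0 (negbTE y0) (negbTE tb).
Qed.

Lemma in_pencil u v w : u != v ->
  (forall z, ev (l u) z = 0 -> ev (l v) z = 0 -> ev (l w) z = 0) <->
  [\/ w = u, w = v | lineA l u v w].
Proof.
move=> uv; split; last first.
  case=> [->//|->//|[x [y [c [x0 y0 c0 h]]]]] z zu zv; have := h z.
  by rewrite zu zv !mulr0 !add0r => /eqP; rewrite mulf_eq0 (negbTE c0) => /eqP.
move=> h; have [zv zvu zvv] := l_indep uv.
have [|zu zuv zuu] := @l_indep v u; first by rewrite eq_sym.
pose A := ev (l w) zu / ev (l u) zu; pose B := ev (l w) zv / ev (l v) zv.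
have wE z : ev (l w) z = A * ev (l u) z + B * ev (l v) z.
  have := h (lin 1 (- (ev (l v) z / ev (l v) zv)) (lin 1 (- (ev (l u) z / ev (l u) zu)) z zu) zv).
  rewrite !ev_lin zvu zuv => /(_ _ _)/eqP.
  have -> : 1 * (1 * ev (l u) z + - (ev (l u) z / ev (l u) zu) * ev (l u) zu) +
      - (ev (l v) z / ev (l v) zv) * 0 = 0 by rewrite !mul1r mulr0 addr0 mulNr divfK // subrr.
  have -> : 1 * (1 * ev (l v) z + - (ev (l u) z / ev (l u) zu) * 0) +
      - (ev (l v) z / ev (l v) zv) * ev (l v) zv = 0 by rewrite !mul1r mulr0 addr0 mulNr divfK // subrr.
  move=> /(_ erefl erefl); rewrite -subr_eq0 => /eqP e; apply/eqP; rewrite -subr_eq0 -[X in _ == X]e.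
  by apply/eqP; rewrite /A /B; field; rewrite zuu zvv.
have [A0|A0] := eqVneq A 0.
  apply: Or32; apply/eqP/negPn/negP; rewrite eq_sym => /l_indep[z zv0].
  by rewrite wE A0 zv0 mul0r mulr0 addr0 eqxx.
have [B0|B0] := eqVneq B 0.
  apply: Or31; apply/eqP/negPn/negP; rewrite eq_sym => /l_indep[z zu0].
  by rewrite wE B0 zu0 mul0r mulr0 addr0 eqxx.
apply: Or33; exists A, B, (-1); split=> //.
by move=> z; rewrite wE; ring.
Qed.

(** A generic point of the intersection of two hyperplanes lies only on those hyperplanes that
    contain the whole intersection. *)
Lemma flatA_through u v : u != v -> exists2 F, flatA l F &
  forall w, w \in F <-> [\/ w = u, w = v | lineA l u v w].
Proof.
move=> uv; pose V : set (Cspace r) := [set z | ev (l u) z = 0 /\ ev (l v) z = 0].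
have [|||j|p Vp pP] := @generic_point r {w | ~~ `[< forall z, V z -> ev (l w) z = 0 >]}
    (fun j => ev (l (sval j))) V.
- by move=> j; apply: ev_linear.
- by exists (fun=> 0); rewrite /V /= /ev !big1 // => k _; rewrite mulr0.
- by move=> c d x y [xu xv] [yu yv]; rewrite /V /= !ev_lin xu xv yu yv !mulr0 addr0.
- have /asboolPn h := svalP j; apply: contrapT => no; apply: h => z Vz.
  by apply/eqP/negPn/negP => nz; apply: no; exists z.
exists (finset (fun w => ev (l w) p == 0)); first by exists p => j; rewrite inE.
move=> w; rewrite inE -(in_pencil w uv); split=> [/eqP wp|h]; last first.
  by apply/eqP; case: Vp; exact: h.
have [/asboolP h|h] := boolP `[< forall z, V z -> ev (l w) z = 0 >].
  by move=> z zu zv; apply: h.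
by have := pP (exist _ w h); rewrite /= wp eqxx.
Qed.

(** The forms are rescaled so that 2 becomes [X0 + X1] and 5 becomes [X3 + X4]; for independent
    [X0], [X1], [X3] this is the situation of [pappus_generic]. *)
Lemma pappus_forms (p : nat -> 'I_n) :
  (forall i j, (i < 9)%N -> (j < 9)%N -> i != j -> p i != p j) ->
  (forall t, t \in line_table -> lineA l (p t.1.1) (p t.1.2) (p t.2)) ->
  lineA l (p 6%N) (p 7%N) (p 8%N).
Proof.
move=> pd pl; pose L i z := ev (l (p i)) z.
have [a0 [b0 [c0 [a00 b00 c00 r0]]]] := pl (0, 1, 2)%N isT.
have [a1 [b1 [c1 [a10 b10 c10 r1]]]] := pl (0, 6, 4)%N isT.
have [a2 [b2 [c2 [a20 b20 c20 r2]]]] := pl (0, 7, 5)%N isT.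
have [a3 [b3 [c3 [a30 b30 c30 r3]]]] := pl (1, 6, 3)%N isT.
have [a4 [b4 [c4 [a40 b40 c40 r4]]]] := pl (1, 8, 5)%N isT.
have [a5 [b5 [c5 [a50 b50 c50 r5]]]] := pl (2, 7, 3)%N isT.
have [a6 [b6 [c6 [a60 b60 c60 r6]]]] := pl (2, 8, 4)%N isT.
have [a7 [b7 [c7 [a70 b70 c70 r7]]]] := pl (3, 4, 5)%N isT.
rewrite /= in r0 r1 r2 r3 r4 r5 r6 r7.
pose X0 z := a0 * L 0%N z; pose X1 z := b0 * L 1%N z.
pose X3 z := a7 * L 3%N z; pose X4 z := b7 * L 4%N z.
have X2E z : - c0 * L 2%N z = X0 z + X1 z by rewrite -[LHS]add0r -(r0 z) /X0 /X1 /L; ring.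
have X5E z : - c7 * L 5%N z = X3 z + X4 z by rewrite -[LHS]add0r -(r7 z) /X3 /X4 /L; ring.
have c00' : - c0 != 0 by rewrite oppr_eq0. have c70' : - c7 != 0 by rewrite oppr_eq0.
have e1 z := solve3 b10 a00 b70 (r1 z); have e2 z := solve3 b30 b00 a70 (r3 z).
have e3 z := solve3 b20 a00 c70' (r2 z); have e4 z := solve3 b50 c00' a70 (r5 z).
have e5 z := solve3 b40 b00 c70' (r4 z); have e6 z := solve3 b60 c00' b70 (r6 z).
have nz (a b c : RR[i]) : a != 0 -> b != 0 -> c != 0 -> - (a / (b * c)) != 0.
  by move=> h1 h2 h3; rewrite oppr_eq0 mulf_neq0 // invr_eq0 mulf_neq0.
have [ind|dep] := pselect (forall a b c, (forall t, a * X0 t + b * X1 t + c * X3 t = 0) ->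
    [/\ a = 0, b = 0 & c = 0]).
  apply: (@pappus_generic _ _ X0 X1 X3 X4 (L 6%N) (L 7%N) (L 8%N)
    (- (a1 / (b1 * a0))) (- (c1 / (b1 * b7))) (- (a3 / (b3 * b0))) (- (c3 / (b3 * a7)))
    (- (a2 / (b2 * a0))) (- (c2 / (b2 * - c7))) (- (a5 / (b5 * - c0))) (- (c5 / (b5 * a7)))
    (- (a4 / (b4 * b0))) (- (c4 / (b4 * - c7))) (- (a6 / (b6 * - c0))) (- (c6 / (b6 * b7))));
    try exact: nz; try exact: ind; move=> z; rewrite -?X2E -?X5E.
  - exact: e1.
  - exact: e2.
  - exact: e3.
  - exact: e4.
  - exact: e5.
  - exact: e6.
(* In the degenerate case the forms 6, 7, 8 lie in the span of [X0] and [X1]. Their relation has 2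
   by 2 minors as coefficients, which are nonzero since no two of the forms are proportional. *)
have ind2 a b : (forall t, a * X0 t + b * X1 t = 0) -> a = 0 /\ b = 0.
  move=> h; have [t t0 t1] := l_indep (pd 0 1 isT isT isT).
  have [s s1 s0] := l_indep (pd 1 0 isT isT isT).
  have := h t; have := h s; rewrite /X0 /X1 /L t0 s1 !mulr0 addr0 add0r => /eqP + /eqP.
  by rewrite !mulf_eq0 (negbTE a00) (negbTE b00) (negbTE s0) (negbTE t1) !orbF => /eqP + /eqP.
have [u3 [v3 X3E]] : exists u v, forall t, X3 t = u * X0 t + v * X1 t.
  apply: contrapT => no; apply: dep => a b c h.
  have [c_0|c_0] := eqVneq c 0.
    rewrite c_0 in h *; have [] // := ind2 a b; move=> t; rewrite -[RHS](h t); ring.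
  case: no; exists (- a / c), (- b / c) => t; apply: (mulfI c_0).
  have -> : c * X3 t = - (a * X0 t + b * X1 t) by rewrite -[LHS]subr0 -(h t); ring.
  by field.
have [u4 [v4 X4E]] : exists u v, forall t, X4 t = u * X0 t + v * X1 t.
  have y0 : c1 / (b1 * b7) != 0 by rewrite mulf_neq0 // invr_eq0 mulf_neq0.
  exists ((- (a1 / (b1 * a0)) + c3 / (b3 * a7) * u3) / (c1 / (b1 * b7))),
    ((a3 / (b3 * b0) + c3 / (b3 * a7) * v3) / (c1 / (b1 * b7))) => t.
  apply: (mulfI y0); rewrite -[LHS]addr0 -(subrr (L 6%N t)) {1}/L {1}e1 /L {1}e2.
  rewrite -/(L 0%N t) -/(L 4%N t) -/(L 3%N t) -/(L 1%N t) -/(X0 t) -/(X1 t) -/(X3 t) -/(X4 t) X3E.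
  by move: (c1 / _) (a1 / _) (a3 / _) (c3 / _) y0 => y A1 A3 C3 y0; field.
have sp c d (f g : Cspace r -> RR[i]) : (exists u v, forall t, f t = u * X0 t + v * X1 t) ->
    (exists u v, forall t, g t = u * X0 t + v * X1 t) ->
    exists u v, forall t, c * f t + d * g t = u * X0 t + v * X1 t.
  move=> [u [v h]] [u' [v' h']]; exists (c * u + d * u'), (c * v + d * v') => t.
  by rewrite h h'; ring.
have s0 : exists u v, forall t, X0 t = u * X0 t + v * X1 t.
  by exists 1, 0 => t; rewrite mul1r mul0r addr0.
have s1 : exists u v, forall t, X1 t = u * X0 t + v * X1 t.
  by exists 0, 1 => t; rewrite mul1r mul0r add0r.
have s3 : exists u v, forall t, X3 t = u * X0 t + v * X1 t by exists u3, v3.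
have s4 : exists u v, forall t, X4 t = u * X0 t + v * X1 t by exists u4, v4.
have s5 : exists u v, forall t, X3 t + X4 t = u * X0 t + v * X1 t.
  by have [u [v h]] := sp 1 1 _ _ s3 s4; exists u, v => t; rewrite -h !mul1r.
have [u6 [v6 L6E]] : exists u v, forall t, L 6%N t = u * X0 t + v * X1 t.
  have [u [v h]] := sp (- (a1 / (b1 * a0))) (- (c1 / (b1 * b7))) _ _ s0 s4.
  by exists u, v => t; rewrite -h; exact: e1.
have [u7 [v7 L7E]] : exists u v, forall t, L 7%N t = u * X0 t + v * X1 t.
  have [u [v h]] := sp (- (a2 / (b2 * a0))) (- (c2 / (b2 * - c7))) _ _ s0 s5.
  by exists u, v => t; rewrite -h -X5E; exact: e3.
have [u8 [v8 L8E]] : exists u v, forall t, L 8%N t = u * X0 t + v * X1 t.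
  have [u [v h]] := sp (- (a4 / (b4 * b0))) (- (c4 / (b4 * - c7))) _ _ s1 s5.
  by exists u, v => t; rewrite -h -X5E; exact: e5.
have det i j u v u' v' : (i < 9)%N -> (j < 9)%N -> i != j ->
    (forall t, L i t = u * X0 t + v * X1 t) -> (forall t, L j t = u' * X0 t + v' * X1 t) ->
    u * v' - u' * v != 0.
  move=> i9 j9 ij iE jE; apply/eqP => D; have [t ti tj] := l_indep (pd i j i9 j9 ij).
  rewrite -/(L i t) -/(L j t) in ti tj.
  have u0 : u * L j t = 0.
    have -> : u * L j t = u' * L i t + (u * v' - u' * v) * X1 t by rewrite iE jE; ring.
    by rewrite D ti mulr0 mul0r addr0.
  have v0 : v * L j t = 0.
    have -> : v * L j t = v' * L i t - (u * v' - u' * v) * X0 t by rewrite iE jE; ring.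
    by rewrite D ti mulr0 mul0r subr0.
  move/eqP: u0; move/eqP: v0; rewrite !mulf_eq0 (negbTE tj) !orbF => /eqP v0 /eqP u0.
  have [s] := l_neq0 (p i); rewrite -/(L i s) iE u0 v0 !mul0r addr0 eqxx //.
exists (u7 * v8 - u8 * v7), (u8 * v6 - u6 * v8), (u6 * v7 - u7 * v6); split.
- exact: det L7E L8E.
- exact: det L8E L6E.
- exact: det L6E L7E.
by move=> t; rewrite -/(L 6%N t) -/(L 7%N t) -/(L 8%N t) L6E L7E L8E; ring.
Qed.

End Forms.

(* For every base point p of |Q|, every r, every arrangement A of linear
   hyperplanes in C^r and every base point z of its complement,
   pi_1(|Q|, p) is not isomorphic to pi_1(C^r \ U A, z). *)
Theorem theorem5p5 :
  forall (p : realization_space), geom_realization_Q p ->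
  forall (r : nat) (A : seq ('I_r -> CC)),
    (forall a, a \in A -> nonzero_form a) ->
  forall (z : Cspace r), arrangement_complement A z ->
    ~ pi1_isomorphic geom_realization_Q p (arrangement_complement A) z.
Proof.
move=> p pQ r A A0 z zA iso.
have [n [l [l1 l2 lM]]] := reduced_family A0; rewrite -lM in zA iso.
have [alpha aQ] := QQ_spec.
have s1 := spec_transfer pQ QQ_connected aQ.
have s2 := spec_transfer zA (@Mset_connected _ _ l) (A_spec l1 l2).
have [M [N [MN NM Mline Nline]]] := spec_iso iso s1 s2.
apply: (@no_nonpappus 'I_n (flatA l) (lineA l) M N MN NM Mline Nline).
- exact: flatA_through.
- exact: lineA_rot.
- exact: lineA_swap.
- exact: lineA_neq.
- exact: pappus_forms.
Qed.
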